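(* Let $\gamma<0$ and $B>\gamma^2/4$. Suppose that $\psi\in\dot H^1(\mathbb{R};\mathbb{R})\cap L^6(\mathbb{R};\mathbb{R})$ is a sufficiently smooth solution of $$-\psi''+B|\psi|^4\psi+\gamma\psi\,|D|(|\psi|^2)=0\quad\text{on }\mathbb{R}.$$ Then $\psi\equiv0$.
   Context: $|D|=\partial_x\mathcal{H}=\mathcal{H}\partial_x$, where $\mathcal{H}f(x)=\frac1\pi\,\mathrm{p.v.}\int_{\mathbb{R}}\frac{f(y)}{x-y}\,dy$ is the Hilbert transform on $\mathbb{R}$ (Fourier symbol $-i\,\mathrm{sgn}\,\xi$). $\dot H^1\cap L^6$ consists of the $f\in L^6$ with weak derivative $f'\in L^2$. *)

(* Defs.v *)
From HB Require Import structures.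
From mathcomp Require Import all_boot all_order all_algebra.
From mathcomp Require Import all_classical all_reals all_analysis.
Set Implicit Arguments.
Unset Strict Implicit.
Unset Printing Implicit Defensive.
Import Order.TTheory GRing.Theory Num.Theory.
Import numFieldNormedType.Exports.
Local Open Scope ring_scope.
Local Open Scope classical_set_scope.

Section definitions.
Context {R : realType}.
Local Notation mu := (@lebesgue_measure R).

Definition class_C (k : nat) (f : R -> R) : Prop :=
  (forall j : nat, (j < k)%N -> forall x : R, derivable f^`(j) x 1) /\
  continuous f^`(k).

Definition test_function (phi : R -> R) : Prop :=
  (forall k : nat, class_C k phi) /\ compact (closure [set x | phi x != 0]).

(* Only meant for locally integrable f and g: [Rintegral] is a total function,
   with a meaningless value on non-integrable integrands. *)
Definition weak_derivative (f g : R -> R) : Prop :=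
  forall phi : R -> R, test_function phi ->
    \int[mu]_x (f x * (phi^`())%classic x) = - \int[mu]_x (g x * phi x).

(* The intersection of L^6 with the homogeneous Sobolev space of order 1. *)
Definition dotH1_L6 (f : R -> R) : Prop :=
  f \in Lfun mu 6%:E /\
  exists2 g : R -> R, g \in Lfun mu 2%:E & weak_derivative f g.

(* The principal value truncates only at the singularity y = x: for f in L^p
   with 1 <= p < oo, the truncated integrals converge absolutely at infinity.
   The value is meaningless at points where the limit does not exist; it exists
   at every point where such an f is differentiable. *)
Definition hilbert (f : R -> R) (x : R) : R :=
  pi^-1 * lim ((fun e : R =>
    \int[mu]_(y in [set y | e < `|x - y|]) (f y / (x - y))) @ 0^'+).

Definition absD (f : R -> R) : R -> R := hilbert f^`().

End definitions.

(* Main.v *)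
(** With c = - gamma, rho = psi^2, K = int psi'^2 and S = int psi^6, testing the
    equation against psi gives K + B S = c int rho |D| rho. For a > 0, expand
    0 <= int (psi' + (a / pi) v psi)^2 with v = pi H rho, and use the identity
    int rho (H rho)^2 = (1/3) int rho^3 (the sum of 1/((x-y)(x-z)) over cyclic
    permutations vanishes off the diagonal and has total mass pi^2 on it): this
    yields a int rho |D| rho <= K + (a^2/3) S, hence the virial inequality
    a (K + B S) <= c (K + (a^2/3) S). Testing against x psi' gives the Pohozaev
    inequality K <= (B/3) S, because int x rho' (H rho') = (int rho')^2 / (2 pi)
    vanishes. For a = 2B/c the two inequalities and 4B > c^2 force S <= 0.

    Decay at infinity is not known, so both computations are localized by the
    cutoff 1 - x^2/N^2, H is replaced by the convolution with t/(t^2 + e^2), and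
    the multiplier x by x/(x^2 + n^2), whose difference quotient has rank two.
    That psi' is square integrable follows from the weak derivative by
    mollification and Fatou's lemma. *)

Require Import Defs.
From HB Require Import structures.
From mathcomp Require Import all_boot all_order all_algebra.
From mathcomp Require Import all_classical all_reals all_analysis.
From mathcomp Require Import measurable_realfun.
From mathcomp Require Import ring lra.
Set Implicit Arguments.
Unset Strict Implicit.
Unset Printing Implicit Defensive.
Import Order.TTheory GRing.Theory Num.Theory.
Import numFieldNormedType.Exports.
Local Open Scope ring_scope.
Local Open Scope classical_set_scope.

(** * Integrable real-valued functions *)

Section real_integrable.
Context d (T : measurableType d) (R : realType).
Variable mu : {measure set T -> \bar R}.
Implicit Types f g : T -> R.

(** What is at hand is weak: rho = psi^2 is bounded, rho^3 is integrable and rho' is square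
    integrable, but rho itself need not be integrable, so neither the cubic form in rho nor the
    pairing with x rho' converges absolutely. This fixes the order of the limits: e to 0 under a
    fixed cutoff N, where the localization error is O(e) or O(sqrt e); then N to infinity by
    dominated convergence; and, for Pohozaev only, n to infinity at the end. The kernel t/(t^2 +
    e^2) is preferred to a truncation because its cyclic sum is, for every e > 0, a nonnegative
    kernel of mass exactly pi^2. The constant 1/3 then comes from AM-GM at fixed e, as an upper
    bound, with no limit to justify. Upper bounds are all that the final algebra uses. In particular
    the rank-two form of the Pohozaev computation is a difference of two squares, of which the
    subtracted one is dropped and the other one tends to 0. *)

Definition rintegrable f := mu.-integrable setT (EFin \o f).

Lemma rintegrable_measurable f : rintegrable f -> measurable_fun setT f.
Proof. by move=> /integrableP[/measurable_EFinP]. Qed.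

Lemma rintegrableD f g :
  rintegrable f -> rintegrable g -> rintegrable (fun x => f x + g x).
Proof. by move=> hf hg; exact: (integrableD measurableT hf hg). Qed.

Lemma rintegrableZ k f : rintegrable f -> rintegrable (fun x => k * f x).
Proof. by move=> hf; exact: (integrableZl measurableT k hf). Qed.

Lemma rintegrableN f : rintegrable f -> rintegrable (fun x => - f x).
Proof. by move=> hf; exact: (integrableN hf). Qed.

Lemma rintegrableB f g :
  rintegrable f -> rintegrable g -> rintegrable (fun x => f x - g x).
Proof. by move=> hf /rintegrableN; exact: rintegrableD. Qed.

Lemma le_rintegrable f g : measurable_fun setT f ->
  (forall x, `|f x| <= g x) -> rintegrable g -> rintegrable f.
Proof.
move=> mf fg hg; apply: le_integrable hg => //; first exact/measurable_EFinP.
by move=> x _; rewrite /= lee_fin (le_trans (fg x))// ler_norm.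
Qed.

Lemma le_rintegral f g : rintegrable f -> rintegrable g ->
  (forall x, f x <= g x) -> \int[mu]_x f x <= \int[mu]_x g x.
Proof. by move=> hf hg fg; apply: le_Rintegral. Qed.

Lemma rintegralD f g : rintegrable f -> rintegrable g ->
  \int[mu]_x (f x + g x) = \int[mu]_x f x + \int[mu]_x g x.
Proof. exact: RintegralD. Qed.

Lemma rintegralB f g : rintegrable f -> rintegrable g ->
  \int[mu]_x (f x - g x) = \int[mu]_x f x - \int[mu]_x g x.
Proof. exact: RintegralB. Qed.

Lemma rintegralZ k f : rintegrable f ->
  \int[mu]_x (k * f x) = k * \int[mu]_x f x.
Proof. exact: RintegralZl. Qed.

Lemma rintegral_EFin f : rintegrable f ->
  (\int[mu]_x (f x)%:E)%E = (\int[mu]_x f x)%:E.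
Proof. by move=> hf; rewrite /Rintegral fineK//; exact: integrable_fin_num. Qed.

Lemma rdominated (f_ : nat -> T -> R) f g :
  (forall n, measurable_fun setT (f_ n)) ->
  (forall x, f_ ^~ x @ \oo --> f x) ->
  (forall n x, `|f_ n x| <= g x) -> rintegrable g ->
  rintegrable f /\ (fun n => \int[mu]_x f_ n x) @ \oo --> \int[mu]_x f x.
Proof.
move=> mf cf bf ig.
have mlim : measurable_fun setT f.
  by apply: (measurable_fun_cvg mf) => x _; exact: cf.
have cE x : (EFin \o f_ ^~ x) @ \oo --> (f x)%:E.
  by apply: cvg_EFin; [exact: nearW|exact: cf].
have [h1 h2 h3] := @dominated_convergence _ _ _ mu setT measurableT
  (fun n x => (f_ n x)%:E) (EFin \o f) (EFin \o g)
  (fun n => (measurable_EFinP _ _).2 (mf n)) ((measurable_EFinP _ _).2 mlim)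
  (aeW mu (fun x _ => cE x)) ig (aeW mu (fun x n _ => bf n x)).
split; first exact: h1.
by apply: fine_cvg => /=; rewrite -rintegral_EFin.
Qed.

Lemma rintegral_norm_le f g : rintegrable f -> rintegrable g ->
  (forall x, `|f x| <= g x) -> `|\int[mu]_x f x| <= \int[mu]_x g x.
Proof.
move=> jf ig le; rewrite ler_norml; apply/andP; split.
  rewrite lerNl -mulN1r -(rintegralZ (-1) jf).
  apply: (le_rintegral (rintegrableZ (-1) jf) ig) => w; rewrite mulN1r.
  by apply: le_trans (le w); rewrite -normrN ler_norm.
by apply: (le_rintegral jf ig) => w; apply: le_trans (le w); exact: ler_norm.
Qed.

End real_integrable.

Lemma cvg_fun_lim_le (R : realType) (u : nat -> R) (l c : R) :
  u @ \oo --> l -> (forall n, u n <= c) -> l <= c.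
Proof.
by move=> ul uc; rewrite -(cvg_lim _ ul)//; apply: limr_le; [apply/cvg_ex; exists l|exact: nearW].
Qed.

(** * Invariance of Lebesgue measure under translation and reflection *)

Section lebesgue.
Context {R : realType}.
Local Notation mu := (@lebesgue_measure R).
Local Notation rint := (rintegrable mu).
Implicit Types f g : R -> R.

Let measurable_shift c : @measurable_fun _ _ (measurableTypeR R)
  (measurableTypeR R) setT (fun x : R => x + c).
Proof. by apply: measurable_funD. Qed.

Let measurable_opp : @measurable_fun _ _ (measurableTypeR R)
  (measurableTypeR R) setT (fun x : R => - x).
Proof. exact: oppr_measurable. Qed.

(** By uniqueness of Lebesgue measure it is enough to compare the two measures on half-open
    intervals. Packing the map as a measurable function lets its pushforward be inferred to be a
    measure. *)
Lemma lebesgue_measure_shift (c : R) (A : set R) : measurable A ->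
  mu A = pushforward mu (fun x : R => x + c) A.
Proof.
have mphi := measurable_shift c.
pose phi : {mfun measurableTypeR R >-> measurableTypeR R} :=
  HB.pack (fun x : R => x + c) (isMeasurableFun.Build _ _ _ _ _ mphi).
move=> mA; have := @lebesgue_measure_unique R (pushforward mu phi).
apply => // X [[a b]] /= _ <-.
rewrite /pushforward.
have -> : (fun x : R => x + c) @^-1` `]a, b] = `]a - c, b - c]%classic.
  by apply/seteqP; split => x /=; rewrite !in_itv/=; lra.
rewrite !lebesgue_measure_itv/= !lte_fin ltrD2r -!EFinD.
by case: ifP => // _; congr EFin; ring.
Qed.

Lemma lebesgue_measure_opp (A : set R) : measurable A ->
  mu A = pushforward mu (fun x : R => - x) A.
Proof.
have mphi := measurable_opp.
pose phi : {mfun measurableTypeR R >-> measurableTypeR R} :=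
  HB.pack (fun x : R => - x) (isMeasurableFun.Build _ _ _ _ _ mphi).
move=> mA; have := @lebesgue_measure_unique R (pushforward mu phi).
apply => // X [[a b]] /= _ <-.
rewrite /pushforward.
have -> : (fun x : R => - x) @^-1` `]a, b] = `[- b, - a[%classic.
  by apply/seteqP; split => x /=; rewrite !in_itv/=; lra.
rewrite !lebesgue_measure_itv/= !lte_fin ltrN2 -!EFinD.
by case: ifP => // _; congr EFin; ring.
Qed.

Lemma ge0_integral_shift (f : R -> \bar R) (c : R) : measurable_fun setT f ->
  (forall x, 0 <= f x)%E ->
  (\int[mu]_x f ((x : R) + c)%R = \int[mu]_x f x)%E.
Proof.
move=> mf f0.
have mphi := measurable_shift c.
have := @ge0_integral_pushforward _ _ _ _ R _ mphi mu setT f measurableT mf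
  (fun y _ => f0 y).
rewrite preimage_setT => <-.
by apply: eq_measure_integral => A mA _; apply/esym/lebesgue_measure_shift.
Qed.

Lemma ge0_integral_opp (f : R -> \bar R) : measurable_fun setT f ->
  (forall x, 0 <= f x)%E ->
  (\int[mu]_x f (- (x : R))%R = \int[mu]_x f x)%E.
Proof.
move=> mf f0.
have mphi := measurable_opp.
have := @ge0_integral_pushforward _ _ _ _ R _ mphi mu setT f measurableT mf
  (fun y _ => f0 y).
rewrite preimage_setT => <-.
by apply: eq_measure_integral => A mA _; apply/esym/lebesgue_measure_opp.
Qed.

Lemma ge0_integral_reflect (f : R -> \bar R) (c : R) : measurable_fun setT f ->
  (forall x, 0 <= f x)%E ->
  (\int[mu]_x f (c - (x : R))%R = \int[mu]_x f x)%E.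
Proof.
move=> mf f0.
rewrite -(ge0_integral_opp mf f0) -(@ge0_integral_shift (fun x => f (- x)) (- c)).
- by apply: eq_integral => x _; rewrite opprD opprK addrC.
- exact: measurableT_comp.
- by [].
Qed.

Lemma rintegrable_shift f c : rint f -> rint (fun x => f (x + c)).
Proof.
move=> /integrableP[mf hf].
have mphi := measurable_shift c.
apply/integrableP; split; first exact: (measurableT_comp mf mphi).
rewrite (@ge0_integral_shift (fun x => `|(f x)%:E|%E) c)//.
exact: measurableT_comp.
Qed.

Lemma rintegrable_opp f : rint f -> rint (fun x => f (- x)).
Proof.
move=> /integrableP[mf hf].
have mphi := measurable_opp.
apply/integrableP; split; first exact: (measurableT_comp mf mphi).
rewrite (@ge0_integral_opp (fun x => `|(f x)%:E|%E))//.
exact: measurableT_comp.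
Qed.

Lemma rintegrable_reflect f c : rint f -> rint (fun x => f (c - x)).
Proof.
move=> /(rintegrable_shift c)/rintegrable_opp; apply: eq_integrable => // x _.
by rewrite /= addrC.
Qed.

Lemma rintegral_shift f c : rint f ->
  \int[mu]_x f ((x : R) + c)%R = \int[mu]_x f x.
Proof.
move=> hf.
have mphi := measurable_shift c.
have := @integral_pushforward _ _ _ _ R _ mphi mu setT (EFin \o f)
  (measurable_int mu hf).
rewrite preimage_setT => /(_ (rintegrable_shift c hf) measurableT) h.
rewrite /Rintegral; congr fine; rewrite -[LHS]h.
by apply: eq_measure_integral => A mA _; apply/esym/lebesgue_measure_shift.
Qed.

Lemma rintegral_opp f : rint f -> \int[mu]_x f (- (x : R))%R = \int[mu]_x f x.
Proof.
move=> hf.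
have mphi := measurable_opp.
have := @integral_pushforward _ _ _ _ R _ mphi mu setT (EFin \o f)
  (measurable_int mu hf).
rewrite preimage_setT => /(_ (rintegrable_opp hf) measurableT) h.
rewrite /Rintegral; congr fine; rewrite -[LHS]h.
by apply: eq_measure_integral => A mA _; apply/esym/lebesgue_measure_opp.
Qed.

Lemma rintegral_reflect f c : rint f -> \int[mu]_x f (c - (x : R))%R = \int[mu]_x f x.
Proof.
move=> hf; rewrite -(rintegral_shift c hf) -(rintegral_opp (rintegrable_shift c hf)).
by apply: eq_Rintegral => x _; rewrite addrC.
Qed.

End lebesgue.

(** * Integrals over the plane *)

Section product.
Context {R : realType}.
Local Notation mu := (@lebesgue_measure R).
Local Notation rint := (rintegrable mu).
Local Notation mu2 := (mu \x mu)%E.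
Local Notation rint2 := (rintegrable mu2).
Implicit Types (a b : R -> R) (F : R * R -> R).

Lemma rintegral_ge0_lty a : rint a -> (\int[mu]_x `|(a x)%:E| < +oo)%E.
Proof. by move=> /integrableP[]. Qed.

Lemma rintegrable_prod a b : rint a -> rint b ->
  rint2 (fun z => a z.1 * b z.2).
Proof.
move=> ha hb.
have ma := rintegrable_measurable ha; have mb := rintegrable_measurable hb.
have mF : measurable_fun setT
    (fun z : measurableTypeR R * measurableTypeR R => a z.1 * b z.2).
  by apply: measurable_funM; exact: measurableT_comp.
apply/integrable12ltyP; first exact/measurable_EFinP.
rewrite (eq_integral (fun x : measurableTypeR R => (\int[mu]_y `|(b y)%:E|) * `|(a x)%:E|)%E).
  have hb' := rintegral_ge0_lty hb.
  have b0 : (0 <= \int[mu]_y `|(b y)%:E|)%E by exact: integral_ge0.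
  rewrite -(@fineK _ (\int[mu]_y `|(b y)%:E|)%E) ?ge0_fin_numE//.
  rewrite ge0_integralZl//.
  - by rewrite lte_mul_pinfty// ?fin_numE//; [exact: fine_ge0|exact: rintegral_ge0_lty].
  - by apply: measurableT_comp => //; exact/measurable_EFinP.
  - by rewrite lee_fin; exact: fine_ge0.
move=> x _; rewrite muleC -ge0_integralZl//.
- by apply: eq_integral => y _; rewrite /= normrM.
- by apply: measurableT_comp => //; exact/measurable_EFinP.
Qed.

Lemma rintegrable_conv a b : rint a -> rint b ->
  rint2 (fun z => a z.1 * b (z.1 - z.2)).
Proof.
move=> ha hb.
have ma := rintegrable_measurable ha; have mb := rintegrable_measurable hb.
have mF : measurable_fun setT
    (fun z : measurableTypeR R * measurableTypeR R => a z.1 * b (z.1 - z.2)).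
  apply: measurable_funM; first exact: measurableT_comp.
  apply: (measurableT_comp mb).
  by apply: measurable_funB; [exact: measurable_fst|exact: measurable_snd].
apply/integrable12ltyP; first exact/measurable_EFinP.
rewrite (eq_integral (fun x : measurableTypeR R => (\int[mu]_y `|(b y)%:E|) * `|(a x)%:E|)%E).
  have hb' := rintegral_ge0_lty hb.
  have b0 : (0 <= \int[mu]_y `|(b y)%:E|)%E by exact: integral_ge0.
  rewrite -(@fineK _ (\int[mu]_y `|(b y)%:E|)%E) ?ge0_fin_numE//.
  rewrite ge0_integralZl//.
  - by rewrite lte_mul_pinfty// ?fin_numE//; [exact: fine_ge0|exact: rintegral_ge0_lty].
  - by apply: measurableT_comp => //; exact/measurable_EFinP.
  - by rewrite lee_fin; exact: fine_ge0.
have mb' : measurable_fun setT (fun y : R => `|(b y)%:E|%E).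
  by apply: measurableT_comp => //; exact/measurable_EFinP.
move=> x _; rewrite -(@ge0_integral_reflect _ (fun y => `|(b y)%:E|%E) x)//.
rewrite muleC -ge0_integralZl//.
- by apply: eq_integral => y _; rewrite /= normrM.
- apply: (measurableT_comp mb').
  by apply: measurable_funB => //.
Qed.

(** The inner extended integral is finite only almost everywhere. On the exceptional null set [fine]
    returns 0, which never increases the absolute value, so the real-valued inner integral inherits
    integrability and has the same integral. *)
Lemma rfubini1 F : rint2 F ->
  rint (fun x => \int[mu]_y F (x, y)) /\
  \int[mu]_x \int[mu]_y F (x, y) = \int[mu2]_z F z.
Proof.
move=> hF.
have iG := integrable_fubini_F hF.
have aeG := integrable_ae measurableT iG.
have mfine : measurable_fun setT (fun x : measurableTypeR R => \int[mu]_y F (x, y)).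
  exact: (measurableT_comp (fine_measurable measurableT) (measurable_int _ iG)).
have E : ae_eq mu setT (fubini_F mu (EFin \o F))
    (fun x => (\int[mu]_y F (x, y))%:E).
  by apply: filterS aeG => x /= /(_ I) fx _; rewrite /Rintegral fineK.
have iG' : rint (fun x => \int[mu]_y F (x, y)).
  apply: le_integrable iG => //; first exact/measurable_EFinP.
  move=> x _; rewrite /= /Rintegral /fubini_F/=.
  by case: (\int[mu]_y (F (x, y))%:E)%E => [r| |]//=; rewrite normr0 leey.
split => //.
rewrite /Rintegral; congr fine; rewrite -(integral12_prod_meas1 hF).
apply/esym.
apply: (@ae_eq_integral _ _ _ mu setT _ _ measurableT _ _ E).
exact: measurable_int iG.
exact/measurable_EFinP.
Qed.

Lemma rintegrable_swap F : rint2 F -> rint2 (fun z => F (z.2, z.1)).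
Proof.
move=> hF.
have mF := rintegrable_measurable hF.
have ms : measurable_fun setT
  (fun z : measurableTypeR R * measurableTypeR R => (z.2, z.1)).
  by apply/measurable_fun_pairP; split => /=; [exact: measurable_snd|exact: measurable_fst].
have mF' : measurable_fun setT
  (fun z : measurableTypeR R * measurableTypeR R => F (z.2, z.1)).
  exact: (measurableT_comp mF ms).
apply/integrable12ltyP; first exact/measurable_EFinP.
by have /integrable21ltyP := hF; apply; exact/measurable_EFinP.
Qed.

Lemma rintegral_swap F : rint2 F ->
  \int[mu2]_z F (z.2, z.1) = \int[mu2]_z F z.
Proof.
move=> hF; rewrite /Rintegral; congr fine.
by rewrite -(integral21_prod_meas1 hF) -(integral12_prod_meas1 (rintegrable_swap hF)).
Qed.

Lemma rfubini2 F : rint2 F ->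
  rint (fun y => \int[mu]_x F (x, y)) /\
  \int[mu]_y \int[mu]_x F (x, y) = \int[mu2]_z F z.
Proof. by move=> hF; rewrite -rintegral_swap//; exact: rfubini1 (rintegrable_swap hF). Qed.

Lemma rintegral_prod a b : rint a -> rint b ->
  \int[mu2]_z (a z.1 * b z.2) = (\int[mu]_x a x) * \int[mu]_y b y.
Proof.
move=> ha hb; rewrite -(rfubini1 (rintegrable_prod ha hb)).2 mulrC -rintegralZ//.
by apply: eq_Rintegral => x _ /=; rewrite rintegralZ// mulrC.
Qed.

Lemma rintegral_conv a b : rint a -> rint b ->
  \int[mu2]_z (a z.1 * b (z.1 - z.2)) = (\int[mu]_x a x) * \int[mu]_y b y.
Proof.
move=> ha hb; rewrite -(rfubini1 (rintegrable_conv ha hb)).2 mulrC -rintegralZ//.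
apply: eq_Rintegral => x _ /=; rewrite rintegralZ//; last exact: rintegrable_reflect.
by rewrite rintegral_reflect// mulrC.
Qed.

End product.

(** * Calculus on the line *)

Section calculus.
Context {R : realType}.
Implicit Types (F G f g : R -> R) (x a b c : R).

Lemma continuous_cst c : continuous (fun _ : R => c).
Proof. by move=> x; exact: cvg_cst. Qed.

Lemma continuousDf f g :
  continuous f -> continuous g -> continuous (fun x => f x + g x).
Proof. by move=> cf cg x; exact: (cvgD (cf x) (cg x)). Qed.

Lemma continuousNf f : continuous f -> continuous (fun x => - f x).
Proof. by move=> cf x; exact: (cvgN (cf x)). Qed.

Lemma continuousBf f g :
  continuous f -> continuous g -> continuous (fun x => f x - g x).
Proof. by move=> cf cg; apply: continuousDf => //; exact: continuousNf. Qed.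

Lemma continuousMf f g :
  continuous f -> continuous g -> continuous (fun x => f x * g x).
Proof. by move=> cf cg x; exact: (cvgM (cf x) (cg x)). Qed.

Lemma continuousXf f n : continuous f -> continuous (fun x => f x ^+ n).
Proof.
move=> cf; elim: n => [|n IH]; first exact: continuous_cst.
by under eq_fun do rewrite exprS; exact: continuousMf.
Qed.

Lemma continuousVf f :
  continuous f -> (forall x, f x != 0) -> continuous (fun x => (f x)^-1).
Proof. by move=> cf f0 x; exact: (cvgV (f0 x) (cf x)). Qed.

Lemma continuous_compf f g :
  continuous f -> continuous g -> continuous (fun x => f (g x)).
Proof. by move=> cf cg x; exact: (continuous_comp (cg x) (cf (g x))). Qed.

Lemma continuous_idf : continuous (fun x : R => x).
Proof. by move=> x; exact: cvg_id. Qed.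

Lemma deriveDf F G x a b : is_derive x 1 F a -> is_derive x 1 G b ->
  is_derive x 1 (fun y => F y + G y) (a + b).
Proof. exact: is_deriveD. Qed.

Lemma deriveNf F x a : is_derive x 1 F a -> is_derive x 1 (fun y => - F y) (- a).
Proof. exact: is_deriveN. Qed.

Lemma deriveBf F G x a b : is_derive x 1 F a -> is_derive x 1 G b ->
  is_derive x 1 (fun y => F y - G y) (a - b).
Proof. exact: is_deriveB. Qed.

Lemma deriveMf F G x a b : is_derive x 1 F a -> is_derive x 1 G b ->
  is_derive x 1 (fun y => F y * G y) (F x * b + G x * a).
Proof. exact: is_deriveM. Qed.

Lemma deriveXf F n x a : is_derive x 1 F a ->
  is_derive x 1 (fun y => F y ^+ n) (n%:R * F x ^+ n.-1 * a).
Proof.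
move=> h; have -> : (fun y => F y ^+ n) = F ^+ n.
  by apply/funext => y; elim: n => // n IH; rewrite !exprS IH.
exact: is_deriveX.
Qed.

Lemma deriveVf F x a : is_derive x 1 F a -> F x != 0 ->
  is_derive x 1 (fun y => (F y)^-1) (- a / F x ^+ 2).
Proof.
move=> [dF Fa] F0; split; first exact: derivableV.
by rewrite deriveV// Fa scaleNr -mulrN mulrC.
Qed.

Lemma derive_cstf c x : is_derive x 1 (fun _ : R => c) 0.
Proof. exact: is_derive_cst. Qed.

Lemma derive_idf x : is_derive x 1 (fun y : R => y) 1.
Proof. exact: is_derive_id. Qed.

Lemma derive_compf F G x a b : is_derive (G x) 1 F a -> is_derive x 1 G b ->
  is_derive x 1 (fun y => F (G y)) (a * b).
Proof. exact: is_derive1_comp. Qed.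

Lemma derive_eqf F x a b : is_derive x 1 F a -> a = b -> is_derive x 1 F b.
Proof. by move=> h <-. Qed.

Lemma derive_continuousf F f : (forall x : R, is_derive x 1 F (f x)) -> continuous F.
Proof.
move=> h x; apply: differentiable_continuous; apply/derivable1_diffP.
exact: ex_derive.
Qed.

End calculus.

Ltac contf := repeat first
  [ assumption | exact: continuous_cst | exact: continuous_idf
  | apply: continuousXf | apply: continuousDf | apply: continuousNf
  | apply: continuousMf ].

(** * The fundamental theorem of calculus on intervals and on the whole line *)

Section integrals_on_line.
Context {R : realType}.
Local Notation mu := (@lebesgue_measure R).
Local Notation rint := (rintegrable mu).
Implicit Types (F f g : R -> R) (a b c e t : R).

Lemma continuous_rmeasurable f : continuous f ->
  @measurable_fun _ _ (measurableTypeR R) R setT f.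
Proof. by move=> cf; exact: continuous_measurable_fun. Qed.

Lemma restrict_indicM (A : set R) f : f \_ A = (fun x => \1_A x * f x).
Proof.
apply/funext => x; rewrite patchE indicE.
by case: ifPn => _; rewrite ?mul1r ?mul0r.
Qed.

Lemma rintegrable_itv f a b : continuous f ->
  rint (fun x => \1_(`[a, b]%classic) x * f x).
Proof.
move=> cf.
have : mu.-integrable `[a, b] (EFin \o f).
  apply: continuous_compact_integrable; first exact: segment_compact.
  exact: continuous_subspaceT.
by move/integrable_mkcond => /(_ (measurable_itv _)); rewrite restrict_EFin restrict_indicM.
Qed.

Lemma rintegral_itv_FTC F f a b : a < b -> (forall x : R, is_derive x 1 F (f x)) ->
  continuous f -> \int[mu]_x (\1_(`[a, b]%classic) x * f x) = F b - F a.
Proof.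
move=> ab dF cf; have cF := derive_continuousf dF.
have := @continuous_FTC2 R f F a b ab (continuous_subspaceT cf).
have h : derivable_oo_LRcontinuous F a b.
  split; first by move=> x _; exact: ex_derive.
    by apply: cvg_at_right_filter; exact: cF.
  by apply: cvg_at_left_filter; exact: cF.
have h2 : {in `]a, b[%R, F^`() =1 f} by move=> x _; rewrite derive1E derive_val.
move=> /(_ h h2); rewrite integral_mkcond restrict_EFin restrict_indicM => e.
by rewrite /Rintegral e.
Qed.

(** Monotone convergence along symmetric intervals gives integrability and the value at once; no
    separate majorant is required because the integrand is nonnegative. *)
Lemma ge0_FTC_line F f (L : R) : (forall x, 0 <= f x) -> continuous f ->
  (forall x : R, is_derive x 1 F (f x)) ->
  (fun n => F n.+1%:R - F (- n.+1%:R)) @ \oo --> L ->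
  rint f /\ \int[mu]_x f x = L.
Proof.
move=> f0 cf dF FL.
(* The index [n.+1] keeps the interval nondegenerate, as [rintegral_itv_FTC] demands. *)
pose g n x : R := \1_(`[- n.+1%:R, n.+1%:R]%classic) x * f x.
have g0 n x : 0 <= g n x by rewrite mulr_ge0.
have gi n : rint (g n) by exact: rintegrable_itv.
have gI n : \int[mu]_x g n x = F n.+1%:R - F (- n.+1%:R).
  by rewrite rintegral_itv_FTC// -subr_gt0 opprK addr_gt0.
have gl x : (EFin \o g ^~ x) @ \oo --> (f x)%:E.
  apply: cvg_EFin; first exact: nearW.
  apply: cvg_near_cst; near=> n.
  rewrite /= /g indicE mem_set ?mul1r//= in_itv/= -ler_norml.
  have : `|x| <= n%:R by near: n; exact: nbhs_infty_ger.
  by move=> /le_trans; apply; rewrite ler_nat.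
have := @cvg_monotone_convergence _ _ _ mu setT measurableT
  (fun n x => (g n x)%:E).
move=> /(_ (fun n => (measurable_EFinP _ _).2 (rintegrable_measurable (gi n)))).
move=> /(_ (fun n x _ => g0 n x)).
have nd x : setT x -> {homo (fun n => (g n x)%:E) : n m / (n <= m)%N >-> (n <= m)%E}.
  move=> _ n m nm; rewrite lee_fin ler_wpM2r// !indicE ler_nat.
  have [|//] := boolP (x \in _); rewrite inE/= in_itv/= => /andP[xn nx].
  rewrite mem_set//= in_itv/= (le_trans _ xn) ?(le_trans nx)// ?lerN2 ler_nat ltnS//.
move=> /(_ nd).
rewrite (eq_integral (fun x : measurableTypeR R => (f x)%:E)); last by move=> x _; exact: cvg_lim (gl x).
have -> : (fun n => (\int[mu]_x (g n x)%:E)%E) =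
    EFin \o (fun n => F n.+1%:R - F (- n.+1%:R)).
  by apply/funext => n; rewrite /= -gI rintegral_EFin.
move=> h.
have iE : (\int[mu]_x (f x)%:E)%E = L%:E.
  rewrite -(cvg_lim (@ereal_hausdorff _) h); apply: cvg_lim => //.
  by apply: cvg_EFin => //; exact: nearW.
split; last by rewrite /Rintegral iE.
apply/integrableP; split; first by apply/measurable_EFinP; exact: continuous_rmeasurable cf.
rewrite (eq_integral (fun x : measurableTypeR R => (f x)%:E)); last by move=> x _; rewrite /= ger0_norm.
by rewrite iE ltry.
Unshelve. all: by end_near. Qed.

Lemma cvg_atan_line a : 0 < a ->
  (fun n => atan (n.+1%:R / a) - atan (- n.+1%:R / a)) @ \oo --> (pi : R).
Proof.
move=> a0.
have h : (fun n => n.+1%:R / a) @ \oo --> +oo.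
  apply/cvgryPge => M; near=> n; rewrite ler_pdivlMr//.
  have : M * a <= n%:R by near: n; exact: nbhs_infty_ger.
  by move=> /le_trans; apply; rewrite ler_nat.
have := cvg_comp _ _ h (@cvgy_atan R) => h2.
rewrite [X in _ --> X](_ : _ = pi / 2 + pi / 2); last by rewrite -splitr.
under eq_fun do rewrite mulNr atanN opprK.
exact: (cvgD h2 h2).
Unshelve. all: by end_near. Qed.

(** The Poisson kernel at height [e] is [e / pi] times this function. *)
Definition cauchy e (t : R) := (t ^+ 2 + e ^+ 2)^-1.

Lemma cauchy_den_gt0 e t : 0 < e -> 0 < t ^+ 2 + e ^+ 2.
Proof. by move=> e0; rewrite ltr_wpDl ?sqr_ge0 ?exprn_gt0. Qed.

Lemma cauchy_gt0 e t : 0 < e -> 0 < cauchy e t.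
Proof. by move=> e0; rewrite invr_gt0 cauchy_den_gt0. Qed.

Lemma continuous_cauchy e : 0 < e -> continuous (cauchy e).
Proof.
move=> e0; apply: continuousVf => [|t]; last by rewrite gt_eqF ?cauchy_den_gt0.
by contf.
Qed.

Lemma is_derive_atan_cauchy e (x : R) : 0 < e ->
  is_derive x 1 (fun t => atan (t / e) / e) (cauchy e x).
Proof.
move=> e0; apply: derive_eqf => /=; rewrite /GRing.scale /=.
have := cauchy_den_gt0 x e0; rewrite /cauchy => h; field.
by rewrite !gt_eqF ?h// addrC.
Qed.

Lemma rintegral_cauchy e : 0 < e ->
  rint (cauchy e) /\ \int[mu]_t cauchy e t = pi / e.
Proof.
move=> e0; apply: (@ge0_FTC_line (fun t => atan (t / e) / e)).
- by move=> x; exact/ltW/cauchy_gt0.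
- exact: continuous_cauchy.
- by move=> x; exact: is_derive_atan_cauchy.
- under eq_fun do rewrite -mulrBl.
  by apply: cvgM; [exact: cvg_atan_line|exact: cvg_cst].
Qed.

End integrals_on_line.

(** * The Cauchy kernel *)

Section cauchy_kernel.
Context {R : realType}.
Local Notation mu := (@lebesgue_measure R).
Local Notation rint := (rintegrable mu).
Local Notation mu2 := (mu \x mu)%E.
Local Notation rint2 := (rintegrable mu2).
Implicit Types (e s t : R).

Lemma cvg_atan_div e s : 0 < e ->
  (fun n => atan ((n.+1%:R + s) / e)) @ \oo --> (pi / 2 : R) /\
  (fun n => atan ((- n.+1%:R + s) / e)) @ \oo --> (- (pi / 2) : R).
Proof.
move=> e0.
have h c : (fun n => (n.+1%:R + c) / e) @ \oo --> +oo.
  apply/cvgryPge => M; near=> n; rewrite ler_pdivlMr// -lerBlDr.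
  have : M * e - c <= n%:R by near: n; exact: nbhs_infty_ger.
  by move=> /le_trans; apply; rewrite ler_nat.
have h1 c := cvg_comp _ _ (h c) (@cvgy_atan R).
split; first exact: h1.
under eq_fun do rewrite -[X in X + _]opprK opprK -[in X in X / _](opprK s) -opprD mulNr atanN.
exact: (cvgN (h1 (- s))).
Unshelve. all: by end_near. Qed.

Let lnq e s t := ln ((t + s) ^+ 2 + e ^+ 2) - ln (t ^+ 2 + e ^+ 2).

(** The boolean selects the end of the line. The ratio of the two quadratics differs from 1 by at
    most a constant over n, so its logarithm tends to 0 by continuity of [ln] at 1. *)
Lemma cvg_ln_ratio e s (b : bool) : 0 < e ->
  (fun n => lnq e s ((-1) ^+ b * n.+1%:R)) @ \oo --> (0 : R).
Proof.
move=> e0.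
pose q n := ((((-1) ^+ b * n.+1%:R + s) ^+ 2 + e ^+ 2) /
             (((-1) ^+ b * n.+1%:R) ^+ 2 + e ^+ 2)).
have q0 n : 0 < q n by rewrite divr_gt0 ?cauchy_den_gt0.
have -> : (fun n => lnq e s ((-1) ^+ b * n.+1%:R)) = (fun n => ln (q n)).
  by apply/funext => n; rewrite /lnq /q lnM ?posrE ?invr_gt0 ?cauchy_den_gt0// lnV ?posrE ?cauchy_den_gt0.
rewrite -[X in _ --> X](@ln1 R).
suff hq : q @ \oo --> (1 : R) by exact: (cvg_comp _ _ hq (continuous_ln ltr01)).
have hb n : `|1 - q n| <= (2 * `|s| + s ^+ 2) * harmonic n.
  have m1 : 1 <= n.+1%:R :> R by rewrite ler1n.
  set m := n.+1%:R in m1 *.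
  have d0 := cauchy_den_gt0 ((-1) ^+ b * m) e0.
  have sgn : ((-1) ^+ b * m) ^+ 2 = m ^+ 2 by rewrite exprMn sqrr_sign mul1r.
  have -> : 1 - q n = - ((2 * ((-1) ^+ b * m) * s + s ^+ 2) / (((-1) ^+ b * m) ^+ 2 + e ^+ 2)).
    by rewrite /q -/m; move: d0; move: ((-1) ^+ b * m) => X d0; field; rewrite gt_eqF.
  rewrite normrN normrM normfV (gtr0_norm d0) ler_pdivrMr// /harmonic/= -/m.
  have h1 : `|2 * ((-1) ^+ b * m) * s + s ^+ 2| <= 2 * m * `|s| + s ^+ 2.
    rewrite (le_trans (ler_normD _ _))// !normrM normr_sign mul1r.
    by rewrite -expr2 real_normK ?num_real// normr_nat ger0_norm//; lra.
  apply: (le_trans h1).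
  have m0 : 0 < m by lra.
  have -> : (2 * `|s| + s ^+ 2) / m * (((-1) ^+ b * m) ^+ 2 + e ^+ 2) =
     (2 * `|s| + s ^+ 2) * m + (2 * `|s| + s ^+ 2) / m * e ^+ 2.
    by rewrite sgn; field; rewrite gt_eqF.
  have h2 : 0 <= (2 * `|s| + s ^+ 2) / m * e ^+ 2.
    by rewrite mulr_ge0 ?sqr_ge0// divr_ge0 ?(ltW m0)// addr_ge0 ?sqr_ge0// mulr_ge0.
  have h3 : s ^+ 2 <= s ^+ 2 * m by rewrite ler_peMr ?sqr_ge0.
  by rewrite -[leLHS]addr0 lerD// mulrDl; lra.
apply/cvgrPdist_le => eps eps0.
have hh : (fun n => (2 * `|s| + s ^+ 2) * harmonic n) @ \oo --> (0 : R).
  rewrite -[X in _ --> X](mulr0 (2 * `|s| + s ^+ 2)).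
  by apply: cvgM; [exact: cvg_cst|exact: cvg_harmonic].
move/cvgrPdist_le : hh => /(_ _ eps0) hh; near=> n.
rewrite (le_trans (hb n))//.
have := near hh n => /(_ ltac:(by []))/=.
by rewrite sub0r normrN => /(le_trans (ler_norm _)).
Unshelve. all: by end_near. Qed.

(** The semigroup law of the Poisson kernels: the right-hand side is [2 * pi / e] times
    [cauchy (2 * e) s]. *)
Lemma rintegral_cauchy_conv e s : 0 < e -> s != 0 ->
  rint (fun t => cauchy e t * cauchy e (t + s)) /\
  \int[mu]_t (cauchy e t * cauchy e (t + s)) = 2 * pi / (e * (s ^+ 2 + 4 * e ^+ 2)).
Proof.
move=> e0 s0.
have D0 : 0 < s ^+ 2 + 4 * e ^+ 2.
  by rewrite ltr_wpDl ?sqr_ge0// mulr_gt0// exprn_gt0.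
(* Antiderivative from partial fractions. The logarithmic part carries a factor 1/s, hence the
   hypothesis on [s]; it vanishes at both ends, so that only the arctangents contribute to the
   value. *)
pose F t := (atan (t / e) / e + atan ((t + s) / e) / e) / (s ^+ 2 + 4 * e ^+ 2) +
  lnq e s t / (s * (s ^+ 2 + 4 * e ^+ 2)).
apply: (@ge0_FTC_line _ F).
- by move=> t; rewrite mulr_ge0// ltW// cauchy_gt0.
- apply: continuousMf; first exact: continuous_cauchy.
  by apply: continuous_compf; [exact: continuous_cauchy|contf].
- move=> t.
  have d1 := is_derive_atan_cauchy t e0.
  have d2 : is_derive t 1 (fun t => atan ((t + s) / e) / e) (cauchy e (t + s)).
    have D := @derive_compf _ (fun t => atan (t / e) / e) (fun t => t + s) t _ _
      (is_derive_atan_cauchy _ e0) (deriveDf (derive_idf _) (derive_cstf _ _)).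
    by apply: (derive_eqf D); rewrite addr0 mulr1.
  have d3 c : is_derive t 1 (fun t => ln ((t + c) ^+ 2 + e ^+ 2)) (2 * (t + c) / ((t + c) ^+ 2 + e ^+ 2)).
    have D := @derive_compf _ (@ln R) (fun t => (t + c) ^+ 2 + e ^+ 2) t _ _
      (is_derive1_ln (cauchy_den_gt0 _ e0))
      (deriveDf (deriveXf 2 (deriveDf (derive_idf _) (derive_cstf _ _))) (derive_cstf _ _)).
    by apply: (derive_eqf D); rewrite /=; field; rewrite gt_eqF ?cauchy_den_gt0.
  have d4 : is_derive t 1 (fun t => ln (t ^+ 2 + e ^+ 2)) (2 * t / (t ^+ 2 + e ^+ 2)).
    by have := d3 0; under eq_fun do rewrite addr0; rewrite addr0.
  have D := deriveDf (deriveMf (deriveDf d1 d2) (derive_cstf (s ^+ 2 + 4 * e ^+ 2)^-1 t))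
    (deriveMf (deriveBf (d3 s) d4) (derive_cstf (s * (s ^+ 2 + 4 * e ^+ 2))^-1 t)).
  apply: (derive_eqf D).
  have := cauchy_den_gt0 t e0; have := cauchy_den_gt0 (t + s) e0.
  rewrite /cauchy => h1 h2; field.
  by rewrite s0 !gt_eqF.
- have [a1 a2] := cvg_atan_div 0 e0; have [b1 b2] := cvg_atan_div s e0.
  have c1 := @cvg_ln_ratio e s false e0; have c2 := @cvg_ln_ratio e s true e0.
  have -> : 2 * pi / (e * (s ^+ 2 + 4 * e ^+ 2)) =
   ((pi / 2 / e + pi / 2 / e) / (s ^+ 2 + 4 * e ^+ 2) + 0 / (s * (s ^+ 2 + 4 * e ^+ 2)))
   - ((- (pi / 2) / e + - (pi / 2) / e) / (s ^+ 2 + 4 * e ^+ 2) + 0 / (s * (s ^+ 2 + 4 * e ^+ 2))).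
    by field; rewrite s0 !gt_eqF.
  rewrite /F; apply: cvgB; apply: cvgD; (apply: cvgM; last exact: cvg_cst).
  + apply: cvgD; (apply: cvgM; last exact: cvg_cst) => //.
    by under eq_fun do rewrite -[X in atan (X / _)]addr0.
  + by under eq_fun do rewrite -[X in lnq _ _ X]mul1r.
  + apply: cvgD; (apply: cvgM; last exact: cvg_cst) => //.
    by under eq_fun do rewrite -[X in atan (X / _)]addr0.
  + by under eq_fun do rewrite -[X in lnq _ _ X]mulN1r.
Qed.

End cauchy_kernel.

(** * Triple integrals *)

Section triple_integral.
Context {R : realType}.
Local Notation mu := (@lebesgue_measure R).
Local Notation RR := (measurableTypeR R).
Implicit Types (F G : R -> R -> R -> R).

Definition measurable3 F :=
  measurable_fun setT (fun w : (RR * RR) * RR => F w.1.1 w.1.2 w.2).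

(** An iterated integral, so that a permutation of the variables reduces to Tonelli for two adjacent
    ones; its values are extended reals, so that nonnegative integrands can be added and compared
    before anything is known to be finite. *)
Definition integral3 F : \bar R :=
  (\int[mu]_x \int[mu]_y \int[mu]_z (F x y z)%:E)%E.

Let slice x F : measurable3 F ->
  measurable_fun setT (fun w : RR * RR => (F x w.1 w.2)%:E).
Proof.
move=> mF; apply/measurable_EFinP.
have mg : measurable_fun setT (fun w : RR * RR => ((x, w.1), w.2) : (RR * RR) * RR).
  apply/measurable_fun_pairP; split => /=; last exact: measurable_snd.
  by apply/measurable_fun_pairP; split => /=; [exact: measurable_cst|exact: measurable_fst].
exact: (measurableT_comp mF mg).
Qed.

Let mpair (x : RR) : measurable_fun setT (fun y : RR => (x, y) : RR * RR).
Proof.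
by apply/measurable_fun_pairP; split => /=; [exact: measurable_cst|exact: measurable_id].
Qed.

Let slice1 x y F : measurable3 F ->
  measurable_fun setT (fun z : RR => (F x y z)%:E).
Proof. by move=> mF; exact: (measurableT_comp (slice x mF) (mpair y)). Qed.

Let inner F : measurable3 F -> (forall x y z, 0 <= F x y z) ->
  measurable_fun setT (fun w : RR * RR => (\int[mu]_z (F w.1 w.2 z)%:E)%E).
Proof.
move=> mF F0.
apply: (@measurable_fun_fubini_tonelli_F _ _ (RR * RR)%type RR R mu
  (fun w => (F w.1.1 w.1.2 w.2)%:E)) => //.
- exact/measurable_EFinP.
- by move=> w; rewrite lee_fin.
Qed.

Let inner1 x F : measurable3 F -> (forall x y z, 0 <= F x y z) ->
  measurable_fun setT (fun y : RR => (\int[mu]_z (F x y z)%:E)%E).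
Proof.
by move=> mF F0; exact: (measurableT_comp (inner mF F0) (mpair x)).
Qed.

Let inner2 F : measurable3 F -> (forall x y z, 0 <= F x y z) ->
  measurable_fun setT (fun x : RR => (\int[mu]_y \int[mu]_z (F x y z)%:E)%E).
Proof.
move=> mF F0.
apply: (@measurable_fun_fubini_tonelli_F _ _ RR RR R mu
  (fun w => (\int[mu]_z (F w.1 w.2 z)%:E)%E)); first exact: inner.
by move=> w; apply: integral_ge0 => z _; rewrite lee_fin.
Qed.

Lemma integral3_swap12 F : measurable3 F -> (forall x y z, 0 <= F x y z) ->
  integral3 (fun x y z => F y x z) = integral3 F.
Proof.
move=> mF F0.
apply/esym/(fubini_tonelli (m1 := mu) (m2 := mu)
  (fun w : RR * RR => (\int[mu]_z (F w.1 w.2 z)%:E)%E) (inner mF F0)).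
by move=> w; apply: integral_ge0 => z _; rewrite lee_fin.
Qed.

Lemma integral3_swap23 F : measurable3 F -> (forall x y z, 0 <= F x y z) ->
  integral3 (fun x y z => F x z y) = integral3 F.
Proof.
move=> mF F0; apply: eq_integral => x _.
by rewrite (fubini_tonelli (m1 := mu) (m2 := mu) (fun w : RR * RR => (F x w.1 w.2)%:E))//;
  [exact: slice|move=> w; rewrite lee_fin].
Qed.

Lemma measurable3_perm F : measurable3 F ->
  measurable3 (fun x y z => F y x z) /\ measurable3 (fun x y z => F x z y).
Proof.
move=> mF; split.
  have mg : measurable_fun setT
      (fun w : (RR * RR) * RR => ((w.1.2, w.1.1), w.2) : (RR * RR) * RR).
    apply/measurable_fun_pairP; split => /=; last exact: measurable_snd.
    apply/measurable_fun_pairP; split => /=.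
      exact: (measurableT_comp measurable_snd measurable_fst).
    exact: (measurableT_comp measurable_fst measurable_fst).
  exact: (measurableT_comp mF mg).
have mg : measurable_fun setT
    (fun w : (RR * RR) * RR => ((w.1.1, w.2), w.1.2) : (RR * RR) * RR).
  apply/measurable_fun_pairP; split => /=; last first.
    exact: (measurableT_comp measurable_snd measurable_fst).
  apply/measurable_fun_pairP; split => /=; last exact: measurable_snd.
  exact: (measurableT_comp measurable_fst measurable_fst).
exact: (measurableT_comp mF mg).
Qed.

Lemma integral3D F G : measurable3 F -> (forall x y z, 0 <= F x y z) ->
  measurable3 G -> (forall x y z, 0 <= G x y z) ->
  integral3 (fun x y z => F x y z + G x y z) = (integral3 F + integral3 G)%E.
Proof.
move=> mF F0 mG G0; rewrite /integral3 -ge0_integralD//; last 4 first.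
- by move=> x _; do 2 apply: integral_ge0 => *; rewrite lee_fin.
- exact: inner2.
- by move=> x _; do 2 apply: integral_ge0 => *; rewrite lee_fin.
- exact: inner2.
apply: eq_integral => x _; rewrite -ge0_integralD//; last 4 first.
- by move=> y _; apply: integral_ge0 => *; rewrite lee_fin.
- exact: inner1.
- by move=> y _; apply: integral_ge0 => *; rewrite lee_fin.
- exact: inner1.
apply: eq_integral => y _; rewrite -ge0_integralD//.
- by move=> z _; rewrite lee_fin.
- exact: slice1.
- by move=> z _; rewrite lee_fin.
- exact: slice1.
Qed.

Lemma le_integral3 F G : measurable3 F -> (forall x y z, 0 <= F x y z) ->
  measurable3 G -> (forall x y z, F x y z <= G x y z) ->
  (integral3 F <= integral3 G)%E.
Proof.
move=> mF F0 mG FG.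
have G0 x y z : 0 <= G x y z by exact: le_trans (FG x y z).
apply: ge0_le_integral; [by []| |exact: inner2|exact: inner2|] => [x _|x _].
  by do 2 apply: integral_ge0 => *; rewrite lee_fin.
apply: ge0_le_integral; [by []| |exact: inner1|exact: inner1|] => [y _|y _].
  by apply: integral_ge0 => *; rewrite lee_fin.
by apply: ge0_le_integral; [by []| |exact: slice1|exact: slice1|] => [z _|z _];
  rewrite lee_fin.
Qed.

End triple_integral.

(** * The symmetrized triple kernel and its mass *)

Section triple_kernel.
Context {R : realType}.
Local Notation mu := (@lebesgue_measure R).
Local Notation rint := (rintegrable mu).
Local Notation mu2 := (mu \x mu)%E.
Local Notation rint2 := (rintegrable mu2).
Implicit Types (e s t x y z : R).

(** This is pi times the conjugate Poisson kernel: a bounded odd regularization of 1/t. *)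
Definition conj_ker e t := t * cauchy e t.

(** The cyclic sum of [triple_kerE], decomposed into products of Cauchy kernels because these can be
    integrated over the plane one by one. *)
Definition triple_ker e s t := e ^+ 2 / 2 *
  (cauchy e s * cauchy e t + cauchy e s * cauchy e (s - t) +
   cauchy e t * cauchy e (s - t)
   - 3 * e ^+ 2 * (cauchy e s * cauchy e t * cauchy e (s - t))).

Lemma triple_kerE e x y z : 0 < e ->
  conj_ker e (x - y) * conj_ker e (x - z) +
  conj_ker e (y - x) * conj_ker e (y - z) +
  conj_ker e (z - x) * conj_ker e (z - y) = triple_ker e (x - y) (x - z).
Proof.
move=> e0; have h := fun t => lt0r_neq0 (cauchy_den_gt0 t e0).
rewrite /triple_ker /conj_ker /cauchy; field.
by rewrite !h.
Qed.

(** Over the common denominator the numerator is a sum of squares, although the decomposition in the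
    definition contains a negative term. *)
Lemma triple_ker_ge0 e s t : 0 < e -> 0 <= triple_ker e s t.
Proof.
move=> e0; have h t := cauchy_den_gt0 t e0.
have -> : triple_ker e s t = e ^+ 2 * (s ^+ 2 + t ^+ 2 + (s - t) ^+ 2) /
  (2 * ((s ^+ 2 + e ^+ 2) * (t ^+ 2 + e ^+ 2) * ((s - t) ^+ 2 + e ^+ 2))).
  by rewrite /triple_ker /cauchy; field; rewrite !gt_eqF.
rewrite divr_ge0// mulr_ge0// ?sqr_ge0//.
  by rewrite !addr_ge0// sqr_ge0.
by rewrite !mulr_ge0// ltW.
Qed.

Lemma cauchy_opp e t : cauchy e (- t) = cauchy e t.
Proof. by rewrite /cauchy sqrrN. Qed.

Lemma cauchy_le e t : 0 < e -> cauchy e t <= e ^- 2.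
Proof.
move=> e0; rewrite lef_pV2 ?posrE ?cauchy_den_gt0 ?exprn_gt0//.
by rewrite lerDr sqr_ge0.
Qed.

Lemma measurable_cauchy e : 0 < e ->
  measurable_fun setT (cauchy e).
Proof. by move=> e0; apply: continuous_measurable_fun; exact: continuous_cauchy. Qed.

Lemma rintegrable2_cauchy3 e : 0 < e ->
  rint2 (fun w => cauchy e w.1 * cauchy e w.2 * cauchy e (w.1 - w.2)).
Proof.
move=> e0; have [h _] := rintegral_cauchy e0; have mc := measurable_cauchy e0.
apply: le_rintegrable (rintegrableZ (e ^- 2) (rintegrable_prod h h)).
  apply: measurable_funM; first by apply: measurable_funM; exact: measurableT_comp.
  apply: (measurableT_comp mc).
  by apply: measurable_funB; [exact: measurable_fst|exact: measurable_snd].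
move=> w; have c0 t := ltW (cauchy_gt0 t e0).
rewrite ger0_norm ?mulr_ge0// mulrC ler_wpM2r ?mulr_ge0//.
exact: cauchy_le.
Qed.

Lemma rintegral2_cauchy3 e : 0 < e ->
  \int[mu2]_w (cauchy e w.1 * cauchy e w.2 * cauchy e (w.1 - w.2)) =
  pi ^+ 2 / (3 * e ^+ 4).
Proof.
move=> e0; have [hc ic] := rintegral_cauchy e0.
have [hc2 ic2] := rintegral_cauchy (mulr_gt0 (ltr0Sn R 1) e0).
have [h1 <-] := rfubini1 (rintegrable2_cauchy3 e0).
(* The inner integral is a multiple of [cauchy e s * cauchy (2 * e) s], and partial fractions turn
   this product into a difference of the two kernels. *)
pose g s := (2 * pi / (3 * e ^+ 3)) * (cauchy e s - cauchy (2 * e) s).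
have hg : rint g by apply: rintegrableZ; exact: rintegrableB.
transitivity (\int[mu]_s g s); last first.
  rewrite rintegralZ ?rintegralB// ?ic ?ic2//; last exact: rintegrableB.
  by field; rewrite gt_eqF.
rewrite /Rintegral; congr fine.
apply: (@ae_eq_integral _ _ _ mu setT _ _ measurableT).
- exact: measurable_int h1.
- exact: measurable_int hg.
(* The closed form of the inner integral is available for [s != 0] only; a single point is
   negligible. *)
exists ([set 0] : set R); split; [exact: measurable_set1|exact: lebesgue_measure_set1|].
move=> s /= /not_implyP[_ H]; apply: contra_notP H => /eqP s0.
congr EFin.
rewrite -[LHS]/(\int[mu]_t (cauchy e s * cauchy e t * cauchy e (s - t))).
transitivity (\int[mu]_t (cauchy e s * (cauchy e t * cauchy e (t + - (s : R))))).
  by apply: eq_Rintegral => t _; rewrite -mulrA -[in LHS](cauchy_opp e (_ - _)) opprB.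
have [|r1 r2] := @rintegral_cauchy_conv _ e (- s) e0; first by rewrite oppr_eq0.
rewrite [LHS](rintegralZ _ r1) r2 /g /cauchy sqrrN.
have h t := cauchy_den_gt0 t e0.
have h' : 0 < s ^+ 2 + (2 * e) ^+ 2 by rewrite cauchy_den_gt0// mulr_gt0.
have h'' : 0 < s ^+ 2 + 4 * e ^+ 2 by rewrite (lt_le_trans h')// exprMn; lra.
by field; rewrite !gt_eqF.
Qed.

(** The three double products have mass (pi / e)^2 each and the triple product has mass pi^2 / (3
    e^4), so that the total is (e^2 / 2) (3 pi^2 / e^2 - pi^2 / e^2) = pi^2, whatever [e] is. *)
Lemma rintegral2_triple_ker e : 0 < e ->
  rint2 (fun w => triple_ker e w.1 w.2) /\
  \int[mu2]_w triple_ker e w.1 w.2 = pi ^+ 2.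
Proof.
move=> e0; have [hc ic] := rintegral_cauchy e0.
have i1 := rintegrable_prod hc hc.
have i2 := rintegrable_conv hc hc.
have i3 : rint2 (fun w => cauchy e w.2 * cauchy e (w.1 - w.2)).
  have := rintegrable_swap i2; congr (rint2 _).
  by apply/funext => w /=; rewrite -[in LHS](cauchy_opp e (_ - _)) opprB.
have v3 : \int[mu2]_w (cauchy e w.2 * cauchy e (w.1 - w.2)) = (pi / e) ^+ 2.
  rewrite expr2 -ic -(rintegral_conv hc hc) -(rintegral_swap i2).
  by apply: eq_Rintegral => w _ /=; rewrite -[in LHS](cauchy_opp e (_ - _)) opprB.
have i4 := rintegrableZ (3 * e ^+ 2) (rintegrable2_cauchy3 e0).
have i12 := rintegrableD i1 i2.
have i123 := rintegrableD i12 i3.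
split; first by apply: rintegrableZ; exact: rintegrableB.
rewrite (rintegralZ _ (rintegrableB i123 i4)) (rintegralB i123 i4).
rewrite (rintegralD i12 i3) (rintegralD i1 i2) v3.
rewrite (rintegral_prod hc hc) (rintegral_conv hc hc) ic.
rewrite (rintegralZ _ (rintegrable2_cauchy3 e0)) (rintegral2_cauchy3 e0).
by field; rewrite gt_eqF.
Qed.

End triple_kernel.

(** * Conjugate Poisson integrals *)

Lemma eq_rintegrable d (T : measurableType d) (R : realType)
    (mu : {measure set T -> \bar R}) (f g : T -> R) :
  f =1 g -> rintegrable mu f -> rintegrable mu g.
Proof. by move=> /funext ->. Qed.

Lemma eq_rintegral d (T : measurableType d) (R : realType)
    (mu : {measure set T -> \bar R}) (f g : T -> R) :
  f =1 g -> \int[mu]_x f x = \int[mu]_x g x.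
Proof. by move=> /funext ->. Qed.

Section conj_bound.
Context {R : realType}.
Local Notation mu := (@lebesgue_measure R).
Local Notation rint := (rintegrable mu).
Local Notation mu2 := (mu \x mu)%E.
Local Notation rint2 := (rintegrable mu2).
Local Notation RR := (measurableTypeR R).
Implicit Types (e s t x y z : R) (f k : R -> R).

Lemma continuous_conj_ker e : 0 < e -> continuous (conj_ker e).
Proof.
move=> e0; apply: continuousMf; first exact: continuous_idf.
exact: continuous_cauchy.
Qed.

Lemma conj_ker_opp e t : conj_ker e (- t) = - conj_ker e t.
Proof. by rewrite /conj_ker cauchy_opp mulNr. Qed.

Lemma conj_ker_bound e t : 0 < e -> `|conj_ker e t| <= (2 * e)^-1.
Proof.
move=> e0; have h := cauchy_den_gt0 t e0.
rewrite /conj_ker normrM [`|cauchy _ _|]gtr0_norm ?cauchy_gt0//.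
rewrite /cauchy ler_pdivrMr// ler_pdivlMl ?mulr_gt0//.
have := sqr_ge0 (`|t| - e); have := real_normK (num_real t).
by rewrite sqrrB => ->; lra.
Qed.

Lemma rintegrableM_bounded f k (C : R) :
  @measurable_fun _ _ RR R setT k -> (forall x, `|k x| <= C) -> rint f ->
  rint (fun x => k x * f x).
Proof.
move=> mk kC hf.
have hn : rint (fun x => `|f x|).
  exact: (integrable_abse hf).
apply: le_rintegrable (rintegrableZ C hn).
  by apply: measurable_funM => //; exact: rintegrable_measurable hf.
by move=> x; rewrite normrM ler_wpM2r.
Qed.

Lemma rintegrable_conv_bounded f k (C x : R) :
  continuous k -> (forall x, `|k x| <= C) -> rint f ->
  rint (fun y => k (x - y) * f y).
Proof.
move=> ck kC hf; apply: (@rintegrableM_bounded _ _ C) => //.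
apply: continuous_rmeasurable; apply: continuous_compf => //.
by apply: continuousBf; [exact: continuous_cst|exact: continuous_idf].
Qed.

Lemma rintegrable2M_bounded (F : R * R -> R) (G : R * R -> R) (C : R) :
  measurable_fun setT (F : RR * RR -> R) -> (forall w, `|F w| <= C) -> rint2 G ->
  rint2 (fun w => F w * G w).
Proof.
move=> mk kC hf.
have hn : rint2 (fun w => `|G w|) by exact: (integrable_abse hf).
apply: le_rintegrable (rintegrableZ C hn).
  by apply: measurable_funM => //; exact: rintegrable_measurable hf.
by move=> w; rewrite normrM ler_wpM2r.
Qed.

Lemma measurable_sub2 k : continuous k ->
  measurable_fun setT (fun w : RR * RR => k (w.1 - w.2)).
Proof.
move=> ck; apply: (measurableT_comp (continuous_measurable_fun ck)).
by apply: measurable_funB; [exact: measurable_fst|exact: measurable_snd].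
Qed.

(** A bounded [k] does not make the integrand integrable over the plane. The weight [cauchy 1 x]
    does; Fubini then gives measurability in x, and the positive continuous weight is divided
    out. *)
Lemma measurable_conv f k (C : R) :
  continuous k -> (forall x, `|k x| <= C) -> rint f ->
  @measurable_fun _ _ RR R setT (fun x => \int[mu]_y (k (x - y) * f y)).
Proof.
move=> ck kC hf.
have [hc _] := rintegral_cauchy (ltr01 : 0 < (1 : R)).
have h2 : rint2 (fun w => k (w.1 - w.2) * (cauchy 1 w.1 * f w.2)).
  apply: (@rintegrable2M_bounded _ _ C) => //; first exact: measurable_sub2.
  exact: rintegrable_prod.
have [/rintegrable_measurable h _] := rfubini1 h2.
have -> : (fun x : RR => \int[mu]_y (k (x - y) * f y)) =
  (fun x => (cauchy 1 x)^-1 * \int[mu]_y (k ((x, y).1 - (x, y).2) * (cauchy 1 (x, y).1 * f (x, y).2))).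
  apply/funext => x /=.
  rewrite [X in _ = _ * X](_ : _ = cauchy 1 x * \int[mu]_y (k (x - y) * f y)).
    by rewrite mulrA mulVf ?mul1r// lt0r_neq0 ?cauchy_gt0.
  rewrite -rintegralZ; first by apply: eq_rintegral => y; ring.
  exact: (@rintegrable_conv_bounded _ _ C).
apply: measurable_funM => //.
apply: continuous_rmeasurable; apply: continuousVf; first exact: continuous_cauchy.
by move=> x; rewrite lt0r_neq0 ?cauchy_gt0.
Qed.

(** Without the factor 1 / pi: for small [e] it approximates [pi * hilbert f x]. *)
Definition conj_poisson e f x := \int[mu]_y (conj_ker e (x - y) * f y).

Lemma triple_kerC e s t : 0 < e -> triple_ker e s t = triple_ker e t s.
Proof.
move=> e0; rewrite /triple_ker -(cauchy_opp e (t - s)) opprB; ring.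
Qed.

Lemma triple_ker_rot e x y z : 0 < e ->
  triple_ker e (y - x) (y - z) = triple_ker e (x - y) (x - z).
Proof. by move=> e0; rewrite -!triple_kerE//; ring. Qed.

Lemma continuous_triple_ker1 e : 0 < e ->
  measurable_fun setT (fun w : RR * RR => triple_ker e w.1 w.2).
Proof. by move=> e0; have [/rintegrable_measurable] := rintegral2_triple_ker e0. Qed.

Lemma ge0_integral_triple_ker e (c x : R) : 0 < e -> 0 <= c ->
  (\int[mu]_y \int[mu]_z (c * triple_ker e (x - y) (x - z))%:E = (c * pi ^+ 2)%:E)%E.
Proof.
move=> e0 c0; have [h1 h2] := rintegral2_triple_ker e0.
have mM := rintegrable_measurable (rintegrableZ c h1).
have M0 s t : 0 <= c * triple_ker e s t by rewrite mulr_ge0// triple_ker_ge0.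
have mI : measurable_fun setT (fun y : RR => (\int[mu]_z (c * triple_ker e y z)%:E)%E).
  apply: (@measurable_fun_fubini_tonelli_F _ _ RR RR R mu
    (fun w => (c * triple_ker e w.1 w.2)%:E)) => //; first exact/measurable_EFinP.
  by move=> w; rewrite lee_fin.
have mS s : measurable_fun setT (fun z : RR => (c * triple_ker e s z)%:E).
  apply/measurable_EFinP.
  have mp : measurable_fun setT (fun y : RR => (s, y) : RR * RR).
    by apply/measurable_fun_pairP; split => /=; [exact: measurable_cst|exact: measurable_id].
  exact: (measurableT_comp mM mp).
transitivity (\int[mu]_y \int[mu]_z (c * triple_ker e (x - y) z)%:E)%E.
  apply: eq_integral => y _.
  exact: (@ge0_integral_reflect _ (fun z => (c * triple_ker e (x - y) z)%:E) x (mS _)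
    (fun z => M0 _ z)).
transitivity (\int[mu]_y \int[mu]_z (c * triple_ker e y z)%:E)%E.
  apply: (@ge0_integral_reflect _ (fun y => \int[mu]_z (c * triple_ker e y z)%:E)%E x mI).
  by move=> y; apply: integral_ge0 => z _; rewrite lee_fin.
rewrite -(fubini_tonelli1 (m1 := mu) (m2 := mu) (fun w => (c * triple_ker e w.1 w.2)%:E)).
- by rewrite (rintegral_EFin (rintegrableZ c h1)) (rintegralZ _ h1) h2.
- exact/measurable_EFinP.
- by move=> w; rewrite lee_fin.
Qed.

Lemma amgm3 (a b d : R) : 0 <= a -> 0 <= b -> 0 <= d ->
  a * b * d <= 3^-1 * a ^+ 3 + 3^-1 * b ^+ 3 + 3^-1 * d ^+ 3.
Proof.
move=> a0 b0 d0.
have h : 0 <= (a + b + d) * ((a - b) ^+ 2 + (b - d) ^+ 2 + (d - a) ^+ 2).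
  by rewrite mulr_ge0// !addr_ge0// sqr_ge0.
by lra.
Qed.

(** Here [X] stands for the triple integral with the nonnegative kernel, whose finiteness is not
    known beforehand; the equation excludes both infinities. *)
Lemma ereal_cancel (X : \bar R) (a b w : R) :
  (a%:E + a%:E + a%:E = X + w%:E)%E -> (X <= b%:E + b%:E + b%:E)%E ->
  3 * a - w <= 3 * b.
Proof.
case: X => [r| |]//; rewrite -!EFinD lee_fin => -[h]; lra.
Qed.

Section fixed_density.
Variables (e C : R) (sg : R -> R).
Hypotheses (e0 : 0 < e) (csg : continuous sg) (sg0 : forall x, 0 <= sg x)
  (sgC : forall x, sg x <= C) (isg : rint sg).

Let v := conj_poisson e sg.
Let c := (2 * e)^-1.
Let k := conj_ker e.
Let m := \int[mu]_x sg x.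

Let kb x : `|k x| <= c. Proof. exact: conj_ker_bound. Qed.

Let ik x : rint (fun y => k (x - y) * sg y).
Proof. by apply: (@rintegrable_conv_bounded _ _ c) => //; exact: continuous_conj_ker. Qed.

Let vb x : `|v x| <= c * m.
Proof.
rewrite /v /conj_poisson (le_trans (le_normr_Rintegral measurableT (ik x)))//.
rewrite -rintegralZ//; apply: le_rintegral.
- exact: (integrable_abse (ik x)).
- exact: rintegrableZ.
- by move=> y; rewrite normrM (ger0_norm (sg0 y)) ler_wpM2r.
Qed.

Let mv : @measurable_fun _ _ RR R setT v.
Proof. by apply: (@measurable_conv _ _ c) => //; exact: continuous_conj_ker. Qed.

Lemma rintegrable_conj_sqr : rint (fun x => sg x * v x ^+ 2).
Proof.
apply: (@eq_rintegrable _ RR _ mu (fun x => v x ^+ 2 * sg x)) => [x|]; first by rewrite mulrC.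
apply: (@rintegrableM_bounded _ _ ((c * m) ^+ 2)) => //.
  exact: measurable_funX.
by move=> x; rewrite normrX ler_sqr// ?nnegrE// (le_trans _ (vb x)).
Qed.

Lemma rintegrable_cube : rint (fun x => sg x ^+ 3).
Proof.
apply: (@eq_rintegrable _ RR _ mu (fun x => sg x ^+ 2 * sg x)) => [x|]; first by rewrite -exprSr.
apply: (@rintegrableM_bounded _ _ (C ^+ 2)) => //.
  by apply: continuous_rmeasurable; exact: continuousXf.
move=> x; rewrite normrX ler_sqr ?nnegrE ?ger0_norm//.
exact: le_trans (sgC x).
Qed.

(** Since |k| <= c, adding [c ^+ 2] makes [G] nonnegative, so that Tonelli applies to a signed
    kernel. [W] collects the three added constants, [M] carries the cyclic sum, and [A] is one of
    the three AM-GM terms that dominate [M]. *)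
Let G x y z := sg x * sg y * sg z * (k (x - y) * k (x - z) + c ^+ 2).
Let M x y z := sg x * sg y * sg z * triple_ker e (x - y) (x - z).
Let W x y z := 3 * c ^+ 2 * (sg x * sg y * sg z).
Let A x y z := 3^-1 * sg x ^+ 3 * triple_ker e (x - y) (x - z).

Let mproj1 : measurable_fun setT (fun w : RR * RR * RR => w.1.1).
Proof. exact: (measurableT_comp measurable_fst measurable_fst). Qed.
Let mproj2 : measurable_fun setT (fun w : RR * RR * RR => w.1.2).
Proof. exact: (measurableT_comp measurable_snd measurable_fst). Qed.

Let mcomp f (p : RR * RR * RR -> R) : continuous f -> measurable_fun setT p ->
  measurable_fun setT (fun w => f (p w)).
Proof. by move=> cf mp; exact: (measurableT_comp (continuous_measurable_fun cf) mp). Qed.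

Let m111 : measurable3 (fun x y z => sg x * sg y * sg z).
Proof. by apply: measurable_funM; [apply: measurable_funM|]; exact: mcomp. Qed.

Let mG : measurable3 G.
Proof.
apply: measurable_funM; first exact: m111.
apply: measurable_funD; last exact: measurable_cst.
by apply: measurable_funM; (apply: mcomp; [exact: continuous_conj_ker|exact: measurable_funB]).
Qed.

Let mT : measurable3 (fun x y z => triple_ker e (x - y) (x - z)).
Proof.
have mg : measurable_fun setT
    (fun w : (RR * RR) * RR => (w.1.1 - w.1.2, w.1.1 - w.2) : RR * RR).
  by apply/measurable_fun_pairP; split => /=; exact: measurable_funB.
exact: (measurableT_comp (continuous_triple_ker1 e0) mg).
Qed.

Let mM : measurable3 M. Proof. by apply: measurable_funM; [exact: m111|exact: mT]. Qed.
Let mW : measurable3 W. Proof. by apply: measurable_funM => //; exact: m111. Qed.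
Let mA : measurable3 A.
Proof.
apply: measurable_funM; last exact: mT.
apply: measurable_funM => //; apply: (@mcomp (fun x => sg x ^+ 3)) => //.
exact: continuousXf.
Qed.

Let G0 x y z : 0 <= G x y z.
Proof.
rewrite mulr_ge0 ?mulr_ge0// -(opprK (k _ * _)) addrC subr_ge0.
by rewrite (le_trans (ler_norm _))// normrN normrM expr2 ler_pM.
Qed.
Let M0 x y z : 0 <= M x y z.
Proof. by rewrite mulr_ge0 ?triple_ker_ge0// !mulr_ge0. Qed.
Let W0 x y z : 0 <= W x y z.
Proof. by apply: mulr_ge0; [rewrite mulr_ge0// sqr_ge0|rewrite !mulr_ge0]. Qed.
Let A0 x y z : 0 <= A x y z.
Proof. by rewrite mulr_ge0 ?triple_ker_ge0// mulr_ge0// exprn_ge0. Qed.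

(** These two rearrangements stand for the two nontrivial cyclic shifts, because the kernels in [G]
    and [A] are symmetric in their last two variables. *)
Let rot3 F : measurable3 F -> (forall x y z, 0 <= F x y z) ->
  [/\ measurable3 (fun x y z => F y x z), measurable3 (fun x y z => F z x y),
      integral3 (fun x y z => F y x z) = integral3 F &
      integral3 (fun x y z => F z x y) = integral3 F].
Proof.
move=> mF F0; have [h1 h2] := measurable3_perm mF.
have [h3 h4] := measurable3_perm h1.
have e12 := integral3_swap12 mF F0.
split; [exact: h1|exact: h4|exact: e12|].
exact: (etrans (integral3_swap23 h1 (fun x y z => F0 y x z)) e12).
Qed.

Let I3G : integral3 G = (\int[mu]_x (sg x * v x ^+ 2 + c ^+ 2 * m ^+ 2 * sg x)%:E)%E.
Proof.
rewrite /integral3; apply: eq_integral => x _.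
transitivity (\int[mu]_y (sg x * v x * (k (x - y) * sg y) + sg x * (c ^+ 2 * m) * sg y)%:E)%E.
  apply: eq_integral => y _.
  have i1 := rintegrableZ (sg x * sg y * k (x - y)) (ik x).
  have i2 := rintegrableZ (sg x * sg y * c ^+ 2) isg.
  transitivity ((\int[mu]_z (sg x * sg y * k (x - y) * (k (x - z) * sg z) +
     sg x * sg y * c ^+ 2 * sg z))%:E).
    rewrite -(rintegral_EFin (rintegrableD i1 i2)).
    by apply: eq_integral => z _; rewrite /G; congr EFin; ring.
  rewrite (rintegralD i1 i2) (rintegralZ _ (ik x)) (rintegralZ _ isg) -/m.
  rewrite -[\int[mu]_x0 _]/(v x).
  by congr EFin; ring.
have i1 := rintegrableZ (sg x * v x) (ik x).
have i2 := rintegrableZ (sg x * (c ^+ 2 * m)) isg.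
rewrite (rintegral_EFin (rintegrableD i1 i2)) (rintegralD i1 i2) (rintegralZ _ (ik x)) (rintegralZ _ isg) -/m.
by rewrite -[\int[mu]_x0 _]/(v x); congr EFin; ring.
Qed.

Let I3W : integral3 W = (3 * c ^+ 2 * m ^+ 3)%:E.
Proof.
transitivity (\int[mu]_x (3 * c ^+ 2 * m ^+ 2 * sg x)%:E)%E.
  apply: eq_integral => x _.
  transitivity (\int[mu]_y (3 * c ^+ 2 * m * sg x * sg y)%:E)%E.
    apply: eq_integral => y _.
    transitivity (\int[mu]_z (3 * c ^+ 2 * sg x * sg y * sg z)%:E)%E.
      by apply: eq_integral => z _; rewrite /W; congr EFin; ring.
    rewrite (rintegral_EFin (rintegrableZ _ isg)) (rintegralZ _ isg) -/m.
    by congr EFin; ring.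
  rewrite (rintegral_EFin (rintegrableZ _ isg)) (rintegralZ _ isg) -/m.
  by congr EFin; ring.
rewrite (rintegral_EFin (rintegrableZ _ isg)) (rintegralZ _ isg) -/m.
by congr EFin; ring.
Qed.

Let I3A : integral3 A = (pi ^+ 2 / 3 * \int[mu]_x sg x ^+ 3)%:E.
Proof.
transitivity (\int[mu]_x (pi ^+ 2 / 3 * sg x ^+ 3)%:E)%E.
  apply: eq_integral => x _; rewrite ge0_integral_triple_ker//; last first.
    by rewrite mulr_ge0// exprn_ge0.
  by congr EFin; ring.
by rewrite (rintegral_EFin (rintegrableZ _ rintegrable_cube)) (rintegralZ _ rintegrable_cube).
Qed.

(* Summing the three cyclic permutations of the kernel turns the signed
   k (x - y) * k (x - z) into a nonnegative kernel of mass pi ^+ 2, to which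
   AM-GM applies. *)
Lemma conj_poisson_sqr_le :
  \int[mu]_x (sg x * v x ^+ 2) <= pi ^+ 2 / 3 * \int[mu]_x sg x ^+ 3.
Proof.
have [mG2 mG3 eG2 eG3] := rot3 mG G0.
have [mA2 mA3 eA2 eA3] := rot3 mA A0.
have iv := rintegrable_conj_sqr.
have ic2 := rintegrableZ (c ^+ 2 * m ^+ 2) isg.
have eG : integral3 G = (\int[mu]_x (sg x * v x ^+ 2) + c ^+ 2 * m ^+ 3)%:E.
  rewrite I3G (rintegral_EFin (rintegrableD iv ic2)) (rintegralD iv ic2).
  by rewrite (rintegralZ _ isg) -/m; congr EFin; ring.
have eqGM : (fun x y z => G x y z + G y x z + G z x y) =
    (fun x y z => M x y z + W x y z).
  apply/funext => x; apply/funext => y; apply/funext => z.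
  by rewrite /G /M /W -(triple_kerE x y z e0) -/k; ring.
have s2 : (integral3 G + integral3 G + integral3 G = integral3 M + integral3 W)%E.
  have a1 := integral3D mM M0 mW W0.
  have a2 := integral3D (measurable_funD mG mG2) (fun x y z => addr_ge0 (G0 x y z) (G0 y x z))
    mG3 (fun x y z => G0 z x y).
  have a3 := integral3D mG G0 mG2 (fun x y z => G0 y x z).
  rewrite -[RHS]a1 -eqGM; apply/esym/(etrans a2).
  apply: (f_equal2 (@adde R)); last exact: eG3.
  apply: (etrans a3); apply: (f_equal2 (@adde R)); [exact: erefl|exact: eG2].
have s3 : (integral3 M <= integral3 A + integral3 A + integral3 A)%E.
  have a2 := integral3D (measurable_funD mA mA2) (fun x y z => addr_ge0 (A0 x y z) (A0 y x z))
    mA3 (fun x y z => A0 z x y).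
  have a3 := integral3D mA A0 mA2 (fun x y z => A0 y x z).
  have a4 : (integral3 A + integral3 A + integral3 A =
      integral3 (fun x y z => A x y z + A y x z + A z x y)%R)%E.
    apply/esym/(etrans a2).
    apply: (f_equal2 (@adde R)); last exact: eA3.
    apply: (etrans a3); apply: (f_equal2 (@adde R)); [exact: erefl|exact: eA2].
  rewrite [leRHS]a4.
  apply: le_integral3; [exact: mM|exact: M0| |].
    by apply: measurable_funD mA3; exact: measurable_funD mA mA2.
  move=> x y z; rewrite /A (triple_ker_rot x y z e0).
  have -> : triple_ker e (z - x) (z - y) = triple_ker e (x - y) (x - z).
    by rewrite (triple_ker_rot x z y e0); exact: triple_kerC.
  have := sg0 x; have := sg0 y; have := sg0 z; rewrite /M.
  have := triple_ker_ge0 (x - y) (x - z) e0.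
  move: (triple_ker e (x - y) (x - z)) (sg x) (sg y) (sg z) => T a b d T0 d0 b0 a0.
  rewrite -!mulrDl; apply: (ler_wpM2r T0); exact: amgm3.
(* The constants added in [G] contribute 3 c^2 m^3 in total, which is exactly the integral of [W],
   and cancel. *)
move: s2 s3; rewrite eG I3W I3A => s2 s3.
by have := ereal_cancel s2 s3; lra.
Qed.

End fixed_density.
End conj_bound.

(** * The Hilbert transform as a limit *)

Section principal_value.
Context {R : realType}.
Local Notation mu := (@lebesgue_measure R).
Local Notation rint := (rintegrable mu).
Local Notation RR := (measurableTypeR R).
Implicit Types (e s t x y z : R) (f h : R -> R).

Lemma rintegrableM_sqr d (T : measurableType d) (m : {measure set T -> \bar R})
    (h f : T -> R) :
  measurable_fun setT h -> measurable_fun setT f ->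
  rintegrable m (fun w => h w ^+ 2) -> rintegrable m (fun w => f w ^+ 2) ->
  rintegrable m (fun w => h w * f w).
Proof.
move=> mh mf ih jf; apply: le_rintegrable (rintegrableD ih jf).
  exact: measurable_funM.
move=> x; rewrite normrM -[h x ^+ 2]real_normK ?num_real// -[f x ^+ 2]real_normK ?num_real//.
have := sqr_ge0 (`|h x| - `|f x|); have := normr_ge0 (h x); have := normr_ge0 (f x).
by move: `|h x| `|f x| => a b a0 b0; rewrite sqrrB; have := mulr_ge0 a0 b0; lra.
Qed.

(** Folding t with -t replaces [f] by a difference that vanishes at t = 0. This absorbs the
    singularity of the limiting kernel and permits bounds uniform in the regularization. *)
Lemma rintegral_odd_kernel h f x : continuous f -> rint (fun t => f t ^+ 2) ->
  @measurable_fun _ _ RR R setT h -> rint (fun t => h t ^+ 2) ->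
  (forall t, h (- t) = - h t) ->
  \int[mu]_y (h (x - y) * f y) = 2^-1 * \int[mu]_t (h t * (f (x - t) - f (x + t))).
Proof.
move=> cf f2 mh h2 hodd.
have i1 : rint (fun t => h t * f (x - t)).
  apply: rintegrableM_sqr => //; last exact: rintegrable_reflect f2.
  apply: continuous_rmeasurable; apply: continuous_compf => //.
  by apply: continuousBf; [exact: continuous_cst|exact: continuous_idf].
have i2 : rint (fun t => h t * f (x + t)).
  have := rintegrable_opp i1; move/rintegrableN; apply: eq_rintegrable => t.
  by rewrite hodd opprK mulNr opprK.
have e1 : \int[mu]_y (h (x - y) * f y) = \int[mu]_t (h t * f (x - t)).
  rewrite -(rintegral_reflect x i1); apply: eq_rintegral => y.
  by congr (_ * f _); rewrite opprB addrC subrK.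
have e2 : \int[mu]_t (h t * f (x - t)) = - \int[mu]_t (h t * f (x + t)).
  rewrite -(rintegral_opp i1) -mulN1r -rintegralZ//; apply: eq_rintegral => t.
  by rewrite hodd opprK; ring.
rewrite e1 (_ : \int[mu]_t (h t * (f (x - t) - f (x + t))) =
  \int[mu]_t (h t * f (x - t)) - \int[mu]_t (h t * f (x + t))).
  by rewrite {2}e2 e2; field.
by rewrite -rintegralB//; apply: eq_rintegral => t; ring.
Qed.

Definition trunc_inv e t := if e < `|t| then t^-1 else 0.

Lemma measurable_trunc_inv e : 0 < e ->
  @measurable_fun _ _ RR R setT (trunc_inv e).
Proof.
(* The function [den] equals 2 t^2 where |t| > e and is positive everywhere, so 2 t / den extends
   1/t from that region to a continuous function on the line. *)
move=> e0; pose den t := t ^+ 2 + e ^+ 2 + `|t ^+ 2 - e ^+ 2|.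
have d0 t : 0 < den t by rewrite ltr_wpDr// cauchy_den_gt0.
have -> : trunc_inv e = (fun t => if e < `|t| then 2 * t / den t else 0).
  apply/funext => t; rewrite /trunc_inv; case: ifPn => // et.
  have t0 : t != 0 by rewrite -normr_gt0 (lt_trans e0).
  have et2 : e ^+ 2 <= t ^+ 2.
    by rewrite -[t ^+ 2]real_normK ?num_real// ler_sqr ?nnegrE ?(ltW e0) ?(ltW et).
  have -> : den t = 2 * t ^+ 2 by rewrite /den ger0_norm ?subr_ge0//; ring.
  by field.
apply: measurable_fun_ifT.
- by apply: measurable_fun_ltr.
- apply: continuous_rmeasurable; apply: continuousMf.
    by apply: continuousMf; [exact: continuous_cst|exact: continuous_idf].
  apply: continuousVf => [|t]; last exact: lt0r_neq0.
  have c2 : continuous (fun t => t ^+ 2) by apply: continuousXf; exact: continuous_idf.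
  apply: continuousDf; first by apply: continuousDf => //; exact: continuous_cst.
  apply: continuous_compf; first exact: norm_continuous.
  by apply: continuousBf => //; exact: continuous_cst.
- exact: measurable_cst.
Qed.

Lemma trunc_inv_sqr_le e t : 0 < e ->
  trunc_inv e t ^+ 2 <= (1 + e ^- 2) * cauchy 1 t.
Proof.
move=> e0; have c0 := cauchy_den_gt0 t (ltr01 : 0 < (1 : R)).
rewrite /trunc_inv; case: ifPn => [et|_]; last first.
  rewrite expr0n/= mulr_ge0 ?ltW// ?cauchy_gt0//.
  by rewrite ltr_wpDr ?invr_ge0 ?sqr_ge0.
have t0 : 0 < t ^+ 2.
  by rewrite -real_normK ?num_real// exprn_gt0// (lt_trans e0).
have et2 : e ^+ 2 <= t ^+ 2.
  by rewrite -[t ^+ 2]real_normK ?num_real// ler_sqr ?nnegrE ?ltW// (lt_trans e0).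
rewrite /cauchy ler_pdivlMr// exprVn mulrDr mulVf ?lt0r_neq0// lerD2l.
by rewrite expr1n mulr1 lef_pV2 ?posrE// exprn_gt0.
Qed.

Lemma conj_ker_sqr_le e t : 0 < e -> conj_ker e t ^+ 2 <= cauchy e t.
Proof.
move=> e0; have c0 := cauchy_den_gt0 t e0.
have -> : conj_ker e t ^+ 2 = t ^+ 2 / (t ^+ 2 + e ^+ 2) * cauchy e t.
  by rewrite /conj_ker /cauchy; field; rewrite lt0r_neq0.
rewrite -[leRHS]mul1r ler_wpM2r ?(ltW (cauchy_gt0 _ _))//.
by rewrite ler_pdivrMr// mul1r lerDl sqr_ge0.
Qed.

Lemma conj_ker_le_inv e t : 0 < e -> `|conj_ker e t| <= `|t^-1|.
Proof.
move=> e0; have c0 := cauchy_den_gt0 t e0.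
have [->|t0] := eqVneq t 0; first by rewrite /conj_ker mul0r normr0.
have -> : conj_ker e t = t ^+ 2 / (t ^+ 2 + e ^+ 2) * t^-1.
  by rewrite /conj_ker /cauchy; field; rewrite t0 lt0r_neq0.
rewrite normrM -[leRHS]mul1r ler_wpM2r// ger0_norm ?divr_ge0 ?sqr_ge0 ?(ltW c0)//.
by rewrite ler_pdivrMr// mul1r lerDl sqr_ge0.
Qed.

Lemma trunc_inv_le_inv e t : `|trunc_inv e t| <= `|t^-1|.
Proof. by rewrite /trunc_inv; case: ifP => // _; rewrite normr0. Qed.

Lemma rintegrable_trunc_inv_sqr e : 0 < e -> rint (fun t => trunc_inv e t ^+ 2).
Proof.
move=> e0; have [hc _] := rintegral_cauchy (ltr01 : 0 < (1 : R)).
apply: le_rintegrable (rintegrableZ (1 + e ^- 2) hc).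
  by apply: measurable_funX; exact: measurable_trunc_inv.
by move=> t; rewrite ger0_norm ?sqr_ge0//; exact: trunc_inv_sqr_le.
Qed.

Lemma rintegrable_conj_ker_sqr e : 0 < e -> rint (fun t => conj_ker e t ^+ 2).
Proof.
move=> e0; have [hc _] := rintegral_cauchy e0.
apply: le_rintegrable hc.
  by apply: continuous_rmeasurable; apply: continuousXf; exact: continuous_conj_ker.
by move=> t; rewrite ger0_norm ?sqr_ge0//; exact: conj_ker_sqr_le.
Qed.

Section pv.
Variables (f f' : R -> R) (C N : R).
Hypotheses (cf : continuous f) (df : forall x : R, is_derive x 1 f (f' x))
  (f2 : rint (fun t => f t ^+ 2)) (f'C : forall x, `|x| <= N + 1 -> `|f' x| <= C).

(** Majorant of the folded quotient. For |t| <= 1 the mean value theorem gives 2 C, while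
    [cauchy 1 t] is at least 1/2. For |t| > 1 Young's inequality bounds each |f| / |t| by f^2 / 2
    plus [cauchy 1 t]. The radius N + 1 in the bound on f' accounts for |t| <= 1. *)
Let bnd x t := (4 * C + 2) * cauchy 1 t + (f (x - t) ^+ 2 + f (x + t) ^+ 2).

Lemma rintegrable_pv_bound x : rint (bnd x).
Proof.
have [hc _] := rintegral_cauchy (ltr01 : 0 < (1 : R)).
apply: rintegrableD; first exact: rintegrableZ.
apply: rintegrableD; first exact: rintegrable_reflect f2.
by have := rintegrable_shift x f2; apply: eq_rintegrable => t; rewrite addrC.
Qed.

Lemma rintegral_pv_bound x :
  \int[mu]_t bnd x t = (4 * C + 2) * pi + 2 * \int[mu]_t f t ^+ 2.
Proof.
have [hc ic] := rintegral_cauchy (ltr01 : 0 < (1 : R)).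
have i1 := rintegrable_reflect x f2.
have i2 : rint (fun t => f (x + t) ^+ 2).
  by have := rintegrable_shift x f2; apply: eq_rintegrable => t; rewrite addrC.
rewrite (rintegralD (rintegrableZ _ hc) (rintegrableD i1 i2)) (rintegralD i1 i2).
rewrite (rintegralZ _ hc) ic divr1 (rintegral_reflect x f2).
rewrite (_ : \int[mu]_t f (x + t) ^+ 2 = \int[mu]_t f t ^+ 2); first by ring.
by rewrite -(rintegral_shift x f2); apply: eq_rintegral => t; rewrite addrC.
Qed.

Lemma pv_quotient_le x t : `|x| <= N ->
  `|t^-1| * `|f (x - t) - f (x + t)| <= bnd x t.
Proof.
move=> xN; have h2 : 0 <= f (x - t) ^+ 2 + f (x + t) ^+ 2 by rewrite addr_ge0 ?sqr_ge0.
have N0 : 0 <= N by exact: le_trans xN.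
have C0 : 0 <= C.
  by apply: le_trans (f'C (x := 0) _); rewrite ?normr0// addr_ge0.
have hc := cauchy_gt0 t (ltr01 : 0 < (1 : R)).
have c0 := cauchy_den_gt0 t (ltr01 : 0 < (1 : R)).
have [->|t0] := eqVneq t 0.
  by rewrite invr0 normr0 mul0r addr_ge0 ?addr_ge0 ?sqr_ge0// mulr_ge0 ?ltW ?cauchy_gt0//; lra.
have t0' : 0 < `|t| by rewrite normr_gt0.
have tt : `|t| ^+ 2 = t ^+ 2 by rewrite real_normK ?num_real.
rewrite /bnd normfV mulrC ler_pdivrMr//.
have [t1|t1] := leP `|t| 1.
  have hcl : 1 <= 2 * cauchy 1 t.
    rewrite /cauchy ler_pdivlMr// mul1r expr1n -tt.
    have : `|t| ^+ 2 <= 1 by rewrite expr_le1.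
    lra.
  have key : `|f (x - t) - f (x + t)| <= C * (2 * `|t|).
    have lip a b : a < b -> `|a| <= N + 1 -> `|b| <= N + 1 -> `|f b - f a| <= C * (b - a).
      move=> ab ha hb.
      have [c cab ->] := MVT ab (fun z _ => df z) (continuous_subspaceT cf).
      rewrite normrM [`|b - a|]gtr0_norm ?subr_gt0// ler_wpM2r// ?subr_ge0 ?(ltW ab)//.
      move: cab; rewrite in_itv/= => /andP[ac cb]; apply: f'C.
      move: ha hb; rewrite !ler_norml => /andP[a1 a2] /andP[b1 b2].
      by apply/andP; split; lra.
    have hp : `|x + t| <= N + 1 by rewrite (le_trans (ler_normD _ _))// lerD.
    have hm : `|x - t| <= N + 1 by rewrite (le_trans (ler_normB _ _))// lerD.
    case: (ltrgtP t 0) t0 => // [t0|t0] _.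
      rewrite (le_trans (lip (x + t) (x - t) _ _ _))//; first by lra.
      by rewrite ltr0_norm//; lra.
    rewrite distrC (le_trans (lip (x - t) (x + t) _ _ _))//; first by lra.
    by rewrite gtr0_norm//; lra.
  apply: (le_trans key); rewrite mulrA ler_wpM2r ?(ltW t0')//.
  have : C * 1 <= C * (2 * cauchy 1 t) by rewrite ler_wpM2l.
  by lra.
have hcl : 1 <= 2 * cauchy 1 t * `|t| ^+ 2.
  rewrite /cauchy mulrAC ler_pdivlMr// mul1r expr1n tt.
  have : 1 <= `|t| ^+ 2 by rewrite expr_ge1// ltW.
  by rewrite tt; lra.
apply: (le_trans (ler_normB _ _)).
have ab (a : R) : `|a| <= (2^-1 * a ^+ 2 + cauchy 1 t) * `|t|.
  rewrite -(ler_pM2r t0').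
  rewrite -[a ^+ 2]real_normK ?num_real//.
  have := sqr_ge0 (`|a| * `|t| - 1); rewrite sqrrB mulr1 exprMn expr1n.
  have -> : (2^-1 * `|a| ^+ 2 + cauchy 1 t) * `|t| * `|t| =
    2^-1 * (`|a| ^+ 2 * `|t| ^+ 2) + cauchy 1 t * `|t| ^+ 2 by ring.
  by lra.
apply: (le_trans (lerD (ab _) (ab _))); rewrite -mulrDl ler_wpM2r ?(ltW t0')//.
have : 0 <= C * cauchy 1 t by rewrite mulr_ge0// ltW.
by move: (f (x - t)) (f (x + t)) h2 => a b; have := sqr_ge0 a; have := sqr_ge0 b; lra.
Qed.

Let pvi x := 2^-1 * \int[mu]_t (t^-1 * (f (x - t) - f (x + t))).

(** Stated for an arbitrary odd approximation of 1/t, so as to apply both to the truncation in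
    [hilbert] and to [conj_ker]; the two limits therefore agree. *)
Lemma cvg_odd_kernel (h : nat -> R -> R) x : `|x| <= N ->
  (forall n, @measurable_fun _ _ RR R setT (h n)) ->
  (forall n, rint (fun t => h n t ^+ 2)) ->
  (forall n t, h n (- t) = - h n t) ->
  (forall n t, `|h n t| <= `|t^-1|) ->
  (forall t, t != 0 -> h ^~ t @ \oo --> t^-1) ->
  (fun n => \int[mu]_y (h n (x - y) * f y)) @ \oo --> pvi x.
Proof.
move=> xN mh h2 hodd hle hl.
under eq_fun do rewrite rintegral_odd_kernel//.
apply: cvgM; first exact: cvg_cst.
have mD : @measurable_fun _ _ RR R setT (fun t => f (x - t) - f (x + t)).
  apply: continuous_rmeasurable; apply: continuousBf; apply: continuous_compf => //.
    by apply: continuousBf; [exact: continuous_cst|exact: continuous_idf].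
  by apply: continuousDf; [exact: continuous_cst|exact: continuous_idf].
have := @rdominated _ RR R mu (fun n t => h n t * (f (x - t) - f (x + t)))
  (fun t => t^-1 * (f (x - t) - f (x + t))) (bnd x).
move=> /(_ (fun n => measurable_funM (mh n) mD)).
move=> H; apply: (H _ _ _).2 => [t|n t|].
- have [->|t0] := eqVneq t 0.
    by rewrite subr0 addr0 subrr mulr0; under eq_fun do rewrite mulr0; exact: cvg_cst.
  by apply: cvgM; [exact: hl|exact: cvg_cst].
- by rewrite normrM (le_trans _ (pv_quotient_le t xN))// ler_wpM2r.
- exact: rintegrable_pv_bound.
Qed.

Lemma cvg_conj_poisson x (e_ : nat -> R) : `|x| <= N -> (forall n, 0 < e_ n) ->
  e_ @ \oo --> (0 : R) -> (fun n => conj_poisson (e_ n) f x) @ \oo --> pvi x.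
Proof.
move=> xN e0 el; apply: (@cvg_odd_kernel (fun n => conj_ker (e_ n))) => //.
- by move=> n; apply: continuous_rmeasurable; exact: continuous_conj_ker.
- by move=> n; exact: rintegrable_conj_ker_sqr.
- by move=> n t; exact: conj_ker_opp.
- by move=> n t; exact: conj_ker_le_inv.
- move=> t t0; rewrite [X in _ --> X](_ : _ = t / (t ^+ 2 + 0 ^+ 2)); last by field.
  apply: cvgM; first exact: cvg_cst.
  apply: cvgV; first by rewrite expr0n/= addr0 expf_neq0.
  by apply: cvgD; [exact: cvg_cst|rewrite expr2; exact: cvgM].
Qed.

Lemma hilbert_pv x : `|x| <= N -> hilbert f x = pi^-1 * pvi x.
Proof.
move=> xN; rewrite /hilbert; congr (_ * _); apply: cvg_lim => //.
apply/cvg_at_rightP => e_ [e0 el].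
rewrite [X in X @ _ --> _](_ : _ =
   (fun n => \int[mu]_y (trunc_inv (e_ n) (x - y) * f y))); last first.
  apply/funext => n; rewrite Rintegral_mkcond; apply: eq_rintegral => y.
  rewrite patchE /trunc_inv; case: ifPn; rewrite ?inE/= ?notin_setE/= => h.
    by rewrite h mulrC.
  by move/negP: h => /negbTE ->; rewrite mul0r.
apply: (@cvg_odd_kernel (fun n => trunc_inv (e_ n))) => //.
- by move=> n; exact: measurable_trunc_inv.
- by move=> n; exact: rintegrable_trunc_inv_sqr.
- by move=> n t; rewrite /trunc_inv normrN; case: ifP; rewrite ?oppr0// invrN.
- by move=> n t; exact: trunc_inv_le_inv.
- move=> t t0; apply: cvg_near_cst.
  have t0' : 0 < `|t| by rewrite normr_gt0.
  move/cvgrPdist_lt : el => /(_ _ t0'); apply: filterS => n.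
  by rewrite sub0r normrN /trunc_inv => /(le_lt_trans (ler_norm _)) ->.
Qed.

Lemma conj_poisson_hilbert x (e_ : nat -> R) : `|x| <= N -> (forall n, 0 < e_ n) ->
  e_ @ \oo --> (0 : R) ->
  (fun n => conj_poisson (e_ n) f x) @ \oo --> pi * hilbert f x.
Proof.
move=> xN e0 el; rewrite hilbert_pv// mulrA divff ?mul1r ?lt0r_neq0 ?pi_gt0//.
exact: cvg_conj_poisson.
Qed.

(** The right-hand side is half the integral of [bnd]. Its uniformity in [e] is what dominated
    convergence under a cutoff relies on. *)
Lemma conj_poisson_bound x e : `|x| <= N -> 0 < e ->
  `|conj_poisson e f x| <= (2 * C + 1) * pi + \int[mu]_t f t ^+ 2.
Proof.
move=> xN e0.
have mk : @measurable_fun _ _ RR R setT (conj_ker e).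
  by apply: continuous_rmeasurable; exact: continuous_conj_ker.
rewrite /conj_poisson rintegral_odd_kernel//; last 2 first.
- exact: rintegrable_conj_ker_sqr.
- by move=> t; exact: conj_ker_opp.
have hb t : `|conj_ker e t * (f (x - t) - f (x + t))| <= bnd x t.
  rewrite normrM (le_trans _ (pv_quotient_le t xN))// ler_wpM2r//.
  exact: conj_ker_le_inv.
have ib := rintegrable_pv_bound x.
have ig : rint (fun t => conj_ker e t * (f (x - t) - f (x + t))).
  apply: le_rintegrable ib; last exact: hb.
  apply: measurable_funM => //.
  apply: continuous_rmeasurable; apply: continuousBf; apply: continuous_compf => //.
    by apply: continuousBf; [exact: continuous_cst|exact: continuous_idf].
  by apply: continuousDf; [exact: continuous_cst|exact: continuous_idf].
rewrite normrM gtr0_norm// ler_pdivrMl//.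
rewrite (le_trans (le_normr_Rintegral measurableT ig))//.
apply: (@le_trans _ _ (\int[mu]_t bnd x t)).
  by apply: le_rintegral => //; exact: (integrable_abse ig).
by rewrite rintegral_pv_bound; lra.
Qed.

End pv.
End principal_value.

(** * The derivative of the conjugate kernel and integration by parts *)

Section conj_ker_derivative.
Context {R : realType}.
Local Notation mu := (@lebesgue_measure R).
Local Notation rint := (rintegrable mu).
Local Notation mu2 := (mu \x mu)%E.
Local Notation rint2 := (rintegrable mu2).
Local Notation RR := (measurableTypeR R).
Implicit Types (e s t x y z : R) (f k r : R -> R).

Definition dconj_ker e t := (e ^+ 2 - t ^+ 2) * cauchy e t ^+ 2.

Lemma is_derive_conj_ker e x : 0 < e -> is_derive x 1 (conj_ker e) (dconj_ker e x).
Proof.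
move=> e0; have h := lt0r_neq0 (cauchy_den_gt0 x e0).
have D := deriveMf (derive_idf x)
  (@deriveVf R (fun t => t ^+ 2 + e ^+ 2) x _
    (deriveDf (deriveXf 2 (derive_idf x)) (derive_cstf (e ^+ 2) x)) h).
apply: (derive_eqf D); rewrite /dconj_ker /cauchy /=; field.
by rewrite h.
Qed.

Lemma continuous_dconj_ker e : 0 < e -> continuous (dconj_ker e).
Proof.
move=> e0; apply: continuousMf; last by apply: continuousXf; exact: continuous_cauchy.
apply: continuousBf; first exact: continuous_cst.
by apply: continuousXf; exact: continuous_idf.
Qed.

Lemma dconj_ker_opp e t : dconj_ker e (- t) = dconj_ker e t.
Proof. by rewrite /dconj_ker cauchy_opp sqrrN. Qed.

Lemma dconj_ker_bound e t : 0 < e -> `|dconj_ker e t| <= cauchy e t.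
Proof.
move=> e0; have c0 := cauchy_den_gt0 t e0; have h := cauchy_gt0 t e0.
have -> : dconj_ker e t = (e ^+ 2 - t ^+ 2) / (t ^+ 2 + e ^+ 2) * cauchy e t.
  by rewrite /dconj_ker /cauchy; field; rewrite lt0r_neq0.
rewrite normrM (gtr0_norm h) -[leRHS]mul1r ler_wpM2r ?(ltW h)//.
rewrite normrM normfV (gtr0_norm c0) ler_pdivrMr// mul1r.
have := sqr_ge0 t; have := sqr_ge0 e; move: (t ^+ 2) (e ^+ 2) => a b b0 a0.
by rewrite ler_norml; apply/andP; split; lra.
Qed.

(** The factor [e ^+ 2], against the mass pi / e of [cauchy e], is what makes the localization error
    O(e). An upper bound is enough, since negative values of the kernel only help there. *)
Lemma dconj_ker_sqr_le e t : 0 < e -> t ^+ 2 * dconj_ker e t <= e ^+ 2 * cauchy e t.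
Proof.
move=> e0; have c0 := cauchy_den_gt0 t e0; have h := cauchy_gt0 t e0.
have -> : e ^+ 2 * cauchy e t = e ^+ 2 * (t ^+ 2 + e ^+ 2) * cauchy e t ^+ 2.
  by rewrite /cauchy; field; rewrite lt0r_neq0.
rewrite /dconj_ker mulrA ler_wpM2r ?sqr_ge0//.
have := sqr_ge0 t; have := sqr_ge0 e; move: (t ^+ 2) (e ^+ 2) => a b b0 a0.
have := sqr_ge0 a; have := sqr_ge0 b; lra.
Qed.

Lemma rintegrable_dconj_ker e : 0 < e -> rint (dconj_ker e).
Proof.
move=> e0; have [hc _] := rintegral_cauchy e0.
apply: le_rintegrable hc.
  by apply: continuous_rmeasurable; exact: continuous_dconj_ker.
by move=> t; exact: dconj_ker_bound.
Qed.

Lemma rintegral_FTC_line0 (F g : R -> R) :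
  (forall x : R, is_derive x 1 F (g x)) -> continuous g -> rint g ->
  (fun n => F n.+1%:R - F (- n.+1%:R)) @ \oo --> (0 : R) ->
  \int[mu]_x g x = 0.
Proof.
move=> dF cg ig FL.
pose gn n x : R := \1_(`[- n.+1%:R, n.+1%:R]%classic) x * g x.
have h : (fun n => \int[mu]_x gn n x) @ \oo --> \int[mu]_x g x.
  apply: (@rdominated _ RR R mu gn g (fun x => `|g x|) _ _ _ _).2.
  - by move=> n; exact: rintegrable_measurable (rintegrable_itv _ _ cg).
  - move=> x; apply: cvg_near_cst; near=> n.
    rewrite /gn indicE mem_set ?mul1r//= in_itv/= -ler_norml.
    have : `|x| <= n%:R by near: n; exact: nbhs_infty_ger.
    by move=> /le_trans; apply; rewrite ler_nat.
  - move=> n x; rewrite /gn normrM -[leRHS]mul1r ler_wpM2r// indicE.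
    by case: (_ \in _); rewrite ?normr1 ?normr0.
  - exact: (integrable_abse ig).
have E : (fun n => \int[mu]_x gn n x) = (fun n => F n.+1%:R - F (- n.+1%:R)).
  by apply/funext => n; rewrite /gn rintegral_itv_FTC// -subr_gt0 opprK addr_gt0.
by rewrite E in h; exact: (cvg_unique _ h FL).
Unshelve. all: by end_near. Qed.

Lemma cvg_conj_ker_natr e x : 0 < e ->
  (fun n => conj_ker e (x - n.+1%:R)) @ \oo --> (0 : R) /\
  (fun n => conj_ker e (x - - n.+1%:R)) @ \oo --> (0 : R).
Proof.
move=> e0.
have key (u : nat -> R) : (forall n, n%:R <= `|u n| + `|x|) ->
    (fun n => conj_ker e (u n)) @ \oo --> (0 : R).
  move=> hu; apply/cvgrPdist_le => eps eps0; near=> n.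
  rewrite sub0r normrN.
  have hn : eps^-1 + `|x| <= n%:R by near: n; exact: nbhs_infty_ger.
  have un : eps^-1 <= `|u n| by have := hu n; lra.
  have u0 : 0 < `|u n| by rewrite (lt_le_trans _ un)// invr_gt0.
  rewrite (le_trans (conj_ker_le_inv _ e0))// normfV.
  by rewrite -[leRHS]invrK lef_pV2 ?posrE// invr_gt0.
split; apply: key => n.
  have := ler_normB x (x - n.+1%:R); rewrite opprB addrC subrK normr_nat => h.
  by rewrite addrC (le_trans _ h)// ler_nat.
have := ler_normB (x - - n.+1%:R) x; rewrite opprK addrC addKr normr_nat => h.
by rewrite (le_trans _ h)// ler_nat.
Unshelve. all: by end_near. Qed.

Section by_parts.
Variables (r f : R -> R) (C : R).
Hypotheses (dr : forall x : R, is_derive x 1 r (f x)) (cf : continuous f)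
  (f2 : rint (fun t => f t ^+ 2)) (rC : forall x, `|r x| <= C).

Let cr : continuous r. Proof. exact: derive_continuousf dr. Qed.

Lemma rintegrable_conj_ker_M e x : 0 < e -> rint (fun y => conj_ker e (x - y) * f y).
Proof.
move=> e0; apply: rintegrableM_sqr => //.
- apply: continuous_rmeasurable; apply: continuous_compf; first exact: continuous_conj_ker.
  by apply: continuousBf; [exact: continuous_cst|exact: continuous_idf].
- exact: continuous_rmeasurable.
- exact: rintegrable_reflect (rintegrable_conj_ker_sqr e0).
Qed.

Lemma rintegrable_dconj_ker_M e x : 0 < e -> rint (fun y => dconj_ker e (x - y) * r y).
Proof.
move=> e0; have := @rintegrableM_bounded R (fun y => dconj_ker e (x - y)) r C.
move=> /(_ (continuous_rmeasurable cr) rC (rintegrable_reflect x (rintegrable_dconj_ker e0))).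
by apply: eq_rintegrable => y; rewrite mulrC.
Qed.

(** The derivative passes from [r] to the kernel; the boundary terms vanish because [r] is bounded
    and [conj_ker] decays. The new kernel is integrable, so the quadratic form in [r] becomes an
    absolutely convergent double integral once one factor is cut off. *)
Lemma conj_poisson_by_parts e x : 0 < e ->
  conj_poisson e f x = \int[mu]_y (dconj_ker e (x - y) * r y).
Proof.
move=> e0; apply/eqP; rewrite -subr_eq0 /conj_poisson.
have i1 := rintegrable_conj_ker_M x e0; have i2 := rintegrable_dconj_ker_M x e0.
rewrite -rintegralB//; apply/eqP.
apply: (@rintegral_FTC_line0 (fun y => conj_ker e (x - y) * r y)
  (fun y => conj_ker e (x - y) * f y - dconj_ker e (x - y) * r y)).
- move=> y.
  have D1 := @derive_compf _ (conj_ker e) (fun y => x - y) y _ _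
    (is_derive_conj_ker _ e0) (deriveBf (derive_cstf x y) (derive_idf y)).
  apply: (derive_eqf (deriveMf D1 (dr y))).
  by rewrite sub0r mulrN1; ring.
- have cx : continuous (fun y => x - y).
    by apply: continuousBf; [exact: continuous_cst|exact: continuous_idf].
  by apply: continuousBf; apply: continuousMf => //; apply: continuous_compf => //;
    [exact: continuous_conj_ker|exact: continuous_dconj_ker].
- exact: rintegrableB.
- have [h1 h2] := cvg_conj_ker_natr x e0.
  have h (u : nat -> R) : (fun n => conj_ker e (x - u n)) @ \oo --> (0 : R) ->
      (fun n => conj_ker e (x - u n) * r (u n)) @ \oo --> (0 : R).
    move=> hu; have hC : (fun n => `|conj_ker e (x - u n)| * C) @ \oo --> (0 : R).
      rewrite -[X in _ --> X](mul0r C) -[X in X * C](normr0 R).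
      by apply: cvgM; [exact: cvg_norm|exact: cvg_cst].
    apply/cvgrPdist_le => eps eps0; near=> n.
    rewrite sub0r normrN normrM (@le_trans _ _ (`|conj_ker e (x - u n)| * C))//.
      by rewrite ler_wpM2l.
    apply: le_trans (ler_norm _) _; rewrite -normrN -sub0r; near: n.
    by move/cvgrPdist_le : hC; exact.
  by rewrite -[X in _ --> X](subrr 0); apply: cvgB; exact: h.
Unshelve. all: by end_near. Qed.

End by_parts.

(** Same weighting by [cauchy 1] as in [measurable_conv], now for square integrable factors, with
    Young's inequality as the source of integrability. *)
Lemma measurable_conv_sqr f k : continuous k -> rint (fun t => k t ^+ 2) ->
  continuous f -> rint (fun t => f t ^+ 2) ->
  @measurable_fun _ _ RR R setT (fun x => \int[mu]_y (k (x - y) * f y)).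
Proof.
move=> ck k2 cf f2.
have [hc _] := rintegral_cauchy (ltr01 : 0 < (1 : R)).
have c0 x : 0 < cauchy 1 x by exact: cauchy_gt0.
have h2 : rint2 (fun w => cauchy 1 w.1 * (k (w.1 - w.2) * f w.2)).
  apply: le_rintegrable (rintegrableD (rintegrable_conv hc k2) (rintegrable_prod hc f2)).
    apply: measurable_funM.
      by apply: (measurableT_comp (continuous_rmeasurable (continuous_cauchy ltr01))).
    apply: measurable_funM; first exact: measurable_sub2.
    by apply: (measurableT_comp (continuous_rmeasurable cf)).
  move=> w; rewrite normrM (gtr0_norm (c0 _)) -mulrDr ler_wpM2l ?(ltW (c0 _))//.
  rewrite normrM -[k _ ^+ 2]real_normK ?num_real// -[f _ ^+ 2]real_normK ?num_real//.
  move: (normr_ge0 (k (w.1 - w.2))) (normr_ge0 (f w.2)).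
  move: `|k _| `|f _| => a b a0 b0.
  by have := sqr_ge0 (a - b); rewrite sqrrB; have := mulr_ge0 a0 b0; lra.
have [/rintegrable_measurable h _] := rfubini1 h2.
have -> : (fun x : RR => \int[mu]_y (k (x - y) * f y)) =
  (fun x => (cauchy 1 x)^-1 * \int[mu]_y (cauchy 1 (x, y).1 * (k ((x, y).1 - (x, y).2) * f (x, y).2))).
  apply/funext => x /=; rewrite rintegralZ.
    by rewrite mulrA mulVf ?mul1r// lt0r_neq0.
  apply: rintegrableM_sqr => //.
  - apply: continuous_rmeasurable; apply: continuous_compf => //.
    by apply: continuousBf; [exact: continuous_cst|exact: continuous_idf].
  - exact: continuous_rmeasurable.
  - exact: rintegrable_reflect k2.
apply: measurable_funM => //.
apply: continuous_rmeasurable; apply: continuousVf; first exact: continuous_cauchy.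
by move=> x; rewrite lt0r_neq0.
Qed.

End conj_ker_derivative.

(** * Cutoff and localization *)

Section cutoff.
Context {R : realType}.
Local Notation mu := (@lebesgue_measure R).
Local Notation rint := (rintegrable mu).
Local Notation mu2 := (mu \x mu)%E.
Local Notation rint2 := (rintegrable mu2).
Local Notation RR := (measurableTypeR R).
Implicit Types (N e s t x y z : R) (f k r g : R -> R).

Definition ind N x : R := \1_(`[- N, N]%classic) x.
(* [bump] is only Lipschitz: derivatives are taken of the polynomial [bump0],
   which vanishes at both ends of the support of [ind]. *)
Definition bump0 N x : R := 1 - (x / N) ^+ 2.
Definition bump N x : R := ind N x * bump0 N x.

Lemma indE N x : ind N x = if `|x| <= N then 1 else 0.
Proof.
rewrite /ind indicE ler_norml.
have -> : (x \in `[- N, N]%classic) = (- N <= x <= N).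
  by apply/idP/idP; rewrite inE/= in_itv.
by case: ifP.
Qed.

Lemma ind_ge0 N x : 0 <= ind N x.
Proof. by rewrite indE; case: ifP. Qed.

Lemma bumpX N x n : ind N x * bump0 N x ^+ n.+1 = bump N x ^+ n.+1.
Proof. by rewrite /bump indE; case: ifP; rewrite ?mul1r// !mul0r expr0n. Qed.

Lemma bump0_ge0 N x : 0 < N -> `|x| <= N -> 0 <= bump0 N x.
Proof.
move=> N0 xN; rewrite subr_ge0 -real_normK ?num_real// expr_le1//.
by rewrite normrM normfV (gtr0_norm N0) ler_pdivrMr// mul1r.
Qed.

Lemma bump0_le1 N x : bump0 N x <= 1.
Proof. by rewrite lerBlDr lerDl sqr_ge0. Qed.

Lemma bump_ge0 N x : 0 < N -> 0 <= bump N x.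
Proof.
move=> N0; rewrite /bump indE; case: ifP; rewrite ?mul0r// mul1r.
exact: bump0_ge0.
Qed.

Lemma bump_le1 N x : bump N x <= 1.
Proof. by rewrite /bump indE; case: ifP; rewrite ?mul0r// mul1r bump0_le1. Qed.

Lemma bump_out N x : N < `|x| -> bump N x = 0.
Proof. by move=> h; rewrite /bump indE leNgt h mul0r. Qed.

Lemma bump_lipschitz N x y : 0 < N -> `|bump N x - bump N y| <= 2 / N * `|x - y|.
Proof.
move=> N0.
(* One point inside the support and one outside: in 1 - (a/N)^2 = (N - |a|)(N + |a|) / N^2 the first
   factor is at most |a - b|. *)
have key a b : `|a| <= N -> N < `|b| -> bump0 N a <= 2 / N * `|a - b|.
  move=> aN bN.
  have h : N - `|a| <= `|a - b|.
    by have := lerB_dist b a; rewrite distrC; lra.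
  have -> : bump0 N a = (N - `|a|) * (N + `|a|) / N ^+ 2.
    rewrite /bump0 exprMn -[a ^+ 2]real_normK ?num_real//; field.
    exact: lt0r_neq0.
  rewrite ler_pdivrMr ?exprn_gt0//.
  have -> : 2 / N * `|a - b| * N ^+ 2 = `|a - b| * (2 * N).
    by field; exact: lt0r_neq0.
  by apply: ler_pM => //; rewrite ?subr_ge0//; have := normr_ge0 a; lra.
wlog xy : x y / `|x| <= `|y|.
  by move=> h; case/orP: (le_total `|x| `|y|) => /h//; rewrite distrC [`|y - _|]distrC.
have [yN|yN] := leP `|y| N.
  rewrite /bump !indE yN (le_trans xy yN) !mul1r /bump0.
  have -> : 1 - (x / N) ^+ 2 - (1 - (y / N) ^+ 2) = (y - x) * (y + x) / N ^+ 2.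
    by field; exact: lt0r_neq0.
  rewrite normrM normfV [`|N ^+ 2|]gtr0_norm ?exprn_gt0// ler_pdivrMr ?exprn_gt0//.
  have -> : 2 / N * `|x - y| * N ^+ 2 = `|x - y| * (2 * N).
    by field; exact: lt0r_neq0.
  rewrite normrM distrC ler_wpM2l// (le_trans (ler_normD _ _))//.
  by have := le_trans xy yN; lra.
rewrite (bump_out yN) subr0 ger0_norm ?bump_ge0//.
have [xN|xN] := leP `|x| N; last first.
  by rewrite bump_out// mulr_ge0// divr_ge0// ltW.
by rewrite /bump indE xN mul1r key.
Qed.

Lemma lipschitz_continuous f C : (forall x y, `|f x - f y| <= C * `|x - y|) ->
  continuous f.
Proof.
move=> h x; apply/cvgrPdist_le => eps eps0.
have C0 : 0 < `|C| + 1 by rewrite ltr_wpDl.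
near=> y; rewrite (le_trans (h x y))// (@le_trans _ _ ((`|C| + 1) * `|x - y|))//.
  by rewrite ler_wpM2r// (le_trans (ler_norm _))// lerDl.
rewrite -ler_pdivlMl//; near: y.
by apply: cvgr_dist_le; [exact: cvg_id|rewrite mulr_gt0 ?invr_gt0].
Unshelve. all: by end_near. Qed.

Lemma continuous_bump N : 0 < N -> continuous (bump N).
Proof.
by move=> N0; apply: (@lipschitz_continuous _ (2 / N)) => x y; exact: bump_lipschitz.
Qed.

Lemma rintegrable_ind g N : continuous g -> rint (fun x => ind N x * g x).
Proof. exact: rintegrable_itv. Qed.

Lemma rintegral_ind N : 0 < N -> rint (ind N) /\ \int[mu]_x ind N x = 2 * N.
Proof.
move=> N0.
have e : (fun x => ind N x * 1) = ind N by apply/funext => x; rewrite mulr1.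
split; first by rewrite -e; exact: (@rintegrable_ind (fun=> 1) N (@continuous_cst R 1)).
have <- : \int[mu]_x (ind N x * 1) = \int[mu]_x ind N x by apply: eq_rintegral => x; rewrite mulr1.
have := @rintegral_itv_FTC R (fun x => x) (fun=> 1) (- N) N.
move=> ->; [by ring|by lra|exact: continuous_cst].
Qed.

Lemma rintegral_ind_FTC F f N : 0 < N -> (forall x : R, is_derive x 1 F (f x)) ->
  continuous f -> \int[mu]_x (ind N x * f x) = F N - F (- N).
Proof. by move=> N0 dF cf; rewrite (@rintegral_itv_FTC _ F)//; lra. Qed.

Lemma bump0_end N : 0 < N -> bump0 N N = 0 /\ bump0 N (- N) = 0.
Proof.
move=> N0; rewrite /bump0; split; field; exact: lt0r_neq0.
Qed.

Definition dbump0 N x := - (2 * x / N ^+ 2).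

Lemma is_derive_bump0 N x : 0 < N -> is_derive x 1 (bump0 N) (dbump0 N x).
Proof.
move=> N0.
have D := deriveBf (derive_cstf 1 x) (deriveXf 2 (deriveMf (derive_idf x) (derive_cstf N^-1 x))).
by apply: (derive_eqf D); rewrite /dbump0 /=; field; exact: lt0r_neq0.
Qed.

Lemma continuous_bump0 N : continuous (bump0 N).
Proof.
apply: continuousBf; first exact: continuous_cst.
apply: continuousXf; apply: continuousMf; first exact: continuous_idf.
exact: continuous_cst.
Qed.

Lemma continuous_dbump0 N : continuous (dbump0 N).
Proof.
apply: continuousNf; apply: continuousMf; last exact: continuous_cst.
by apply: continuousMf; [exact: continuous_cst|exact: continuous_idf].
Qed.

Lemma half_le (a b k : R) : a + a <= 2 * b + (k + k) -> a <= b + k.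
Proof. by lra. Qed.

(* IMS localization: symmetrizing bump ^+ 4 (x), the square of the cutoff
   bump ^+ 2, leaves the error (bump^2 (x) - bump^2 (y)) ^+ 2 / 2, and the
   kernel times (x - y) ^+ 2 is at most e ^+ 2 * cauchy e. *)
Section ims.
Variables (N C e : R) (r f : R -> R).
Hypotheses (N0 : 0 < N) (e0 : 0 < e)
  (dr : forall x : R, is_derive x 1 r (f x)) (cf : continuous f)
  (f2 : rint (fun t => f t ^+ 2)) (r0 : forall x, 0 <= r x) (rC : forall x, r x <= C).

Let sg x := bump N x ^+ 2 * r x.
Let cr : continuous r. Proof. exact: derive_continuousf dr. Qed.
Let csg : continuous sg.
Proof. by apply: continuousMf => //; apply: continuousXf; exact: continuous_bump. Qed.

Let rC' x : `|r x| <= C. Proof. by rewrite ger0_norm. Qed.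

Lemma rintegrable_bump_M n g : continuous g -> rint (fun x => bump N x ^+ n.+1 * g x).
Proof.
move=> cg.
have := @rintegrable_ind (fun x => bump0 N x ^+ n.+1 * g x) N.
have c0 : continuous (fun x => bump0 N x ^+ n.+1 * g x).
  by apply: continuousMf => //; apply: continuousXf; exact: continuous_bump0.
by move=> /(_ c0); apply: eq_rintegrable => x; rewrite mulrA bumpX.
Qed.

(** Here 4 / N is a Lipschitz constant of bump^2, C^2 bounds r x * r y, and e^2 comes from
    [dconj_ker_sqr_le]. *)
Let K := (4 / N) ^+ 2 * C ^+ 2 * e ^+ 2.

Let pointwise x y :
  bump N x ^+ 4 * r x * dconj_ker e (x - y) * r y +
  bump N y ^+ 4 * r y * dconj_ker e (y - x) * r x <=
  2 * (sg x * dconj_ker e (x - y) * sg y) +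
  (K * (ind N x * cauchy e (x - y)) + K * (ind N y * cauchy e (y - x))).
Proof.
rewrite -(dconj_ker_opp e (y - x)) -(cauchy_opp e (y - x)) opprB.
set L := dconj_ker e (x - y); set P := cauchy e (x - y).
have P0 : 0 < P by exact: cauchy_gt0.
have K0 : 0 <= K by apply: mulr_ge0; [apply: mulr_ge0|]; exact: sqr_ge0.
have -> : K * (ind N x * P) + K * (ind N y * P) = K * (ind N x + ind N y) * P by ring.
rewrite -lerBlDl.
have -> : bump N x ^+ 4 * r x * L * r y + bump N y ^+ 4 * r y * L * r x -
    2 * (sg x * L * sg y) = (bump N x ^+ 2 - bump N y ^+ 2) ^+ 2 * (r x * r y) * L.
  by rewrite /sg; ring.
(* Where the kernel is nonpositive the error term is nonpositive as well. Otherwise it is nonzero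
   only if one of the points lies in the support of the cutoff; the weights [ind] record this and
   keep the error integrable. *)
have [L0|L0] := leP L 0.
  apply: (@le_trans _ _ 0).
    by rewrite mulr_ge0_le0// mulr_ge0 ?sqr_ge0// mulr_ge0.
  by rewrite mulr_ge0 ?(ltW P0)// mulr_ge0// addr_ge0 ?ind_ge0.
have [inx|outx] := eqVneq (ind N x + ind N y) 0.
  have hx : ind N x = 0 by have := ind_ge0 N x; have := ind_ge0 N y; lra.
  have hy : ind N y = 0 by have := ind_ge0 N x; have := ind_ge0 N y; lra.
  by rewrite hx hy /bump hx hy; lra.
have i1 : 1 <= ind N x + ind N y.
  move: outx; rewrite !indE.
  by case: ifP; case: ifP => // _ _; rewrite ?addr0 ?eqxx//; lra.
have hb : (bump N x ^+ 2 - bump N y ^+ 2) ^+ 2 <= (4 / N) ^+ 2 * (x - y) ^+ 2.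
  rewrite -exprMn -[leLHS]real_normK ?num_real// -[leRHS]real_normK ?num_real//.
  rewrite ler_sqr ?nnegrE// subr_sqr normrM.
  have h2 : `|bump N x + bump N y| <= 2.
    rewrite ger0_norm ?addr_ge0 ?bump_ge0//.
    by have := bump_le1 N x; have := bump_le1 N y; lra.
  apply: (@le_trans _ _ (2 / N * `|x - y| * 2)).
    by rewrite ler_pM//; exact: bump_lipschitz.
  by rewrite normrM [`|4 / N|]gtr0_norm ?divr_gt0//; lra.
have hr : r x * r y <= C ^+ 2 by rewrite expr2 ler_pM.
apply: (@le_trans _ _ ((4 / N) ^+ 2 * (x - y) ^+ 2 * C ^+ 2 * L)).
  rewrite ler_wpM2r ?(ltW L0)// ler_pM ?sqr_ge0//; exact: mulr_ge0.
have -> : (4 / N) ^+ 2 * (x - y) ^+ 2 * C ^+ 2 * L =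
   ((4 / N) ^+ 2 * C ^+ 2) * ((x - y) ^+ 2 * L) by ring.
apply: (@le_trans _ _ ((4 / N) ^+ 2 * C ^+ 2 * (e ^+ 2 * P))).
  by rewrite ler_wpM2l ?dconj_ker_sqr_le// mulr_ge0 ?sqr_ge0.
have -> : (4 / N) ^+ 2 * C ^+ 2 * (e ^+ 2 * P) = K * 1 * P by rewrite /K; ring.
by rewrite ler_wpM2r ?(ltW P0)// ler_wpM2l.
Qed.

Lemma rintegrable2_dconj : rint2 (fun w => sg w.1 * dconj_ker e (w.1 - w.2) * sg w.2).
Proof.
have i1 := rintegrable_conv (rintegrable_bump_M 1 cr) (rintegrable_dconj_ker e0).
have := @rintegrable2M_bounded R (fun w => sg w.2) _ C _ _ i1.
have m1 : measurable_fun setT (fun w : RR * RR => sg w.2).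
  exact: (measurableT_comp (continuous_rmeasurable csg) measurable_snd).
have b1 (w : R * R) : `|sg w.2| <= C.
  rewrite /sg normrM -[leRHS]mul1r ler_pM// ger0_norm ?sqr_ge0//.
  by rewrite expr_le1 ?bump_ge0 ?bump_le1.
by move=> /(_ m1 b1); apply: eq_rintegrable => w; rewrite /sg; ring.
Qed.

Lemma ims_localization :
  \int[mu]_x (bump N x ^+ 4 * r x * conj_poisson e f x) <=
  \int[mu2]_w (sg w.1 * dconj_ker e (w.1 - w.2) * sg w.2) +
  32 * C ^+ 2 * pi / N * e.
Proof.
have ib := rintegrable_bump_M 3 cr.
pose F1 (w : R * R) := bump N w.1 ^+ 4 * r w.1 * dconj_ker e (w.1 - w.2) * r w.2.
have iF : rint2 F1.
  have := @rintegrable2M_bounded R (fun w => r w.2) _ C _ _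
    (rintegrable_conv ib (rintegrable_dconj_ker e0)).
  have m1 : measurable_fun setT (fun w : RR * RR => r w.2).
    exact: (measurableT_comp (continuous_rmeasurable cr) measurable_snd).
  by move=> /(_ m1 (fun w => rC' _)); apply: eq_rintegrable => w; rewrite /F1; ring.
have E1 : \int[mu]_x (bump N x ^+ 4 * r x * conj_poisson e f x) = \int[mu2]_w F1 w.
  rewrite -(rfubini1 iF).2; apply: eq_rintegral => x.
  rewrite (@conj_poisson_by_parts _ r f C)// -rintegralZ.
    by apply: eq_rintegral => y; rewrite /F1/=; ring.
  exact: (@rintegrable_dconj_ker_M _ r f C).
have iS := rintegrable2_dconj.
have [hc ic] := rintegral_cauchy e0.
have [hi ii] := rintegral_ind N0.
have iP := rintegrable_conv hi hc.
have iP' := rintegrable_swap iP.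
have vP := rintegral_conv hi hc.
have vP' := rintegral_swap iP.
have iE := rintegrableD (rintegrableZ K iP) (rintegrableZ K iP').
have := le_rintegral (rintegrableD iF (rintegrable_swap iF))
  (rintegrableD (rintegrableZ 2 iS) iE) (fun w => pointwise w.1 w.2).
rewrite (rintegralD iF (rintegrable_swap iF)) (rintegral_swap iF).
rewrite (rintegralD (rintegrableZ 2 iS) iE) (rintegralZ 2 iS).
rewrite (rintegralD (rintegrableZ K iP) (rintegrableZ K iP')).
rewrite (rintegralZ K iP) (rintegralZ K iP') vP' vP ic ii E1.
have -> : K * (2 * N * (pi / e)) = 32 * C ^+ 2 * pi / N * e.
  by rewrite /K; field; rewrite !lt0r_neq0.
exact: half_le.
Qed.

End ims.
End cutoff.

Lemma le_square_expansion (R : realDomainType) (p q s t : R) :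
  0 <= p - q + s -> s <= t -> q <= p + t.
Proof. lra. Qed.

(** * The localized Gagliardo-Nirenberg inequality *)

Section gagliardo_nirenberg.
Context {R : realType}.
Local Notation mu := (@lebesgue_measure R).
Local Notation rint := (rintegrable mu).
Local Notation mu2 := (mu \x mu)%E.
Local Notation rint2 := (rintegrable mu2).
Local Notation RR := (measurableTypeR R).
Variables (N C e a : R) (psi psi1 : R -> R).
Hypotheses (N0 : 0 < N) (e0 : 0 < e)
  (dpsi : forall x : R, is_derive x 1 psi (psi1 x)) (cpsi1 : continuous psi1)
  (psiC : forall x, psi x ^+ 2 <= C).

Let cpsi : continuous psi. Proof. exact: derive_continuousf dpsi. Qed.

Let w x := bump0 N x * psi x.
Let w1 x := bump0 N x * psi1 x + psi x * dbump0 N x.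
Let sg x := bump N x ^+ 2 * psi x ^+ 2.

Let dw (x : R) : is_derive x 1 w (w1 x).
Proof. exact: (deriveMf (is_derive_bump0 x N0) (dpsi x)). Qed.

Let cw : continuous w. Proof. exact: derive_continuousf dw. Qed.

Let cw1 : continuous w1.
Proof.
by apply: continuousDf; apply: continuousMf => //;
  [exact: continuous_bump0|exact: continuous_dbump0].
Qed.

Let csg : continuous sg.
Proof. by apply: continuousMf; apply: continuousXf => //; exact: continuous_bump. Qed.

Let sgE x : sg x = ind N x * w x ^+ 2.
Proof. by rewrite /w exprMn mulrA bumpX. Qed.

Let sg0 x : 0 <= sg x. Proof. by rewrite /sg mulr_ge0 ?sqr_ge0. Qed.

Let sgC x : sg x <= C.
Proof.
rewrite -[leRHS]mul1r /sg ler_pM ?sqr_ge0//.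
by rewrite expr_le1 ?bump_ge0 ?bump_le1.
Qed.

Let isg : rint sg.
Proof.
have := @rintegrable_ind R (fun x => w x ^+ 2) N (@continuousXf _ _ 2 cw).
by apply: eq_rintegrable => x; rewrite sgE.
Qed.

Let v := conj_poisson e sg.

Let ck (y : R) : continuous (fun x => conj_ker e (x - y)).
Proof.
apply: continuous_compf; first exact: continuous_conj_ker.
by apply: continuousBf; [exact: continuous_idf|exact: continuous_cst].
Qed.

Let cL (y : R) : continuous (fun x => dconj_ker e (x - y)).
Proof.
apply: continuous_compf; first exact: continuous_dconj_ker.
by apply: continuousBf; [exact: continuous_idf|exact: continuous_cst].
Qed.

(** Integration by parts on [-N, N] at fixed y; the boundary terms vanish because [bump0] does at
    both ends. *)
Let inner_by_parts y :
  \int[mu]_x (ind N x * (2 * w x * w1 x) * conj_ker e (x - y)) =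
  - \int[mu]_x (sg x * dconj_ker e (x - y)).
Proof.
pose g1 x := 2 * w x * w1 x * conj_ker e (x - y).
pose g2 x := w x ^+ 2 * dconj_ker e (x - y).
have c1 : continuous g1.
  apply: continuousMf => //; apply: continuousMf => //; apply: continuousMf => //.
  exact: continuous_cst.
have c2 : continuous g2 by apply: continuousMf => //; exact: continuousXf.
have i1 := rintegrable_ind N c1; have i2 := rintegrable_ind N c2.
have := @rintegral_ind_FTC R (fun x => w x ^+ 2 * conj_ker e (x - y))
  (fun x => g1 x + g2 x) N N0.
have [b1 b2] := bump0_end N0.
rewrite /w b1 b2 !mul0r expr0n/= !mul0r subrr -/w => H.
have D (x : R) : is_derive x 1 (fun x => w x ^+ 2 * conj_ker e (x - y)) (g1 x + g2 x).
  have D1 := @derive_compf _ (conj_ker e) (fun x => x - y) x _ _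
    (is_derive_conj_ker _ e0) (deriveBf (derive_idf x) (derive_cstf y x)).
  by apply: (derive_eqf (deriveMf (deriveXf 2 (dw x)) D1)); rewrite /g1 /g2 /=; ring.
have {H} := H D (continuousDf c1 c2).
have E : \int[mu]_x (ind N x * (g1 x + g2 x)) =
    \int[mu]_x (ind N x * g1 x) + \int[mu]_x (ind N x * g2 x).
  by rewrite -rintegralD//; apply: eq_rintegral => x; rewrite mulrDr.
rewrite E => /eqP; rewrite addr_eq0 => /eqP h.
transitivity (\int[mu]_x (ind N x * g1 x)).
  by apply: eq_rintegral => x; rewrite /g1 /w; ring.
rewrite h; congr (- _); apply: eq_rintegral => x.
by rewrite sgE /g2 mulrA.
Qed.

Let ig : rint (fun x => ind N x * (2 * w x * w1 x)).
Proof.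
apply: rintegrable_ind; apply: continuousMf => //; apply: continuousMf => //.
exact: continuous_cst.
Qed.

Let ikv : forall x, rint (fun y => conj_ker e (x - y) * sg y).
Proof.
move=> x; apply: (@rintegrable_conv_bounded R sg (conj_ker e) (2 * e)^-1 x) => //.
  exact: continuous_conj_ker.
by move=> t; exact: conj_ker_bound.
Qed.

(** The cross term of the expanded square. Fubini puts the x-integral inside, where the derivative
    of w^2 moves onto the kernel; the sign produced is the one that turns the square into an upper
    bound for the quadratic form. *)
Let energy_cross :
  \int[mu]_x (ind N x * (2 * w x * w1 x) * v x) =
  - \int[mu2]_z (sg z.1 * dconj_ker e (z.1 - z.2) * sg z.2).
Proof.
pose F (z : R * R) := conj_ker e (z.1 - z.2) * (ind N z.1 * (2 * w z.1 * w1 z.1) * sg z.2).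
have iF : rint2 F.
  apply: (@rintegrable2M_bounded R _ _ (2 * e)^-1) (rintegrable_prod ig isg) => [|z].
    by apply: measurable_sub2; exact: continuous_conj_ker.
  exact: conj_ker_bound.
pose S (z : R * R) := sg z.1 * dconj_ker e (z.1 - z.2) * sg z.2.
have iS : rint2 S.
  have cf : continuous (fun x => 2 * psi x * psi1 x).
    by apply: continuousMf => //; apply: continuousMf => //; exact: continuous_cst.
  have dr (x : R) : is_derive x 1 (fun x => psi x ^+ 2) (2 * psi x * psi1 x).
    exact: (derive_eqf (deriveXf 2 (dpsi x))).
  exact: (@rintegrable2_dconj R N C e _ _ N0 e0 dr (fun x => sqr_ge0 _) psiC).
transitivity (\int[mu2]_z F z).
  rewrite -(rfubini1 iF).2; apply: eq_rintegral => x.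
  rewrite /v /conj_poisson -rintegralZ//; apply: eq_rintegral => y.
  by rewrite /F/=; ring.
rewrite -(rfubini2 iF).2 -[RHS]mulN1r -(rfubini2 iS).2 -rintegralZ; last exact: (rfubini2 iS).1.
apply: eq_rintegral => y.
transitivity (sg y * \int[mu]_x (ind N x * (2 * w x * w1 x) * conj_ker e (x - y))).
  rewrite -rintegralZ; first by apply: eq_rintegral => x; rewrite /F/=; ring.
  have := @rintegrable_ind R (fun x => 2 * w x * w1 x * conj_ker e (x - y)) N.
  have c1 : continuous (fun x => 2 * w x * w1 x * conj_ker e (x - y)).
    apply: continuousMf => //; apply: continuousMf => //; apply: continuousMf => //.
    exact: continuous_cst.
  by move=> /(_ c1); apply: eq_rintegrable => x; rewrite mulrA.
rewrite inner_by_parts mulrN mulN1r; congr (- _).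
rewrite -rintegralZ; first by apply: eq_rintegral => x; rewrite /S/=; ring.
have := @rintegrable_ind R (fun x => w x ^+ 2 * dconj_ker e (x - y)) N.
have c1 : continuous (fun x => w x ^+ 2 * dconj_ker e (x - y)).
  by apply: continuousMf => //; exact: continuousXf.
by move=> /(_ c1); apply: eq_rintegrable => x; rewrite sgE mulrA.
Qed.

(* Expand 0 <= (w' + (a / pi) w v)^2, with w the localized psi and v the
   conjugate Poisson integral of w^2. *)
Lemma localized_gagliardo_nirenberg :
  a / pi * \int[mu2]_z (sg z.1 * dconj_ker e (z.1 - z.2) * sg z.2) <=
  \int[mu]_x (ind N x * w1 x ^+ 2) + a ^+ 2 / 3 * \int[mu]_x sg x ^+ 3.
Proof.
pose b : R := a / pi.
have p0 : pi != 0 :> R by rewrite lt0r_neq0 ?pi_gt0.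
have i1 : rint (fun x => ind N x * w1 x ^+ 2).
  by apply: rintegrable_ind; exact: continuousXf.
have mv : @measurable_fun _ _ RR R setT v.
  apply: (@measurable_conv R sg (conj_ker e) (2 * e)^-1) => //.
    exact: continuous_conj_ker.
  by move=> t; exact: conj_ker_bound.
have i3 : rint (fun x => sg x * v x ^+ 2).
  exact: rintegrable_conj_sqr.
have i2 : rint (fun x => ind N x * (2 * w x * w1 x) * v x).
  apply: le_rintegrable (rintegrableD i1 i3).
    by apply: measurable_funM => //; exact: rintegrable_measurable ig.
  move=> x; rewrite sgE.
  have -> : ind N x * (2 * w x * w1 x) * v x = ind N x * (2 * (w1 x * (w x * v x))) by ring.
  have -> : ind N x * w1 x ^+ 2 + ind N x * w x ^+ 2 * v x ^+ 2 =
    ind N x * (w1 x ^+ 2 + (w x * v x) ^+ 2) by ring.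
  rewrite normrM (ger0_norm (ind_ge0 _ _)) ler_wpM2l ?ind_ge0//.
  move: (w1 x) (w x * v x) => s t; rewrite ler_norml.
  have := sqr_ge0 (s - t); have := sqr_ge0 (s + t); rewrite sqrrB sqrrD => h1 h2.
  by apply/andP; split; lra.
have h0 : 0 <= \int[mu]_x (ind N x * (w1 x + b * (w x * v x)) ^+ 2).
  by apply: Rintegral_ge0 => x _; rewrite mulr_ge0 ?ind_ge0 ?sqr_ge0.
have E : \int[mu]_x (ind N x * (w1 x + b * (w x * v x)) ^+ 2) =
   \int[mu]_x (ind N x * w1 x ^+ 2) + b * \int[mu]_x (ind N x * (2 * w x * w1 x) * v x)
   + b ^+ 2 * \int[mu]_x (sg x * v x ^+ 2).
  rewrite -(rintegralZ b i2) -(rintegralZ (b ^+ 2) i3).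
  rewrite -(rintegralD i1 (rintegrableZ b i2)).
  rewrite -(rintegralD (rintegrableD i1 (rintegrableZ b i2)) (rintegrableZ (b ^+ 2) i3)).
  by apply: eq_rintegral => x; rewrite sgE; ring.
move: h0; rewrite E energy_cross.
have h3 := @conj_poisson_sqr_le R e C sg e0 csg sg0 sgC isg.
have h4 : b ^+ 2 * \int[mu]_x (sg x * v x ^+ 2) <= a ^+ 2 / 3 * \int[mu]_x sg x ^+ 3.
  have -> : a ^+ 2 / 3 * \int[mu]_x sg x ^+ 3 =
     b ^+ 2 * (pi ^+ 2 / 3 * \int[mu]_x sg x ^+ 3).
    have Hb : b ^+ 2 * pi ^+ 2 = a ^+ 2 by rewrite /b exprMn exprVn mulfVK// expf_neq0.
    by rewrite -Hb; ring.
  by rewrite ler_wpM2l ?sqr_ge0.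
rewrite mulrN => h5.
exact: le_square_expansion h5 h4.
Qed.

End gagliardo_nirenberg.

(** * The virial inequality *)

Section cutoff_limits.
Context {R : realType}.
Implicit Types (x : R).

Lemma cvg_ind (N_ : nat -> R) x : N_ @ \oo --> +oo -> (fun n => ind (N_ n) x) @ \oo --> (1 : R).
Proof.
move=> NN; apply: cvg_near_cst; near=> n; rewrite indE.
suff -> : `|x| <= N_ n by [].
by near: n; move/cvgryPge : NN; exact.
Unshelve. all: by end_near. Qed.

Lemma cvg_inv_infty (N_ : nat -> R) : N_ @ \oo --> +oo -> (fun n => (N_ n)^-1) @ \oo --> (0 : R).
Proof.
move=> NN; apply/(@gtr0_cvgV0 R nat \oo _ N_) => //.
by move/cvgryPgt : NN; exact.
Qed.

Lemma cvg_bump0 (N_ : nat -> R) x : N_ @ \oo --> +oo -> (fun n => bump0 (N_ n) x) @ \oo --> (1 : R).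
Proof.
move=> /cvg_inv_infty h; rewrite /bump0.
rewrite [X in _ --> X](_ : _ = 1 - (x * 0) * (x * 0)); last by ring.
apply: cvgB; first exact: cvg_cst.
by under eq_fun do rewrite expr2; apply: cvgM; apply: cvgM => //; exact: cvg_cst.
Qed.

Lemma cvg_dbump0 (N_ : nat -> R) x : N_ @ \oo --> +oo -> (fun n => dbump0 (N_ n) x) @ \oo --> (0 : R).
Proof.
move=> /cvg_inv_infty h; rewrite /dbump0.
rewrite [X in _ --> X](_ : _ = - (2 * x * (0 * 0))); last by ring.
apply: cvgN; apply: cvgM; first exact: cvg_cst.
by under eq_fun do rewrite -exprVn expr2; exact: cvgM.
Qed.

Lemma cvg_natS : (fun n => n.+1%:R : R) @ \oo --> +oo.
Proof.
apply/cvgryPge => M; near=> n.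
have : M <= n%:R by near: n; exact: nbhs_infty_ger.
by move=> /le_trans; apply; rewrite ler_nat.
Unshelve. all: by end_near. Qed.

(** A majorant uniform in N: psi^2 is merely bounded, so the integrability of the terms with psi^2
    (bump0')^2 has to come from the cutoff. *)
Lemma dbump0_sqr_le N x : 1 <= N -> `|x| <= N -> dbump0 N x ^+ 2 <= 8 * cauchy 1 x.
Proof.
move=> N1 xN; have N0 : 0 < N by lra.
have c0 := cauchy_den_gt0 x (ltr01 : 0 < (1 : R)).
have x2 : x ^+ 2 <= N ^+ 2.
  by rewrite -real_normK ?num_real// ler_sqr ?nnegrE// ltW.
have N2 : 1 <= N ^+ 2 by rewrite expr_ge1// ltW.
rewrite /dbump0 sqrrN /cauchy ler_pdivlMr//.
have -> : (2 * x / N ^+ 2) ^+ 2 * (x ^+ 2 + 1 ^+ 2) =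
  4 * x ^+ 2 * (x ^+ 2 + 1) / N ^+ 4 by field; exact: lt0r_neq0.
rewrite ler_pdivrMr ?exprn_gt0//.
have -> : 8 * N ^+ 4 = 4 * N ^+ 2 * (N ^+ 2 + N ^+ 2) by ring.
apply: ler_pM.
- by rewrite mulr_ge0// sqr_ge0.
- by rewrite addr_ge0// sqr_ge0.
- by rewrite ler_wpM2l.
- by rewrite lerD.
Qed.

(** Domination for N to infinity, with b and d the cutoff and its derivative, p = psi, q = psi', g =
    - gamma and W a majorant of p^2 d^2. The constants are crude. *)
Lemma virial_integrand_bound (a B g b d p q W : R) : 0 <= a -> 0 <= B -> 0 <= g ->
  0 <= b <= 1 -> p ^+ 2 * d ^+ 2 <= W ->
  `|a * (b ^+ 4 * q ^+ 2 + 4 * (b ^+ 3 * d * (p * q)) + B * (b ^+ 4 * p ^+ 6)) +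
    - g * ((b * q + p * d) ^+ 2 + a ^+ 2 / 3 * (b ^+ 6 * p ^+ 6))| <=
  (a * (B + 5) + g * (4 + a ^+ 2)) * (q ^+ 2 + p ^+ 6 + W).
Proof.
move=> a0 B0 g0 /andP[b0 b1] dW.
have p6 : 0 <= p ^+ 6 by rewrite exprn_even_ge0.
have q2 := sqr_ge0 q.
have W0 : 0 <= W by rewrite (le_trans _ dW)// mulr_ge0// sqr_ge0.
have bk k y : 0 <= y -> b ^+ k * y <= y by move=> y0; rewrite ler_piMl// exprn_ile1.
have bk0 k y : 0 <= y -> 0 <= b ^+ k * y by move=> y0; rewrite mulr_ge0// exprn_ge0.
have h2 := bk 2%N _ q2.
have h4q := bk 4%N _ q2; have h4p := bk 4%N _ p6; have h6p := bk 6%N _ p6.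
have g4q := bk0 4%N _ q2; have g4p := bk0 4%N _ p6; have g6p := bk0 6%N _ p6.
have cr : `|4 * (b ^+ 3 * d * (p * q))| <= 2 * q ^+ 2 + 2 * W.
  have b31 : b ^+ 3 <= 1 by rewrite exprn_ile1.
  have b30 : 0 <= b ^+ 3 by rewrite exprn_ge0.
  have -> : 4 * (b ^+ 3 * d * (p * q)) = b ^+ 3 * (4 * (p * d) * q) by ring.
  rewrite normrM (ger0_norm b30).
  apply: (@le_trans _ _ (1 * `|4 * (p * d) * q|)); first by rewrite ler_wpM2r.
  have s1 := sqr_ge0 (p * d + q); have s2 := sqr_ge0 (p * d - q).
  by rewrite mul1r ler_norml; apply/andP; split; nra.
have sq : (b * q + p * d) ^+ 2 <= 2 * q ^+ 2 + 2 * W.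
  by have s1 := sqr_ge0 (b * q - p * d); nra.
have sq0 := sqr_ge0 (b * q + p * d).
have a20 : 0 <= a ^+ 2 / 3 by rewrite divr_ge0// sqr_ge0.
apply: le_trans (ler_normD _ _) _; rewrite !normrM normrN (ger0_norm a0) (ger0_norm g0).
rewrite [leRHS]mulrDl -(mulrA a (B + 5)) -(mulrA g (4 + _)); apply: lerD.
  rewrite ler_wpM2l//; apply: le_trans (ler_normD _ _) _.
  apply: (@le_trans _ _ (q ^+ 2 + (2 * q ^+ 2 + 2 * W) + B * p ^+ 6)).
    apply: lerD; first by apply: le_trans (ler_normD _ _) (lerD _ cr); rewrite ger0_norm.
    by rewrite normrM (ger0_norm B0) (ger0_norm g4p) ler_wpM2l.
  have := mulr_ge0 B0 q2; have := mulr_ge0 B0 W0; lra.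
rewrite ler_wpM2l// ger0_norm ?addr_ge0//; last by rewrite mulr_ge0.
apply: (@le_trans _ _ (2 * q ^+ 2 + 2 * W + a ^+ 2 / 3 * p ^+ 6)).
  by apply: lerD => //; rewrite ler_wpM2l.
have a2 := sqr_ge0 a.
have := mulr_ge0 a2 q2; have := mulr_ge0 a2 W0; have := mulr_ge0 a2 p6; lra.
Qed.

Lemma cvg_seqD (v w : nat -> R) (l m : R) : v @ \oo --> l -> w @ \oo --> m ->
  (fun n => v n + w n) @ \oo --> l + m.
Proof. by move=> hv hw; exact: cvgD. Qed.

Lemma cvg_seqM (v w : nat -> R) (l m : R) : v @ \oo --> l -> w @ \oo --> m ->
  (fun n => v n * w n) @ \oo --> l * m.
Proof. by move=> hv hw; exact: cvgM. Qed.

Lemma cvg_virial_integrand (a B g p q : R) (i b d : nat -> R) :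
  i @ \oo --> (1 : R) -> b @ \oo --> (1 : R) -> d @ \oo --> (0 : R) ->
  (fun n => i n * (a * (b n ^+ 4 * q ^+ 2 + 4 * (b n ^+ 3 * d n * (p * q)) +
     B * (b n ^+ 4 * p ^+ 6)) +
    g * ((b n * q + p * d n) ^+ 2 + a ^+ 2 / 3 * (b n ^+ 6 * p ^+ 6)))) @ \oo -->
  a * (q ^+ 2 + B * p ^+ 6) + g * (q ^+ 2 + a ^+ 2 / 3 * p ^+ 6).
Proof.
move=> hi hb hd.
have hbX k : (fun n => b n ^+ k) @ \oo --> (1 : R).
  elim: k => [|k IH]; first exact: cvg_cst.
  have h : (fun n => b n * b n ^+ k) @ \oo --> (1 * 1 : R) by exact: cvgM.
  by move: h; rewrite mulr1; under eq_fun do rewrite -exprS.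
have cC (c : R) : (fun _ : nat => c) @ \oo --> c by exact: cvg_cst.
have cM c l (v : nat -> R) (h : v @ \oo --> l) := cvg_seqM (cC c) h.
have cMr c l (v : nat -> R) (h : v @ \oo --> l) := cvg_seqM h (cC c).
have h1 := cvg_seqD (cMr q _ _ hb) (cM p _ _ hd).
have h2 := cvg_seqM h1 h1.
have h3 := cvg_seqD h2 (cM (a ^+ 2 / 3) _ _ (cMr (p ^+ 6) _ _ (hbX 6%N))).
have h4 := cM 4 _ _ (cMr (p * q) _ _ (cvg_seqM (hbX 3%N) hd)).
have h5 := cvg_seqD (cvg_seqD (cMr (q ^+ 2) _ _ (hbX 4%N)) h4) (cM B _ _ (cMr (p ^+ 6) _ _ (hbX 4%N))).
have h6 := cvg_seqM hi (cvg_seqD (cM a _ _ h5) (cM g _ _ h3)).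
have E : 1 * (a * (1 * q ^+ 2 + 4 * (1 * 0 * (p * q)) + B * (1 * p ^+ 6)) +
   g * ((1 * q + p * 0) * (1 * q + p * 0) + a ^+ 2 / 3 * (1 * p ^+ 6))) =
  a * (q ^+ 2 + B * p ^+ 6) + g * (q ^+ 2 + a ^+ 2 / 3 * p ^+ 6) by ring.
rewrite -E; apply: cvg_trans h6; apply: near_eq_cvg; near=> n => /=.
by rewrite [in RHS]expr2.
Unshelve. all: by end_near. Qed.

End cutoff_limits.

Section virial.
Context {R : realType}.
Local Notation mu := (@lebesgue_measure R).
Local Notation rint := (rintegrable mu).
Local Notation mu2 := (mu \x mu)%E.
Local Notation rint2 := (rintegrable mu2).
Local Notation RR := (measurableTypeR R).
Variables (gamma B C : R) (psi psi1 psi2 u : R -> R).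
Hypotheses (gamma0 : gamma < 0) (B0 : 0 < B)
  (dpsi : forall x : R, is_derive x 1 psi (psi1 x))
  (dpsi1 : forall x : R, is_derive x 1 psi1 (psi2 x)) (cpsi2 : continuous psi2)
  (psiC : forall x, psi x ^+ 2 <= C)
  (iK : rint (fun x => psi1 x ^+ 2)) (iS : rint (fun x => psi x ^+ 6))
  (equ : forall x, psi2 x = B * psi x ^+ 5 + gamma * psi x * u x).

Let f x := 2 * psi x * psi1 x.

(** The Hilbert transform enters only through the function [u], by way of the equation and of these
    two facts: pointwise convergence of the regularization and a bound that is locally uniform in x
    and uniform in e. *)
Hypotheses
  (hu : forall (x : R) (e_ : nat -> R), (forall n, 0 < e_ n) -> e_ @ \oo --> (0 : R) ->
    (fun n => conj_poisson (e_ n) f x) @ \oo --> pi * u x)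
  (hb : forall N : R, exists Cv : R, forall x e : R, `|x| <= N -> 0 < e ->
    `|conj_poisson e f x| <= Cv).

Let cpsi : continuous psi. Proof. exact: derive_continuousf dpsi. Qed.
Let cpsi1 : continuous psi1. Proof. exact: derive_continuousf dpsi1. Qed.
Let cf : continuous f.
Proof. by apply: continuousMf => //; apply: continuousMf => //; exact: continuous_cst. Qed.
Let drho (x : R) : is_derive x 1 (fun x => psi x ^+ 2) (f x).
Proof. exact: (derive_eqf (deriveXf 2 (dpsi x))). Qed.

Lemma rintegrable_density_derivative_sqr : rint (fun x => f x ^+ 2).
Proof.
apply: le_rintegrable (rintegrableZ (4 * C) iK).
  by apply: continuous_rmeasurable; exact: continuousXf.
move=> x; rewrite ger0_norm ?sqr_ge0//.
have -> : f x ^+ 2 = 4 * psi x ^+ 2 * psi1 x ^+ 2 by rewrite /f; ring.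
by rewrite ler_wpM2r ?sqr_ge0// ler_wpM2l.
Qed.

Let f2 := rintegrable_density_derivative_sqr.

(** The cutoff confines the integral to a compact interval, on which [hb] supplies a bound
    independent of e. *)
Lemma cvg_bump_conj_poisson N n (h : R -> R) (e_ : nat -> R) : 0 < N -> continuous h ->
  (forall k, 0 < e_ k) -> e_ @ \oo --> (0 : R) ->
  (fun k => \int[mu]_x (bump N x ^+ n.+1 * h x * conj_poisson (e_ k) f x)) @ \oo -->
  \int[mu]_x (bump N x ^+ n.+1 * h x * (pi * u x)).
Proof.
move=> N0 ch e0 el; have [Cv hCv] := hb N.
have ib := @rintegrable_bump_M R N n h ch.
have iab : rint (fun x => Cv * `|bump N x ^+ n.+1 * h x|).
  by apply: rintegrableZ; exact: (integrable_abse ib).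
apply: (@rdominated _ RR R mu (fun k x => bump N x ^+ n.+1 * h x * conj_poisson (e_ k) f x)
  (fun x => bump N x ^+ n.+1 * h x * (pi * u x)) _ _ _ _ iab).2.
- move=> k; apply: measurable_funM; first exact: rintegrable_measurable ib.
  apply: measurable_conv_sqr => //; first exact: continuous_conj_ker.
  exact: rintegrable_conj_ker_sqr.
- by move=> x; apply: cvgM; [exact: cvg_cst|exact: hu].
- move=> k x; rewrite normrM mulrC.
  have [xN|xN] := leP `|x| N; first by rewrite ler_wpM2r// hCv.
  by rewrite bump_out// expr0n/= mul0r normr0 !mulr0.
Qed.

Let harm0 k : 0 < @harmonic R k. Proof. by rewrite /harmonic/= invr_gt0. Qed.

Section one_cutoff.
Variables (N a : R).
Hypotheses (N0 : 0 < N) (a0 : 0 < a).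

Let G := \int[mu]_x (ind N x * (bump0 N x * psi1 x + psi x * dbump0 N x) ^+ 2) +
  a ^+ 2 / 3 * \int[mu]_x (bump N x ^+ 2 * psi x ^+ 2) ^+ 3.

Let upper : a * \int[mu]_x (bump N x ^+ 4 * (psi x ^+ 2 * u x)) <= G.
Proof.
have lim := @cvg_bump_conj_poisson N 3 (fun x => psi x ^+ 2) _ N0
  (continuousXf cpsi) harm0 (@cvg_harmonic R).
pose X := \int[mu]_x (bump N x ^+ 4 * psi x ^+ 2 * (pi * u x)).
have p0 : 0 < pi :> R := pi_gt0 R.
have XE : a / pi * X = a * \int[mu]_x (bump N x ^+ 4 * (psi x ^+ 2 * u x)).
  have EX : X = \int[mu]_x (pi * (bump N x ^+ 4 * (psi x ^+ 2 * u x))).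
    by apply: eq_rintegral => x; ring.
  rewrite EX rintegralZ; first by rewrite mulrA divfK// lt0r_neq0.
  have [Cv _] := hb N.
  have := @rintegrable_bump_M R N 3 (fun x => gamma^-1 * (psi x * psi2 x - B * psi x ^+ 6)).
  have cc : continuous (fun x => gamma^-1 * (psi x * psi2 x - B * psi x ^+ 6)).
    apply: continuousMf; first exact: continuous_cst.
    apply: continuousBf; first exact: continuousMf.
    by apply: continuousMf; [exact: continuous_cst|exact: continuousXf].
  move=> /(_ cc); apply: eq_rintegrable => x; congr (_ * _).
  by rewrite equ; field; rewrite lt_eqF.
pose K := 32 * C ^+ 2 * pi / N.
(* At fixed N the localization error is O(e), so it disappears in this limit before N grows. *)
have lim2 : (fun k => a / pi * (\int[mu]_x (bump N x ^+ 4 * psi x ^+ 2 * conj_poisson (harmonic k) f x) - K * harmonic k)) @ \oo --> a / pi * (X - K * 0).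
  apply: cvgM; first exact: cvg_cst.
  apply: cvgB; first exact: lim.
  by apply: cvgM; [exact: cvg_cst|exact: cvg_harmonic].
rewrite mulr0 subr0 XE in lim2.
apply: (cvg_fun_lim_le lim2) => k.
have h1 := ims_localization N0 (harm0 k) drho cf f2 (fun x => sqr_ge0 _) psiC.
have h2 := @localized_gagliardo_nirenberg R N C (harmonic k) a psi psi1 N0 (harm0 k) dpsi cpsi1 psiC.
apply: le_trans h2; rewrite ler_wpM2l//; first by rewrite divr_ge0// ltW// pi_gt0.
by rewrite lerBlDr.
Qed.

Let c0x : continuous (bump0 N). Proof. exact: continuous_bump0. Qed.
Let d0x : continuous (dbump0 N). Proof. exact: continuous_dbump0. Qed.

Let E1 x := bump0 N x ^+ 4 * psi1 x ^+ 2 +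
  4 * (bump0 N x ^+ 3 * dbump0 N x * (psi x * psi1 x)).

Let cE1 : continuous E1.
Proof.
apply: continuousDf; first by apply: continuousMf; exact: continuousXf.
apply: continuousMf; first exact: continuous_cst.
apply: continuousMf; last exact: continuousMf.
by apply: continuousMf => //; exact: continuousXf.
Qed.

(** The equation tested against bump^4 psi. The fourth power is the weight in [ims_localization],
    and the boundary terms vanish because [bump0] does at both ends. *)
Let energy : \int[mu]_x (ind N x * (E1 x + B * (bump0 N x ^+ 4 * psi x ^+ 6))) =
  - gamma * \int[mu]_x (bump N x ^+ 4 * (psi x ^+ 2 * u x)).
Proof.
pose E2 x := bump0 N x ^+ 4 * (psi x * psi2 x).
pose E3 x := B * (bump0 N x ^+ 4 * psi x ^+ 6).
have cE2 : continuous E2.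
  by apply: continuousMf; [exact: continuousXf|exact: continuousMf].
have cE3 : continuous E3.
  apply: continuousMf; first exact: continuous_cst.
  by apply: continuousMf; exact: continuousXf.
have D (x : R) : is_derive x 1 (fun x => bump0 N x ^+ 4 * (psi x * psi1 x)) (E1 x + E2 x).
  have D0 := deriveMf (deriveXf 4 (is_derive_bump0 x N0)) (deriveMf (dpsi x) (dpsi1 x)).
  by apply: (derive_eqf D0); rewrite /E1 /E2 /=; ring.
have := rintegral_ind_FTC N0 D (continuousDf cE1 cE2).
have [-> ->] := bump0_end N0; rewrite expr0n/= !mul0r subrr => h0.
have i1 := rintegrable_ind N cE1; have i2 := rintegrable_ind N cE2.
have i3 := rintegrable_ind N cE3.
have h12 : \int[mu]_x (ind N x * E1 x) = - \int[mu]_x (ind N x * E2 x).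
  apply/eqP; rewrite -addr_eq0 -(rintegralD i1 i2) -[X in _ == X]h0; apply/eqP.
  by apply: eq_rintegral => x; ring.
transitivity (\int[mu]_x (ind N x * E1 x) + \int[mu]_x (ind N x * E3 x)).
  by rewrite -(rintegralD i1 i3); apply: eq_rintegral => x; rewrite /E3; ring.
rewrite h12 addrC -(rintegralB i3 i2).
have g0 : gamma != 0 by rewrite lt_eqF.
have iU : rint (fun x => bump N x ^+ 4 * (psi x ^+ 2 * u x)).
  have := rintegrableZ (gamma^-1) (rintegrableB i2 i3); apply: eq_rintegrable => x.
  by rewrite -bumpX /E2 /E3 equ; field.
rewrite -(rintegralZ (- gamma) iU); apply: eq_rintegral => x.
by rewrite -bumpX /E2 /E3 equ; ring.
Qed.

(** The bound [upper] multiplied by - gamma > 0, with [energy] substituted. Everything is kept under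
    one integral sign so that a single dominated convergence handles N to infinity. *)
Lemma virial_cutoff :
  \int[mu]_x (ind N x * (a * (E1 x + B * (bump0 N x ^+ 4 * psi x ^+ 6)) +
    gamma * ((bump0 N x * psi1 x + psi x * dbump0 N x) ^+ 2 +
     a ^+ 2 / 3 * (bump0 N x ^+ 6 * psi x ^+ 6)))) <= 0.
Proof.
have cw : continuous (fun x => (bump0 N x * psi1 x + psi x * dbump0 N x) ^+ 2).
  by apply: continuousXf; apply: continuousDf; exact: continuousMf.
have c6 : continuous (fun x => bump0 N x ^+ 6 * psi x ^+ 6).
  by apply: continuousMf; exact: continuousXf.
have cE : continuous (fun x => E1 x + B * (bump0 N x ^+ 4 * psi x ^+ 6)).
  apply: continuousDf => //; apply: continuousMf; first exact: continuous_cst.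
  by apply: continuousMf; exact: continuousXf.
have i1 := rintegrable_ind N cE; have i2 := rintegrable_ind N cw.
have i3 := rintegrable_ind N c6.
have i23 := rintegrableD i2 (rintegrableZ (a ^+ 2 / 3) i3).
rewrite (_ : Rintegral _ _ _ = a * \int[mu]_x (ind N x * (E1 x + B * (bump0 N x ^+ 4 * psi x ^+ 6)))
  + gamma * (\int[mu]_x (ind N x * (bump0 N x * psi1 x + psi x * dbump0 N x) ^+ 2) +
     a ^+ 2 / 3 * \int[mu]_x (ind N x * (bump0 N x ^+ 6 * psi x ^+ 6)))); last first.
  rewrite -(rintegralZ _ i3) -(rintegralD i2 (rintegrableZ (a ^+ 2 / 3) i3)).
  rewrite -(rintegralZ gamma i23) -(rintegralZ a i1).
  rewrite -(rintegralD (rintegrableZ a i1) (rintegrableZ gamma i23)).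
  by apply: eq_rintegral => x; ring.
rewrite energy.
have -> : \int[mu]_x (ind N x * (bump0 N x ^+ 6 * psi x ^+ 6)) =
    \int[mu]_x (bump N x ^+ 2 * psi x ^+ 2) ^+ 3.
  by apply: eq_rintegral => x; rewrite mulrA bumpX; ring.
rewrite -/G mulrCA !mulNr -mulrN -mulrDr nmulr_rle0// addrC subr_ge0.
exact: upper.
Qed.

End one_cutoff.

Lemma virial_inequality a : 0 < a ->
  a * (\int[mu]_x psi1 x ^+ 2 + B * \int[mu]_x psi x ^+ 6) <=
  - gamma * (\int[mu]_x psi1 x ^+ 2 + a ^+ 2 / 3 * \int[mu]_x psi x ^+ 6).
Proof.
move=> a0.
pose J N x := ind N x * (a * (bump0 N x ^+ 4 * psi1 x ^+ 2 +
  4 * (bump0 N x ^+ 3 * dbump0 N x * (psi x * psi1 x)) + B * (bump0 N x ^+ 4 * psi x ^+ 6)) +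
    gamma * ((bump0 N x * psi1 x + psi x * dbump0 N x) ^+ 2 +
     a ^+ 2 / 3 * (bump0 N x ^+ 6 * psi x ^+ 6))).
pose J0 x := a * (psi1 x ^+ 2 + B * psi x ^+ 6) + gamma * (psi1 x ^+ 2 + a ^+ 2 / 3 * psi x ^+ 6).
have hJ n : \int[mu]_x J n.+1%:R x <= 0 by exact: virial_cutoff.
have [hc _] := rintegral_cauchy (ltr01 : 0 < (1 : R)).
(* The [cauchy 1] term majorizes psi^2 (bump0')^2, which neither psi'^2 nor psi^6 controls. *)
have iD := rintegrableD (rintegrableD iK iS) (rintegrableZ (8 * C) hc).
pose A1 := a * (B + 5) + - gamma * (4 + a ^+ 2).
have [iJ0 lim] : rint J0 /\ (fun n => \int[mu]_x J n.+1%:R x) @ \oo --> \int[mu]_x J0 x.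
apply: (@rdominated _ RR R mu (fun n => J n.+1%:R) J0 _ _ _ _ (rintegrableZ A1 iD)).
- move=> n.
  have cb := @continuous_bump0 R n.+1%:R; have cd := @continuous_dbump0 R n.+1%:R.
  apply: rintegrable_measurable (rintegrable_ind _ _).
  have cw : continuous (fun x => (bump0 n.+1%:R x * psi1 x + psi x * dbump0 n.+1%:R x) ^+ 2).
    by apply: continuousXf; apply: continuousDf; exact: continuousMf.
  have c6 k : continuous (fun x => bump0 n.+1%:R x ^+ k * psi x ^+ 6).
    by apply: continuousMf; exact: continuousXf.
  by apply: continuousDf; (apply: continuousMf; first exact: continuous_cst);
    apply: continuousDf => //;
    [apply: continuousDf; [apply: continuousMf; exact: continuousXf|
      apply: continuousMf; [exact: continuous_cst|
       apply: continuousMf; [apply: continuousMf => //; exact: continuousXf|exact: continuousMf]]]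
    |apply: continuousMf => //; exact: continuous_cst
    |apply: continuousMf => //; exact: continuous_cst].
- move=> x; have hi := cvg_ind x cvg_natS; have hb0 := cvg_bump0 x cvg_natS.
  have hd := cvg_dbump0 x cvg_natS.
  have := @cvg_virial_integrand R a B gamma (psi x) (psi1 x) _ _ _ hi hb0 hd; exact.
- move=> n x; rewrite /J indE; have [xN|xN] := leP `|x| n.+1%:R; last first.
    rewrite mul0r normr0; apply: mulr_ge0.
      apply: addr_ge0; apply: mulr_ge0; [exact: ltW| |by rewrite oppr_ge0 ltW|].
        by apply: addr_ge0 => //; exact: ltW.
      by apply: addr_ge0 => //; exact: sqr_ge0.
    apply: addr_ge0; first by apply: addr_ge0; [exact: sqr_ge0|exact: exprn_even_ge0].
    by apply: mulr_ge0; [exact: mulr_ge0 (le_trans (sqr_ge0 (psi 0)) _)|exact: ltW (cauchy_gt0 _ ltr01)].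
  rewrite mul1r -[gamma]opprK.
  have N1 : 1 <= n.+1%:R :> R by rewrite ler1n.
  have b01 : 0 <= bump0 n.+1%:R x <= 1 by rewrite bump0_ge0 ?bump0_le1.
  apply: virial_integrand_bound => //; [exact: ltW|exact: ltW|by rewrite oppr_ge0 ltW|].
  apply: (@le_trans _ _ (C * (8 * cauchy 1 x))); last by rewrite mulrCA mulrA.
  apply: ler_pM; [exact: sqr_ge0|exact: sqr_ge0|exact: psiC|exact: dbump0_sqr_le].
have -> : \int[mu]_x psi1 x ^+ 2 + B * \int[mu]_x psi x ^+ 6 =
  \int[mu]_x (psi1 x ^+ 2 + B * psi x ^+ 6).
  by rewrite (rintegralD iK (rintegrableZ B iS)) (rintegralZ B iS).
have -> : \int[mu]_x psi1 x ^+ 2 + a ^+ 2 / 3 * \int[mu]_x psi x ^+ 6 =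
  \int[mu]_x (psi1 x ^+ 2 + a ^+ 2 / 3 * psi x ^+ 6).
  by rewrite (rintegralD iK (rintegrableZ _ iS)) (rintegralZ _ iS).
have i1 := rintegrableD iK (rintegrableZ B iS).
have i2 := rintegrableD iK (rintegrableZ (a ^+ 2 / 3) iS).
rewrite mulNr -subr_le0 opprK -(rintegralZ _ i1) -(rintegralZ _ i2).
rewrite -(rintegralD (rintegrableZ a i1) (rintegrableZ gamma i2)).
exact: (cvg_fun_lim_le lim).
Qed.

End virial.

(** * The Pohozaev inequality *)

Section commutator.
Context {R : realType}.
Local Notation mu := (@lebesgue_measure R).
Local Notation rint := (rintegrable mu).
Local Notation mu2 := (mu \x mu)%E.
Local Notation rint2 := (rintegrable mu2).
Local Notation RR := (measurableTypeR R).
Implicit Types (a h f : R -> R).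

Lemma young_abs (a k h d : R) : 0 < d ->
  `|a * k * h| <= `|a| * (d * h ^+ 2) + `|a| * ((4 * d)^-1 * k ^+ 2).
Proof.
move=> d0; rewrite -mulrDr -mulrA normrM ler_wpM2l// normrM.
rewrite -(real_normK (num_real h)) -(real_normK (num_real k)).
move: `|k| `|h| => s t.
have h1 : (4 * d)^-1 * (2 * d * t - s) ^+ 2 = d * t ^+ 2 + (4 * d)^-1 * s ^+ 2 - s * t.
  by field; exact: lt0r_neq0.
rewrite -subr_ge0 -h1 mulr_ge0// ?sqr_ge0// invr_ge0 mulr_ge0// ltW//.
Qed.

(** Cauchy-Schwarz in the form of Young's inequality with a free weight d, chosen by the caller in
    place of optimizing with square roots. The squared kernel is dominated by a convolution kernel
    of mass M pi / s. *)
Lemma rintegral2_kernel_bound a h (kap : R * R -> R) (M s d : R) : 0 < s -> 0 < d ->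
  rint a -> continuous h -> rint (fun y => h y ^+ 2) ->
  measurable_fun setT (kap : RR * RR -> R) ->
  (forall w, kap w ^+ 2 <= M * cauchy s (w.1 - w.2)) ->
  rint2 (fun w => a w.1 * kap w * h w.2) /\
  `|\int[mu2]_w (a w.1 * kap w * h w.2)| <=
  (\int[mu]_x `|a x|) * (d * (\int[mu]_x h x ^+ 2) + M * pi / (4 * d * s)).
Proof.
move=> s0 d0 ia ch ih mk hk.
have ja : rint (fun x => `|a x|) by exact: (integrable_abse ia).
have [hc hcE] := rintegral_cauchy s0.
have i1 := rintegrable_prod ja (rintegrableZ d ih).
have i2 := rintegrable_conv ja (rintegrableZ (M / (4 * d)) hc).
have i12 := rintegrableD i1 i2.
have le w : `|a w.1 * kap w * h w.2| <=
    `|a w.1| * (d * h w.2 ^+ 2) + `|a w.1| * (M / (4 * d) * cauchy s (w.1 - w.2)).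
  apply: le_trans (young_abs _ _ _ d0) _; rewrite lerD2l ler_wpM2l//.
  by rewrite [M / _]mulrC -mulrA ler_wpM2l// invr_ge0 mulr_ge0// ltW.
have i0 : rint2 (fun w => a w.1 * kap w * h w.2).
  apply: le_rintegrable i12; last exact: le.
  apply: measurable_funM; first apply: measurable_funM => //.
    exact: measurableT_comp (rintegrable_measurable ia) measurable_fst.
  exact: measurableT_comp (continuous_rmeasurable ch) measurable_snd.
split => //.
have E : \int[mu2]_w (`|a w.1| * (d * h w.2 ^+ 2) +
    `|a w.1| * (M / (4 * d) * cauchy s (w.1 - w.2))) =
  (\int[mu]_x `|a x|) * (d * (\int[mu]_x h x ^+ 2) + M * pi / (4 * d * s)).
  rewrite (rintegralD i1 i2) (rintegral_prod ja (rintegrableZ d ih)).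
  rewrite (rintegral_conv ja (rintegrableZ (M / (4 * d)) hc)).
  rewrite (rintegralZ d ih) (rintegralZ (M / (4 * d)) hc) hcE -mulrDr.
  by congr (_ * (_ + _)); field; rewrite !lt0r_neq0.
rewrite -E; exact: rintegral_norm_le i0 i12 le.
Qed.

Lemma conj_kerB n x y : 0 < n -> conj_ker n x - conj_ker n y =
  (x - y) * (n ^+ 2 * (cauchy n x * cauchy n y) - conj_ker n x * conj_ker n y) :> R.
Proof.
move=> n0; have h1 := cauchy_den_gt0 x n0; have h2 := cauchy_den_gt0 y n0.
by rewrite /conj_ker /cauchy; field; rewrite !lt0r_neq0.
Qed.

(** The factor x - y extracted by [conj_kerB] cancels the regularized singularity up to this
    explicit error. *)
Lemma conj_kerM e t : 0 < e -> t * conj_ker e t = 1 - e ^+ 2 * cauchy e t :> R.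
Proof.
move=> e0; have h := cauchy_den_gt0 t e0.
by rewrite /conj_ker /cauchy; field; rewrite lt0r_neq0.
Qed.

(** With t = x - y the difference of the cutoffs, squared, is at most min(1, 4 t^2 / N^2) and the
    squared kernel is at most 1 / t^2. The product is at most 1 / max(t^2, N^2 / 4), hence at most 2
    / (t^2 + N^2 / 4). *)
Lemma bump_kernel_sqr_le (N e x y : R) : 0 < N -> 0 < e ->
  ((bump N x - bump N y) * conj_ker e (x - y)) ^+ 2 <= 2 * cauchy (N / 2) (x - y).
Proof.
move=> N0 e0; set t := x - y; set D := bump N x - bump N y.
have [t0|t0] := eqVneq t 0.
  rewrite /conj_ker t0 mul0r mulr0 expr0n/= mulr_ge0// ltW// cauchy_gt0//; exact: divr_gt0.
have t2 : 0 < t ^+ 2 by rewrite exprn_even_gt0.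
have k2 : conj_ker e t ^+ 2 <= (t ^+ 2)^-1.
  apply: le_trans (conj_ker_sqr_le t e0) _.
  by rewrite /cauchy lef_pV2 ?posrE ?cauchy_den_gt0// lerDl sqr_ge0.
have D1 : D ^+ 2 <= 1.
  rewrite -real_normK ?num_real// expr_le1// ler_norml.
  have := bump_ge0 x N0; have := bump_ge0 y N0; have := bump_le1 N x; have := bump_le1 N y.
  rewrite /D; move: (bump N x) (bump N y) => a b *; apply/andP; split; lra.
have D2 : D ^+ 2 <= 4 / N ^+ 2 * t ^+ 2.
  rewrite -(real_normK (num_real D)) -(real_normK (num_real t)).
  have -> : 4 / N ^+ 2 * `|t| ^+ 2 = (2 / N * `|t|) ^+ 2 by field; exact: lt0r_neq0.
  rewrite ler_sqr ?nnegrE ?mulr_ge0// ?invr_ge0 ?(ltW N0)//; exact: bump_lipschitz.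
have N2 : 0 < N ^+ 2 by exact: exprn_gt0.
have c0 : 0 < t ^+ 2 + (N / 2) ^+ 2 by apply: cauchy_den_gt0; exact: divr_gt0.
rewrite exprMn; apply: le_trans (ler_wpM2l (sqr_ge0 D) k2) _.
have D2' : N ^+ 2 * D ^+ 2 <= 4 * t ^+ 2.
  by rewrite mulrC -ler_pdivlMr// mulrAC.
rewrite /cauchy ler_pdivlMr//.
have -> : D ^+ 2 * (t ^+ 2)^-1 * (t ^+ 2 + (N / 2) ^+ 2) =
  D ^+ 2 + (N ^+ 2 * D ^+ 2 / 4) / t ^+ 2 by field.
rewrite (_ : 2 = 1 + 1)//; apply: lerD => //.
by rewrite ler_pdivrMr// mul1r; lra.
Qed.

Lemma half_sum_le (T1 T2 X Q s1 s2 r1 r2 Y : R) :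
  T1 + T1 = X - Q - s1 + s2 -> - s1 <= r1 -> s2 <= 2 * r2 -> T2 <= Y -> 0 <= Q ->
  T1 + T2 <= X / 2 + Y + (r1 / 2 + r2).
Proof. by move=> *; lra. Qed.

Section cutoff_form.
Variables (N n : R) (f : R -> R).
Hypotheses (N0 : 0 < N) (n0 : 0 < n) (cf : continuous f) (f2 : rint (fun x => f x ^+ 2)).

Let A x := bump N x * (conj_ker n x * f x).
Let b x := bump N x * f x.
Let P x := bump N x * (cauchy n x * f x).

Let ib g : continuous g -> rint (fun x => bump N x * g x).
Proof.
by move=> cg; have := @rintegrable_bump_M R N 0 g cg; apply: eq_rintegrable => x; rewrite expr1.
Qed.

Let ib2 g : continuous g -> rint (fun x => (bump N x * g x) ^+ 2).
Proof.
move=> cg; have h := @rintegrable_bump_M R N 1 _ (continuousXf (n:=2) cg).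
apply: (eq_rintegrable _ h) => x.
exact: esym (exprMn _ _ _).
Qed.

Let cq : continuous (fun x => conj_ker n x * f x).
Proof. by apply: continuousMf => //; exact: continuous_conj_ker. Qed.
Let cp : continuous (fun x => cauchy n x * f x).
Proof. by apply: continuousMf => //; exact: continuous_cauchy. Qed.
Let cb g : continuous g -> continuous (fun x => bump N x * g x).
Proof. by move=> cg; apply: continuousMf => //; exact: continuous_bump. Qed.

Lemma rintegrable_conj_ker_mul : rint (fun x => conj_ker n x * f x).
Proof.
apply: rintegrableM_sqr => //; last exact: rintegrable_conj_ker_sqr.
  by apply: continuous_rmeasurable; exact: continuous_conj_ker.
exact: continuous_rmeasurable.
Qed.

(* Write bump x = bump y + (bump x - bump y) in one factor: the first part is
   symmetrized in (x, y), where conj_kerB makes the form a difference of two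
   squares, and the second part is O(N^(-1/2)) by Cauchy-Schwarz. *)
Lemma pohozaev_form_le : exists Z, forall s d, 0 < s -> 0 < d ->
  \int[mu]_x (bump N x ^+ 2 * (conj_ker n x * f x) * conj_poisson (s ^+ 2) f x) <=
  2^-1 * n ^+ 2 * (\int[mu]_x (bump N x * (cauchy n x * f x))) ^+ 2 +
  (\int[mu]_x `|conj_ker n x * f x|) * (d * (\int[mu]_x f x ^+ 2) + pi / (d * N)) + Z * s.
Proof.
(* With e = s^2 and Young weight s, both terms of [rintegral2_kernel_bound] for the kernel
   [e ^+ 2 * cauchy e] are of order s, and their sum is [2 * z h * s]. So [Z] depends on neither s
   nor d. *)
pose z h := 2^-1 * ((\int[mu]_x `|h x|) * ((\int[mu]_x h x ^+ 2) + pi / 4)).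
exists (n ^+ 2 * z P + z A) => s d s0 d0.
have e0 : 0 < s ^+ 2 by exact: exprn_gt0.
set e := s ^+ 2.
have iA : rint A := ib cq. have iA2 := ib2 cq. have cA : continuous A := cb cq.
have iP : rint P := ib cp. have iP2 := ib2 cp. have cP : continuous P := cb cp.
have ibb : rint b := ib cf. have ib22 := ib2 cf. have cbb : continuous b := cb cf.
have mk : measurable_fun setT (fun w : RR * RR => conj_ker e (w.1 - w.2)).
  by apply: measurable_sub2; exact: continuous_conj_ker.
have mc : measurable_fun setT (fun w : RR * RR => e ^+ 2 * cauchy e (w.1 - w.2)).
  by apply: measurable_funM => //; apply: measurable_sub2; exact: continuous_cauchy.
have hk (w : R * R) : conj_ker e (w.1 - w.2) ^+ 2 <= 1 * cauchy e (w.1 - w.2).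
  by rewrite mul1r; exact: conj_ker_sqr_le.
have hc (w : R * R) : (e ^+ 2 * cauchy e (w.1 - w.2)) ^+ 2 <= e ^+ 2 * cauchy e (w.1 - w.2).
  rewrite expr2 ler_piMl//; first by rewrite mulr_ge0 ?sqr_ge0// ltW// cauchy_gt0.
  by rewrite mulrC -ler_pdivlMr ?exprn_gt0// mul1r cauchy_le.
have [i1 _] := rintegral2_kernel_bound e0 (ltr01 : 0 < (1:R)) iA cbb ib22 mk hk.
have [i2 _] := rintegral2_kernel_bound e0 (ltr01 : 0 < (1:R)) ibb cA iA2 mk hk.
have [iE1 E1] := rintegral2_kernel_bound e0 s0 iP cP iP2 mc hc.
have [iE2 E2] := rintegral2_kernel_bound e0 s0 iA cA iA2 mc hc.
have mb : measurable_fun setT (fun w : RR * RR => bump N w.1 - bump N w.2).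
  have cN := continuous_rmeasurable (continuous_bump N0).
  by apply: measurable_funB; [exact: measurableT_comp cN measurable_fst|exact: measurableT_comp cN measurable_snd].
have hb w : ((bump N w.1 - bump N w.2) * conj_ker e (w.1 - w.2)) ^+ 2 <=
    2 * cauchy (N / 2) (w.1 - w.2) by exact: bump_kernel_sqr_le.
have Nh : 0 < N / 2 by exact: divr_gt0.
have [i3 E3] := rintegral2_kernel_bound Nh d0 iA cf f2 (measurable_funM mb mk) hb.
pose T1 := \int[mu2]_w (A w.1 * conj_ker e (w.1 - w.2) * b w.2).
pose T2 := \int[mu2]_w (A w.1 * ((bump N w.1 - bump N w.2) * conj_ker e (w.1 - w.2)) * f w.2).
pose S1 := \int[mu2]_w (P w.1 * (e ^+ 2 * cauchy e (w.1 - w.2)) * P w.2).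
pose S2 := \int[mu2]_w (A w.1 * (e ^+ 2 * cauchy e (w.1 - w.2)) * A w.2).
have h12 : T1 + T1 = n ^+ 2 * (\int[mu]_x P x) ^+ 2 - (\int[mu]_x A x) ^+ 2 - n ^+ 2 * S1 + S2.
  rewrite {2}/T1 -(rintegral_swap i1) /=.
  rewrite (expr2 (\int[mu]_x P x)) (expr2 (\int[mu]_x A x)) -(rintegral_prod iP iP) -(rintegral_prod iA iA).
  have jP := rintegrable_prod iP iP; have jA := rintegrable_prod iA iA.
  have js := rintegrable_swap i1.
  rewrite -(rintegralD i1 js) -(rintegralZ (n ^+ 2) jP) -(rintegralZ (n ^+ 2) iE1).
  have jZ := rintegrableZ (n ^+ 2) jP; have jE := rintegrableZ (n ^+ 2) iE1.
  rewrite -(rintegralB jZ jA) -(rintegralB (rintegrableB jZ jA) jE).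
  rewrite -(rintegralD (rintegrableB (rintegrableB jZ jA) jE) iE2).
  apply: eq_rintegral => -[x y] /=.
  have k1 := conj_kerB x y n0; have k2 := conj_kerM (x - y) e0.
  rewrite -/e in k2.
  have -> : conj_ker e (y - x) = - conj_ker e (x - y) by rewrite -conj_ker_opp opprB.
  transitivity (bump N x * f x * (bump N y * f y) * (conj_ker n x - conj_ker n y) * conj_ker e (x - y)).
    by rewrite /A /b; ring.
  rewrite k1; transitivity (bump N x * f x * (bump N y * f y) *
    (n ^+ 2 * (cauchy n x * cauchy n y) - conj_ker n x * conj_ker n y) * ((x - y) * conj_ker e (x - y))).
    by ring.
  by rewrite k2 /A /P; ring.
have hI : \int[mu]_x (bump N x ^+ 2 * (conj_ker n x * f x) * conj_poisson e f x) = T1 + T2.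
  have i13 := rintegrableD i1 i3.
  rewrite /T1 /T2 -(rintegralD i1 i3) -(rfubini1 i13).2.
  apply: eq_rintegral => x /=.
  transitivity (\int[mu]_y (bump N x ^+ 2 * (conj_ker n x * f x) * (conj_ker e (x - y) * f y))).
    by rewrite rintegralZ//; exact: rintegrable_conj_ker_M.
  by apply: eq_rintegral => y; rewrite /A /b; ring.
rewrite hI; clear hI.
have zE h : (\int[mu]_x `|h x|) * (s * (\int[mu]_x h x ^+ 2) + e ^+ 2 * pi / (4 * s * e)) =
    2 * z h * s.
  by rewrite /z /e; field; exact: lt0r_neq0.
move: E1 E2; rewrite !zE -/S1 -/S2 !ler_norml => /andP[E1 _] /andP[_ E2].
have E1' : n ^+ 2 * - S1 <= n ^+ 2 * (2 * z P * s) by rewrite ler_wpM2l ?sqr_ge0// lerNl.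
have E3' : T2 <= (\int[mu]_x `|conj_ker n x * f x|) * (d * (\int[mu]_x f x ^+ 2) + pi / (d * N)).
  apply: le_trans (ler_norm _) _; apply: le_trans E3 _.
  have -> : 2 * pi / (4 * d * (N / 2)) = pi / (d * N) :> R by field; rewrite !lt0r_neq0.
  apply: ler_wpM2r.
    apply: addr_ge0; last by rewrite divr_ge0 ?pi_ge0// mulr_ge0// ltW.
    by rewrite mulr_ge0 ?(ltW d0)//; apply: Rintegral_ge0 => x _; exact: sqr_ge0.
  apply: le_rintegral; [exact: (integrable_abse iA)|exact: (integrable_abse rintegrable_conj_ker_mul)|].
  move=> x /=; rewrite normrM ger0_norm ?bump_ge0//.
  by rewrite ler_piMl ?bump_le1.
(* The square of the integral of [A] enters with a negative sign and is dropped; this is where the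
   identity becomes an inequality. *)
have Q0 := sqr_ge0 (\int[mu]_x A x).
rewrite /P in h12 *.
set X := (\int[mu]_x (bump N x * (cauchy n x * f x))) ^+ 2 in h12 *.
move: h12 E1' E2 E3' Q0.
set X1 := (_ * (_ + _)); set Q := _ ^+ 2.
set nX := n ^+ 2 * X; have -> : 2^-1 * n ^+ 2 * X = nX / 2 by rewrite /nX; field.
move: nX => nX.
have -> : (n ^+ 2 * z P + z A) * s = n ^+ 2 * (2 * z P * s) / 2 + z A * s by field.
rewrite mulrN -!(mulrA 2 (z A)); exact: half_sum_le.
Qed.

End cutoff_form.

End commutator.

(** * Passage to the limit in the Pohozaev computation *)

Section pohozaev.
Context {R : realType}.
Local Notation mu := (@lebesgue_measure R).
Local Notation rint := (rintegrable mu).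
Local Notation RR := (measurableTypeR R).

Lemma cvg_seq_le (v w : nat -> R) (l m : R) : v @ \oo --> l -> w @ \oo --> m ->
  (forall k, v k <= w k) -> l <= m.
Proof.
move=> hv hw le; rewrite -subr_le0.
have h : (fun k => v k + - w k) @ \oo --> l + - m by apply: cvg_seqD => //; exact: cvgN.
by apply: (cvg_fun_lim_le h) => k; rewrite subr_le0.
Qed.

Lemma cvg_seq_cstM (c l : R) (v : nat -> R) : v @ \oo --> l -> (fun n => c * v n) @ \oo --> c * l.
Proof. by move=> h; apply: cvg_seqM => //; exact: cvg_cst. Qed.

Lemma cvg_seqV (l : R) (v : nat -> R) : l != 0 -> v @ \oo --> l -> (fun n => (v n)^-1) @ \oo --> l^-1.
Proof. by move=> l0 h; exact: cvgV. Qed.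

Arguments cvg_seq_cstM c {l v} _.

Variables (gamma B C : R) (psi psi1 psi2 u : R -> R).
Hypotheses (gamma0 : gamma < 0)
  (dpsi : forall x : R, is_derive x 1 psi (psi1 x))
  (dpsi1 : forall x : R, is_derive x 1 psi1 (psi2 x)) (cpsi2 : continuous psi2)
  (psiC : forall x, psi x ^+ 2 <= C)
  (iK : rint (fun x => psi1 x ^+ 2)) (iS : rint (fun x => psi x ^+ 6))
  (equ : forall x, psi2 x = B * psi x ^+ 5 + gamma * psi x * u x).

Let f x := 2 * psi x * psi1 x.

Hypotheses
  (hu : forall (x : R) (e_ : nat -> R), (forall n, 0 < e_ n) -> e_ @ \oo --> (0 : R) ->
    (fun n => conj_poisson (e_ n) f x) @ \oo --> pi * u x)
  (hb : forall N : R, exists Cv : R, forall x e : R, `|x| <= N -> 0 < e ->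
    `|conj_poisson e f x| <= Cv).

Let cpsi : continuous psi. Proof. exact: derive_continuousf dpsi. Qed.
Let cpsi1 : continuous psi1. Proof. exact: derive_continuousf dpsi1. Qed.
Let cf : continuous f.
Proof. by apply: continuousMf => //; apply: continuousMf => //; exact: continuous_cst. Qed.
Let f2 : rint (fun x => f x ^+ 2).
Proof. exact: rintegrable_density_derivative_sqr dpsi dpsi1 psiC iK. Qed.

(** By the equation the derivative [E1] of this energy density equals gamma * f * u. Pairing it with
    a multiplier close to x after scaling and integrating by parts will bound the integral of
    [E0]. *)
Let E0 x := psi1 x ^+ 2 - B / 3 * psi x ^+ 6.
Let E1 x := 2 * psi1 x * (psi2 x - B * psi x ^+ 5).

Let cE0 : continuous E0.
Proof.
apply: continuousBf; first exact: continuousXf.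
by apply: continuousMf; [exact: continuous_cst|exact: continuousXf].
Qed.
Let cE1 : continuous E1.
Proof.
apply: continuousMf; first by apply: continuousMf => //; exact: continuous_cst.
apply: continuousBf => //.
by apply: continuousMf; [exact: continuous_cst|exact: continuousXf].
Qed.
Let iE0 : rint E0. Proof. exact: rintegrableB iK (rintegrableZ (B / 3) iS). Qed.

Let dE0 (x : R) : is_derive x 1 E0 (E1 x).
Proof.
have D := deriveBf (deriveXf 2 (dpsi1 x)) (deriveMf (derive_cstf (B / 3) x) (deriveXf 6 (dpsi x))).
by apply: (derive_eqf D); rewrite /E1 /=; field.
Qed.

Lemma rintegrable_cauchy_mul n : 0 < n -> rint (fun x => cauchy n x * f x).
Proof.
move=> n0; apply: rintegrableM_sqr; last exact: f2.
- by apply: continuous_rmeasurable; exact: continuous_cauchy.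
- exact: continuous_rmeasurable.
- apply: (@le_rintegrable _ RR R mu _ (fun x => n ^- 2 * cauchy n x)).
  + by apply: continuous_rmeasurable; apply: continuousXf; exact: continuous_cauchy.
  + move=> x; rewrite ger0_norm ?sqr_ge0// expr2 ler_wpM2r//; first exact: ltW (cauchy_gt0 _ n0).
    exact: cauchy_le.
  + by apply: rintegrableZ; exact: (rintegral_cauchy n0).1.
Qed.

Section fixed_scale.
Variable n : R.
Hypothesis n0 : 0 < n.

(** The derivative of the multiplier bump0^2 * conj_ker n. *)
Let dphi N x := 2 * bump0 N x * dbump0 N x * conj_ker n x + bump0 N x ^+ 2 * dconj_ker n x.

Let Af := \int[mu]_x `|conj_ker n x * f x|.
Let F2 := \int[mu]_x f x ^+ 2.

Let cutoff N d : 0 < N -> 0 < d ->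
  \int[mu]_x (ind N x * (E0 x * dphi N x)) <=
  - gamma / pi * (2^-1 * n ^+ 2 * (\int[mu]_x (bump N x * (cauchy n x * f x))) ^+ 2 +
  Af * (d * F2 + pi / (d * N))).
Proof.
move=> N0 d0.
have cb := @continuous_bump0 R N; have cd := @continuous_dbump0 R N.
have ck := continuous_conj_ker n0; have cdk := continuous_dconj_ker n0.
have cdphi : continuous (dphi N).
  apply: continuousDf; last by apply: continuousMf => //; exact: continuousXf.
  apply: continuousMf => //; apply: continuousMf => //; apply: continuousMf => //.
  exact: continuous_cst.
have cphi : continuous (fun x => bump0 N x ^+ 2 * conj_ker n x).
  by apply: continuousMf => //; exact: continuousXf.
have D (x : R) : is_derive x 1 (fun x => E0 x * (bump0 N x ^+ 2 * conj_ker n x))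
   (E0 x * dphi N x + E1 x * (bump0 N x ^+ 2 * conj_ker n x)).
  have D1 := deriveMf (dE0 x) (deriveMf (deriveXf 2 (is_derive_bump0 x N0)) (is_derive_conj_ker x n0)).
  by apply: (derive_eqf D1); rewrite /dphi /=; ring.
have c1 : continuous (fun x => E0 x * dphi N x) by exact: continuousMf.
have c2 : continuous (fun x => E1 x * (bump0 N x ^+ 2 * conj_ker n x)) by exact: continuousMf.
have := rintegral_ind_FTC N0 D (continuousDf c1 c2).
have [-> ->] := bump0_end N0; rewrite expr0n/= !mul0r !mulr0 subrr => h0.
have i1 := rintegrable_ind N c1; have i2 := rintegrable_ind N c2.
pose h x := conj_ker n x * f x.
have ch : continuous h by exact: continuousMf.
pose X := \int[mu]_x (bump N x ^+ 2 * h x * (pi * u x)).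
have p0 : 0 < pi :> R := pi_gt0 R.
have g0 : gamma != 0 by rewrite lt_eqF.
have iX : rint (fun x => bump N x ^+ 2 * h x * (pi * u x)).
  apply: eq_rintegrable (rintegrableZ (pi / gamma) i2) => x.
  rewrite -bumpX /h /f /E1 equ; field; exact: g0.
have -> : \int[mu]_x (ind N x * (E0 x * dphi N x)) = - gamma / pi * X.
  rewrite /X -(rintegralZ (- gamma / pi) iX).
  apply/eqP; rewrite -subr_eq0 -(rintegralB i1 (rintegrableZ (- gamma / pi) iX)) -[X in _ == X]h0.
  apply/eqP/eq_rintegral => x.
  rewrite -bumpX /h /f /E1 equ; move: (pi : R) (lt0r_neq0 p0) => P P0.
  by field.
apply: ler_wpM2l; first by rewrite divr_ge0 ?oppr_ge0// ltW.
have [Z hZ] := pohozaev_form_le N0 n0 cf f2.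
have hp k : 0 < @harmonic R k by rewrite /harmonic/= invr_gt0.
have hl : (fun k => @harmonic R k ^+ 2) @ \oo --> (0 : R).
  have := cvg_seqM (@cvg_harmonic R) (@cvg_harmonic R); rewrite mulr0.
  by under eq_fun do rewrite -expr2.
have lim := cvg_bump_conj_poisson dpsi dpsi1 psiC iK hu hb (n := 1) N0 ch
  (fun k => exprn_gt0 2 (hp k)) hl.
have lim2 := cvg_seqD lim (cvg_seq_cstM (- Z) (@cvg_harmonic R)).
rewrite mulr0 addr0 in lim2.
apply: (cvg_fun_lim_le lim2) => k.
by rewrite mulNr lerBlDr; exact: hZ.
Qed.

Lemma pohozaev_scale : \int[mu]_x (E0 x * dconj_ker n x) <=
  - gamma / pi * (2^-1 * n ^+ 2 * (\int[mu]_x (cauchy n x * f x)) ^+ 2).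
Proof.
(* With N = (k+1)^2 and d = 1/(k+1), both d and 1/(d N) equal 1/(k+1), so the whole commutator error
   vanishes. *)
pose N_ k : R := k.+1%:R ^+ 2.
have N1 k : 1 <= N_ k by rewrite exprn_ege1// ler1n.
have N0 k : 0 < N_ k by exact: lt_le_trans (N1 k).
have NN : N_ @ \oo --> +oo.
  apply/cvgryPge => M; near=> k.
  have : M <= k.+1%:R by near: k; move/cvgryPge : (@cvg_natS R); exact.
  by move=> /le_trans; apply; rewrite /N_ expr2 ler_peMl// ler1n.
have cb k := @continuous_bump0 R (N_ k); have cd k := @continuous_dbump0 R (N_ k).
have ck := continuous_conj_ker n0; have cdk := continuous_dconj_ker n0.
have hi x := cvg_ind x NN; have hb0 x := cvg_bump0 x NN; have hd x := cvg_dbump0 x NN.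
have cC (c : R) : (fun _ : nat => c) @ \oo --> c by exact: cvg_cst.
have L1 : (fun k => \int[mu]_x (ind (N_ k) x * (E0 x * dphi (N_ k) x))) @ \oo -->
    \int[mu]_x (E0 x * dconj_ker n x).
  (* The first term bounds 2 bump0 bump0' conj_ker, through |bump0'| <= 2 and |conj_ker| <= 1/(2n);
     the second one bounds [dconj_ker]. *)
  pose M := 2 / n + n ^- 2.
  apply: (@rdominated _ RR R mu (fun k x => ind (N_ k) x * (E0 x * dphi (N_ k) x))
    (fun x => E0 x * dconj_ker n x) (fun x => M * `|E0 x|) _ _ _ _).2.
  - move=> k; apply: rintegrable_measurable (rintegrable_ind _ _).
    apply: continuousMf => //.
    apply: continuousDf; last by apply: continuousMf => //; exact: continuousXf.
    apply: continuousMf => //; apply: continuousMf => //; apply: continuousMf => //.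
    exact: continuous_cst.
  - move=> x.
    have h1 := cvg_seqM (cvg_seqM (cvg_seq_cstM 2 (hb0 x)) (hd x)) (cC (conj_ker n x)).
    have h2 := cvg_seqM (cvg_seqM (hb0 x) (hb0 x)) (cC (dconj_ker n x)).
    have := cvg_seqM (hi x) (cvg_seq_cstM (E0 x) (cvg_seqD h1 h2)).
    by rewrite mulr0 mul0r add0r !mul1r; under eq_fun do rewrite -expr2.
  - move=> k x; rewrite indE; case: ifPn => [xN|_]; last first.
      by rewrite mul0r normr0 mulr_ge0// addr_ge0 ?divr_ge0 ?invr_ge0 ?sqr_ge0// ltW.
    rewrite mul1r normrM mulrC ler_wpM2r//.
    have b0 := bump0_ge0 (N0 k) xN; have b1 := bump0_le1 (N_ k) x.
    apply: le_trans (ler_normD _ _) _; apply: lerD.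
      have dl : `|dbump0 (N_ k) x| <= 2.
        rewrite /dbump0 normrN !normrM ger0_norm// normfV (ger0_norm (sqr_ge0 _)).
        rewrite -mulrA ler_piMr// ler_pdivrMr ?exprn_gt0// mul1r.
        by apply: le_trans xN _; rewrite expr2 ler_peMl// ltW.
      have kl := conj_ker_bound x n0.
      rewrite 3!normrM (ger0_norm b0) (ger0_norm (ler0n R 2)).
      have -> : 2 / n = 2 * 1 * 2 * (2 * n)^-1 by field; exact: lt0r_neq0.
      have b2 : 0 <= 2 * bump0 (N_ k) x by exact: mulr_ge0.
      apply: ler_pM; [exact: mulr_ge0|by []| |exact: kl].
      by apply: ler_pM; [exact: b2|by []|rewrite ler_wpM2l|exact: dl].
    rewrite normrM ger0_norm ?sqr_ge0// -[leRHS]mul1r ler_pM ?sqr_ge0// ?exprn_ile1//.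
    exact: le_trans (dconj_ker_bound x n0) (cauchy_le x n0).
  - by apply: rintegrableZ; exact: (integrable_abse iE0).
have icf := rintegrable_cauchy_mul n0.
have L2 : (fun k => \int[mu]_x (bump (N_ k) x * (cauchy n x * f x))) @ \oo -->
    \int[mu]_x (cauchy n x * f x).
  apply: (@rdominated _ RR R mu (fun k x => bump (N_ k) x * (cauchy n x * f x))
    (fun x => cauchy n x * f x) (fun x => `|cauchy n x * f x|) _ _ _ _).2.
  - move=> k; apply: measurable_funM; last exact: rintegrable_measurable icf.
    by apply: continuous_rmeasurable; exact: continuous_bump.
  - move=> x; have := cvg_seqM (cvg_seqM (hi x) (hb0 x)) (cC (cauchy n x * f x)).
    by rewrite !mul1r.
  - move=> k x; rewrite normrM -[leRHS]mul1r ler_wpM2r// ger0_norm ?bump_le1 ?bump_ge0//.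
  - exact: (integrable_abse icf).
have hp k : 0 < @harmonic R k by rewrite /harmonic/= invr_gt0.
have L3 := cvg_seq_cstM (- gamma / pi) (cvg_seqD (cvg_seq_cstM (2^-1 * n ^+ 2) (cvg_seqM L2 L2))
  (cvg_seq_cstM (Af * (F2 + pi)) (@cvg_harmonic R))).
rewrite mulr0 addr0 -expr2 in L3.
apply: (cvg_seq_le L1 L3) => k.
have := cutoff (N0 k) (hp k); rewrite -expr2.
have -> : pi / (harmonic k * N_ k) = pi * harmonic k :> R.
  rewrite /N_ /=; have : k.+1%:R != 0 :> R by rewrite pnatr_eq0.
  by move: k.+1%:R => y y0; field.
suff -> : Af * (harmonic k * F2 + pi * harmonic k) = Af * (F2 + pi) * harmonic k by [].
by ring.
Unshelve. all: by end_near. Qed.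

End fixed_scale.

(** After integration by parts the derivative of [cauchy n] is at most [n^-1 * cauchy n]. As rho =
    psi^2 need not be integrable, it is split at height d: rho <= d + rho^3 / d^2, and rho^3 is
    integrable. *)
Lemma pohozaev_mean_le (n d : R) : 0 < n -> 0 < d ->
  n ^+ 2 * `|\int[mu]_x (cauchy n x * f x)| <= pi * d + (\int[mu]_x psi x ^+ 6) / (n * d ^+ 2).
Proof.
move=> n0 d0.
pose dc x : R := - (2 * x * cauchy n x ^+ 2).
have cc := continuous_cauchy n0.
have cdc : continuous dc.
  apply: continuousNf; apply: continuousMf; last exact: continuousXf.
  by apply: continuousMf; [exact: continuous_cst|exact: continuous_idf].
have dcauchy (x : R) : is_derive x 1 (cauchy n) (dc x).
  have h0 := cauchy_den_gt0 x n0.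
  have D := deriveVf (deriveDf (deriveXf 2 (derive_idf x)) (derive_cstf (n ^+ 2) x)) (lt0r_neq0 h0).
  by apply: (derive_eqf D); rewrite /dc /cauchy /=; field; exact: lt0r_neq0.
have drho (x : R) : is_derive x 1 (fun x => psi x ^+ 2) (f x).
  exact: (derive_eqf (deriveXf 2 (dpsi x))).
have crho : continuous (fun x => psi x ^+ 2) by exact: continuousXf.
have [hc hcE] := rintegral_cauchy n0.
have dcb x : `|dc x| <= n^-1 * cauchy n x.
  rewrite /dc normrN normrM (ger0_norm (sqr_ge0 _)) expr2 mulrA ler_wpM2r//.
    exact: ltW (cauchy_gt0 _ n0).
  rewrite /cauchy ler_pdivrMr ?cauchy_den_gt0// ler_pdivlMl// normrM ger0_norm//.
  have := sqr_ge0 (`|x| - n); rewrite -(real_normK (num_real x)).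
  by move: `|x| => y; lra.
have idr : rint (fun x => dc x * psi x ^+ 2).
  apply: (@le_rintegrable _ RR R mu _ (fun x => n^-1 * C * cauchy n x)).
  - by apply: continuous_rmeasurable; exact: continuousMf.
  - move=> x; rewrite normrM (ger0_norm (sqr_ge0 _)) mulrAC.
    by apply: ler_pM => //; exact: sqr_ge0.
  - exact: rintegrableZ.
have icf := rintegrable_cauchy_mul n0.
have h : \int[mu]_x (dc x * psi x ^+ 2 + cauchy n x * f x) = 0.
  apply: (@rintegral_FTC_line0 R (fun x => cauchy n x * psi x ^+ 2)).
  - by move=> x; apply: (derive_eqf (deriveMf (dcauchy x) (drho x))); ring.
  - by apply: continuousDf; exact: continuousMf.
  - exact: rintegrableD.
  - have := cvg_seq_cstM (2 * C) (@cvg_harmonic R); rewrite mulr0 => h.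
    have z0 : (fun _ : nat => 0) @ \oo --> (0 : R) by exact: cvg_cst.
    apply/norm_cvg0P; apply: (squeeze_cvgr _ z0 h); near=> k.
    rewrite normr_ge0/=; apply: le_trans (ler_normB _ _) _.
    have nn y : `|cauchy n y * psi y ^+ 2| = cauchy n y * psi y ^+ 2.
      by apply: ger0_norm; apply: mulr_ge0; [exact: ltW (cauchy_gt0 _ n0)|exact: sqr_ge0].
    rewrite !nn cauchy_opp.
    have k0 : 0 < k.+1%:R :> R by [].
    have le1 : cauchy n k.+1%:R <= k.+1%:R^-1.
      rewrite /cauchy lef_pV2 ?posrE ?cauchy_den_gt0//.
      by rewrite (@le_trans _ _ (k.+1%:R ^+ 2))// ?lerDl ?sqr_ge0// expr2 ler_peMl// ler1n.
    have pt (y : R) : cauchy n k.+1%:R * psi y ^+ 2 <= k.+1%:R^-1 * C.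
      by apply: ler_pM => //; [exact: ltW (cauchy_gt0 _ n0)|exact: sqr_ge0].
    rewrite -mulrA (mulrC C); apply: le_trans (lerD (pt _) (pt _)) _.
    by rewrite /= mulr_natl mulr2n.
rewrite (rintegralD idr icf) addrC in h; move/eqP: h; rewrite addr_eq0 => /eqP ->.
rewrite normrN.
have iM : rint (fun x => n^-1 * d * cauchy n x + (n^-1 * n ^- 2 * d ^- 2) * psi x ^+ 6).
  exact: rintegrableD (rintegrableZ _ hc) (rintegrableZ _ iS).
have := rintegral_norm_le idr iM.
rewrite (rintegralD (rintegrableZ _ hc) (rintegrableZ _ iS)) (rintegralZ _ hc) (rintegralZ _ iS) hcE.
move=> hh; apply: le_trans (ler_wpM2l (sqr_ge0 n) (hh _)) _; last first.
  by rewrite le_eqVlt; apply/orP; left; apply/eqP; field; rewrite !lt0r_neq0.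
move=> x; rewrite normrM (ger0_norm (sqr_ge0 _)).
apply: le_trans (ler_wpM2r (sqr_ge0 _) (dcb x)) _.
have cb0 : 0 <= cauchy n x by exact: ltW (cauchy_gt0 _ n0).
have i0 : 0 <= n^-1 by rewrite invr_ge0 ltW.
have key : psi x ^+ 2 <= d + d ^- 2 * psi x ^+ 6.
  have p6 : 0 <= psi x ^+ 6 by exact: exprn_even_ge0.
  have [le|/ltW gt] := leP (psi x ^+ 2) d.
    by apply: le_trans le _; rewrite lerDl mulr_ge0// invr_ge0 sqr_ge0.
  apply: (@le_trans _ _ (d ^- 2 * psi x ^+ 6)); last by rewrite lerDr ltW.
  rewrite mulrC ler_pdivlMr ?exprn_gt0//.
  have -> : psi x ^+ 6 = psi x ^+ 2 * (psi x ^+ 2) ^+ 2 by ring.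
  by rewrite ler_wpM2l ?sqr_ge0// ler_sqr ?nnegrE ?sqr_ge0// ltW.
apply: le_trans (ler_wpM2l (mulr_ge0 i0 cb0) key) _.
rewrite mulrDr -[leRHS]addrC -[leRHS]addrC; apply: lerD; first by rewrite mulrAC.
rewrite -!mulrA; apply: ler_wpM2l => //; apply: ler_wpM2r; last exact: cauchy_le.
by apply: mulr_ge0; [rewrite invr_ge0 sqr_ge0|exact: exprn_even_ge0].
Unshelve. all: by end_near. Qed.

Lemma pohozaev_inequality :
  \int[mu]_x psi1 x ^+ 2 <= B / 3 * \int[mu]_x psi x ^+ 6.
Proof.
rewrite -subr_le0 -(rintegralZ (B / 3) iS) -(rintegralB iK (rintegrableZ (B / 3) iS)).
(* With n = (k+1)^3 and d = 1/(k+1) one has n d^2 = k+1, so the bound of [pohozaev_mean_le] becomes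
   (pi + S)/(k+1). *)
pose n_ k : R := k.+1%:R ^+ 3.
have n0 k : 0 < n_ k by exact: exprn_gt0.
have nn : n_ @ \oo --> +oo.
  apply/cvgryPge => M; near=> k.
  have : M <= k.+1%:R by near: k; move/cvgryPge : (@cvg_natS R); exact.
  move=> /le_trans; apply; rewrite /n_ exprS ler_peMr// exprn_ege1// ler1n.
  done.
have cC (c : R) : (fun _ : nat => c) @ \oo --> c by exact: cvg_cst.
(* The scaled multiplier n^2 conj_ker n x tends to x; its derivative tends to 1 and is at most 1 in
   absolute value. *)
have L1 : (fun k => \int[mu]_x (n_ k ^+ 2 * (E0 x * dconj_ker (n_ k) x))) @ \oo -->
    \int[mu]_x E0 x.
  apply: (@rdominated _ RR R mu (fun k x => n_ k ^+ 2 * (E0 x * dconj_ker (n_ k) x))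
    E0 (fun x => `|E0 x|) _ _ _ _).2.
  - move=> k; apply: continuous_rmeasurable; apply: continuousMf; first exact: continuous_cst.
    by apply: continuousMf => //; exact: continuous_dconj_ker.
  - move=> x.
    have v0 := cvg_seq_cstM x (cvg_inv_infty nn); rewrite mulr0 in v0.
    have v1 := cvg_seqD (cvg_seqM v0 v0) (cC 1); rewrite mulr0 add0r in v1.
    have v2 := cvg_seqV (oner_neq0 R) v1; rewrite invr1 in v2.
    have v3 := cvg_seqD (cC 1) (cvg_seq_cstM (-1) (cvg_seqM v0 v0)); rewrite !mulr0 addr0 in v3.
    have := cvg_seq_cstM (E0 x) (cvg_seqM v3 (cvg_seqM v2 v2)); rewrite !mulr1.
    apply: cvg_trans; apply: near_eq_cvg; near=> k => /=.
    have c0 := cauchy_den_gt0 x (n0 k); have m0 := n0 k.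
    rewrite /dconj_ker /cauchy; move: (n_ k) c0 m0 => m c0 m0.
    have -> : x / m * (x / m) + 1 = (x ^+ 2 + m ^+ 2) / m ^+ 2 by field; exact: lt0r_neq0.
    by field; rewrite (lt0r_neq0 m0) (lt0r_neq0 c0).
  - move=> k x; rewrite mulrCA normrM -[leRHS]mulr1 ler_wpM2l//.
    rewrite normrM ger0_norm ?sqr_ge0//.
    have := le_trans (dconj_ker_bound x (n0 k)) (cauchy_le x (n0 k)).
    by move=> /(ler_wpM2l (sqr_ge0 (n_ k))); rewrite divff// expf_neq0// lt0r_neq0.
  - exact: (integrable_abse iE0).
pose S := \int[mu]_x psi x ^+ 6.
pose c := - gamma / pi * 2^-1.
have c0 : 0 <= c by rewrite mulr_ge0// divr_ge0 ?pi_ge0// oppr_ge0 ltW.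
have L2 := cvg_seq_cstM (c * (pi + S) ^+ 2) (cvg_seqM (@cvg_harmonic R) (@cvg_harmonic R)).
rewrite !mulr0 in L2.
apply: (cvg_seq_le L1 L2) => k.
have m0 := n0 k.
have hk : 0 < @harmonic R k by rewrite /harmonic/= invr_gt0.
have h1 := pohozaev_scale (n0 k).
have h2 := pohozaev_mean_le (n0 k) hk.
have iEd : rint (fun x => E0 x * dconj_ker (n_ k) x).
  have cd := continuous_dconj_ker m0.
  apply: le_rintegrable (rintegrableZ (n_ k ^- 2) (integrable_abse iE0)).
    by apply: continuous_rmeasurable; exact: continuousMf.
  move=> x; rewrite normrM mulrC ler_wpM2r//.
  exact: le_trans (dconj_ker_bound x m0) (cauchy_le x m0).
rewrite (rintegralZ (n_ k ^+ 2) iEd).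
have h3 := ler_wpM2l (sqr_ge0 (n_ k)) h1; apply: le_trans h3 _.
set Y := \int[mu]_x (cauchy (n_ k) x * f x) in h2 *.
have -> : n_ k ^+ 2 * (- gamma / pi * (2^-1 * n_ k ^+ 2 * Y ^+ 2)) = c * (n_ k ^+ 2 * `|Y|) ^+ 2.
  by rewrite -(real_normK (num_real Y)) /c; ring.
rewrite -(mulrA c); apply: ler_wpM2l => //.
rewrite -(expr2 (harmonic k)) -(exprMn 2 (pi + S)).
rewrite ler_sqr ?nnegrE; last 2 first.
- by rewrite mulr_ge0// sqr_ge0.
- rewrite mulr_ge0//; last exact: ltW.
  rewrite addr_ge0 ?pi_ge0//; apply: Rintegral_ge0 => x _; exact: exprn_even_ge0.
apply: le_trans h2 _; rewrite -/S /n_ /=.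
have -> : k.+1%:R ^+ 3 * k.+1%:R^-1 ^+ 2 = k.+1%:R :> R.
  have : k.+1%:R != 0 :> R by rewrite pnatr_eq0.
  by move: k.+1%:R => y y0; field.
by rewrite (mulrDl pi S) lexx.
Unshelve. all: by end_near. Qed.

End pohozaev.

(** * Smooth test functions *)

Section smooth.
Context {R : realType}.
Implicit Types (F G : R -> R).

(** For m = 0 this is the classical smooth function that vanishes to infinite order at 0; the powers
    of 1/s make the span of the family stable under differentiation. *)
Definition flat (m : nat) (s : R) : R := if 0 < s then s^-1 ^+ m * expR (- s^-1) else 0.

Lemma flat_ge0 m s : 0 <= flat m s.
Proof.
rewrite /flat; case: ifPn => // s0.
by rewrite mulr_ge0 ?expR_ge0// exprn_ge0// invr_ge0 ltW.
Qed.

Lemma flat_npos m s : s <= 0 -> flat m s = 0.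
Proof. by rewrite /flat ltNge => ->. Qed.

(** From exp y >= y^(m+2) / (m+2)! at y = 1/s. Quadratic smallness gives derivative 0 at the
    junction point. *)
Lemma flat_le m s : flat m s <= (m.+2)`!%:R * s ^+ 2.
Proof.
rewrite /flat; case: ifPn => s0; last by rewrite mulr_ge0// sqr_ge0.
have i0 : 0 < s^-1 by rewrite invr_gt0.
have f0 : 0 < (m.+2)`!%:R :> R by rewrite ltr0n fact_gt0.
rewrite expRN ler_pdivrMr ?expR_gt0//.
have h := expR_ge1Dxn m.+1 (ltW i0).
apply: (@le_trans _ _ ((m.+2)`!%:R * s ^+ 2 * (s^-1 ^+ m.+2 / (m.+2)`!%:R))).
  rewrite -[m.+2 in X in _ <= X]addn2 exprD addn2 le_eqVlt; apply/orP; left; apply/eqP.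
  move: (_%:R) f0 (s^-1 ^+ m) => c c0 y.
  by field; rewrite (lt0r_neq0 c0) (lt0r_neq0 s0).
rewrite ler_pM2l; last by rewrite mulr_gt0// exprn_gt0.
by apply: le_trans h; rewrite lerDr.
Qed.

Lemma is_derive_flat m (s : R) :
  is_derive s 1 (flat m) (flat m.+2 s - m%:R * flat m.+1 s).
Proof.
have [s0|s0|s0] := ltgtP 0 s.
- rewrite {2 3}/flat s0.
  apply: (@near_eq_is_derive R R^o R^o (fun t => t^-1 ^+ m * expR (- t^-1))).
    near=> t; rewrite /flat; suff -> : 0 < t by [].
    by near: t; exact: lt_nbhsr.
  have s1 : s != 0 by exact: lt0r_neq0.
  have Di := deriveVf (derive_idf s) s1.
  have De := derive_compf (is_derive_expR _) (deriveNf Di).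
  apply: (derive_eqf (deriveMf (deriveXf m Di) De)).
  case: m => [|m]; first by rewrite /= expr0; field.
  by rewrite /= !exprS; field.
- rewrite {2 3}/flat ltNge (ltW s0)/= mulr0 subrr.
  apply: (@near_eq_is_derive R R^o R^o (fun=> 0)).
  near=> t; rewrite flat_npos//; apply: ltW; near: t; exact: lt_nbhsl.
- rewrite -s0 {2 3}/flat ltxx mulr0 subrr.
  have h : (fun h => h^-1 *: (flat m (h *: 1 + 0) - flat m 0)) @ 0^' --> (0 : R).
    apply/cvgrPdist_le => eps eps0; near=> h.
    rewrite sub0r normrN (flat_npos m (lexx 0)) subr0 addr0 /GRing.scale/= mulr1.
    have h0 : h != 0 by near: h; exact: nbhs_dnbhs_neq.
    rewrite normrM (ger0_norm (flat_ge0 m h)) normfV.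
    rewrite ler_pdivrMl ?normr_gt0//.
    apply: le_trans (flat_le m h) _.
    rewrite -real_normK ?num_real// expr2 mulrA mulrC ler_wpM2l// mulrC -ler_pdivlMr ?ltr0n ?fact_gt0//.
    near: h; apply: dnbhs0_le.
    by rewrite divr_gt0// ltr0n fact_gt0.
  apply: DeriveDef; first by apply/cvg_ex; exists 0; exact: h.
  exact: cvg_lim h.
Unshelve. all: by end_near. Qed.

(* A class closed under differentiation, hence made of smooth functions. *)
Inductive elem : (R -> R) -> Prop :=
| elem_cst c : elem (fun=> c)
| elem_id : elem (fun x => x)
| elem_flat m : elem (flat m)
| elemD F G : elem F -> elem G -> elem (fun x => F x + G x)
| elemM F G : elem F -> elem G -> elem (fun x => F x * G x)
| elem_comp F G : elem F -> elem G -> elem (fun x => F (G x)).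

Lemma elem_derive F : elem F -> exists2 F', elem F' & forall x : R, is_derive x 1 F (F' x).
Proof.
elim=> {F} [c||m|F G eF [F' eF' dF] eG [G' eG' dG]|F G eF [F' eF' dF] eG [G' eG' dG]
           |F G eF [F' eF' dF] eG [G' eG' dG]].
- by exists (fun=> 0); [exact: elem_cst|move=> x; exact: derive_cstf].
- by exists (fun=> 1); [exact: elem_cst|move=> x; exact: derive_idf].
- exists (fun s => flat m.+2 s + - m%:R * flat m.+1 s).
    by apply: elemD; [exact: elem_flat|apply: elemM; [exact: elem_cst|exact: elem_flat]].
  by move=> x; apply: (derive_eqf (is_derive_flat m x)); rewrite mulNr.
- exists (fun x => F' x + G' x); first exact: elemD.
  by move=> x; exact: deriveDf.
- exists (fun x => F' x * G x + F x * G' x); first by apply: elemD; exact: elemM.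
  by move=> x; apply: (derive_eqf (deriveMf (dF x) (dG x))); ring.
- exists (fun x => F' (G x) * G' x); first by apply: elemM => //; exact: elem_comp.
  by move=> x; exact: derive_compf.
Qed.

Lemma derive1_is_derive F F' : (forall x : R, is_derive x 1 F (F' x)) -> F^`()%classic = F'.
Proof. by move=> dF; apply/funext => x; rewrite derive1E; have [_] := dF x. Qed.

Lemma elem_derive1n F j : elem F -> elem (F^`(j))%classic.
Proof.
move=> eF; elim: j => [//|j IH]; rewrite derive1nS.
by have [F' eF' /derive1_is_derive ->] := elem_derive IH.
Qed.

Lemma elem_class_C F k : elem F -> class_C k F.
Proof.
move=> eF; split => [j _ x|].
  by have [F' _ /(_ x) []] := elem_derive (elem_derive1n j eF).
by have [F' _ dF] := elem_derive (elem_derive1n k eF); exact: derive_continuousf dF.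
Qed.

Lemma elem_test_function F (a b : R) : elem F ->
  (forall x, ~~ (a <= x <= b) -> F x = 0) -> test_function F.
Proof.
move=> eF Fab; split => [k|]; first exact: elem_class_C.
apply: (subclosed_compact _ (@segment_compact R a b)); first exact: closed_closure.
rewrite [X in _ `<=` X](closure_id _).1; last exact: itv_closed.
apply: closureS => x /= Fx; rewrite in_itv/=; apply/negP => /negP.
by move/Fab/eqP; rewrite (negbTE Fx).
Qed.

End smooth.

(** * Mollification of the weak derivative *)

Section mollifier.
Context {R : realType}.
Local Notation mu := (@lebesgue_measure R).
Local Notation rint := (rintegrable mu).
Local Notation RR := (measurableTypeR R).

(** An even mollifier supported in |t| <= 1/k, not normalized: averages are divided by its
    integral. *)
Definition eta (k t : R) : R := flat 0 (1 - (k * t) ^+ 2).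

Lemma eta_ge0 k t : 0 <= eta k t. Proof. exact: flat_ge0. Qed.

Lemma eta_opp k t : eta k (- t) = eta k t.
Proof. by rewrite /eta mulrN sqrrN. Qed.

Lemma eta_out k t : 1 <= k -> 1 <= k * `|t| -> eta k t = 0.
Proof.
move=> k1 kt; have k0 : 0 <= k by rewrite (le_trans ler01).
rewrite /eta flat_npos// subr_le0 -real_normK ?num_real// normrM (ger0_norm k0).
by rewrite exprn_ege1.
Qed.

Lemma eta_le1 k t : eta k t <= 1.
Proof.
rewrite /eta /flat; case: ifPn => // s0; rewrite expr0 mul1r expR_le1 oppr_le0.
by rewrite invr_ge0 ltW.
Qed.

Lemma is_derive_eta k (t : R) :
  is_derive t 1 (eta k) (flat 2 (1 - (k * t) ^+ 2) * (- (2 * (k * t) * k))).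
Proof.
have D1 := deriveXf 2 (deriveMf (derive_cstf k t) (derive_idf t)).
have D := derive_compf (is_derive_flat 0 _) (deriveBf (derive_cstf 1 t) D1).
by apply: (derive_eqf D) => /=; rewrite mul0r subr0 expr1; ring.
Qed.

Lemma continuous_eta k : continuous (eta k).
Proof. exact: derive_continuousf (is_derive_eta k). Qed.

Lemma rintegrable_eta_M k x (h : R -> R) : 1 <= k -> continuous h ->
  rint (fun y => h y * eta k (x - y)).
Proof.
move=> k1 ch; have k0 : 0 < k by rewrite (lt_le_trans ltr01).
have cx : continuous (fun y => h y * eta k (x - y)).
  apply: continuousMf => //; apply: continuous_compf; first exact: continuous_eta.
  by apply: continuousBf; [exact: continuous_cst|exact: continuous_idf].
apply: eq_rintegrable (rintegrable_ind (`|x| + 1) cx) => y.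
rewrite indE; case: ifPn => [_|]; rewrite ?mul1r// mul0r -ltNge => yx.
rewrite eta_out ?mulr0//; apply: le_trans k1 _; rewrite ler_peMr ?(ltW k0)//.
have := ler_distD x 0 y; rewrite !sub0r !normrN => h1; lra.
Qed.

Lemma rintegrable_eta k : 1 <= k -> rint (eta k).
Proof.
move=> k1; have h := @rintegrable_eta_M k 0 (fun=> 1) k1 (@continuous_cst R 1).
apply: (eq_rintegrable _ h) => y.
by rewrite mul1r sub0r eta_opp.
Qed.

Lemma rintegral_eta_gt0 k : 1 <= k -> 0 < \int[mu]_t eta k t.
Proof.
move=> k1; have k0 : 0 < k by rewrite (lt_le_trans ltr01).
have N0 : 0 < (2 * k)^-1 by rewrite invr_gt0 mulr_gt0.
have [i1 e1] := rintegral_ind N0.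
(* For |t| <= 1/(2k) the argument of [flat 0] is at least 3/4, which gives this lower bound for
   [eta]. *)
have i2 := rintegrableZ (expR (- (3 / 4)^-1)) i1.
apply: (@lt_le_trans _ _ (\int[mu]_t (expR (- (3 / 4)^-1) * ind (2 * k)^-1 t))).
  by rewrite (rintegralZ _ i1) e1 mulr_gt0 ?expR_gt0// mulr_gt0.
apply: (le_rintegral i2 (rintegrable_eta k1)) => t.
rewrite indE; case: ifPn => [tk|_]; last by rewrite mulr0 eta_ge0.
have s34 : 3 / 4 <= 1 - (k * t) ^+ 2.
  have : (k * t) ^+ 2 <= (2^-1) ^+ 2.
    rewrite -real_normK ?num_real// ler_sqr ?nnegrE// normrM (gtr0_norm k0).
    by rewrite mulrC -ler_pdivlMr// -invfM.
  have -> : 2^-1 ^+ 2 = 4^-1 :> R by field.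
  lra.
have s0 : 0 < 1 - (k * t) ^+ 2 by apply: lt_le_trans s34; lra.
rewrite mulr1 /eta /flat s0 expr0 mul1r ler_expR lerN2 lef_pV2 ?posrE//; lra.
Qed.

(** Jensen's inequality for the square, obtained by integrating (h - c)^2 w with c the weighted mean
    of h. *)
Lemma rintegral_weighted_sqr_le (w h : R -> R) : (forall y, 0 <= w y) -> rint w ->
  rint (fun y => h y * w y) -> rint (fun y => h y ^+ 2 * w y) -> 0 < \int[mu]_y w y ->
  ((\int[mu]_y w y)^-1 * \int[mu]_y (h y * w y)) ^+ 2 <=
  (\int[mu]_y w y)^-1 * \int[mu]_y (h y ^+ 2 * w y).
Proof.
move=> w0 iw ih ih2 I0; set I := \int[mu]_y w y in I0 *.
set J := \int[mu]_y (h y * w y); pose c := I^-1 * J.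
have i3 := rintegrableD (rintegrableB ih2 (rintegrableZ (2 * c) ih)) (rintegrableZ (c ^+ 2) iw).
have : 0 <= \int[mu]_y (h y ^+ 2 * w y - 2 * c * (h y * w y) + c ^+ 2 * w y).
  apply: Rintegral_ge0 => y _.
  have -> : h y ^+ 2 * w y - 2 * c * (h y * w y) + c ^+ 2 * w y = (h y - c) ^+ 2 * w y by ring.
  by rewrite mulr_ge0 ?sqr_ge0.
rewrite (rintegralD (rintegrableB ih2 (rintegrableZ (2 * c) ih)) (rintegrableZ (c ^+ 2) iw)).
rewrite (rintegralB ih2 (rintegrableZ (2 * c) ih)) (rintegralZ _ ih) (rintegralZ _ iw) -/I -/J.
set X := \int[mu]_y (h y ^+ 2 * w y) => h0.
rewrite -[leLHS]mul1r -{1}(mulVf (lt0r_neq0 I0)) -mulrA ler_pM2l ?invr_gt0// -subr_ge0.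
suff -> : X - I * (I^-1 * J) ^+ 2 = X - 2 * c * J + c ^+ 2 * I by [].
by rewrite /c; field; exact: lt0r_neq0.
Qed.

Lemma le_limn_einf (v w : nat -> \bar R) : (forall n, (v n <= w n)%E) ->
  (limn_einf v <= limn_einf w)%E.
Proof.
move=> vw; rewrite !limn_einf_lim; apply: lee_lim; [exact: is_cvg_einfs|exact: is_cvg_einfs|].
apply: nearW => n; apply: le_ereal_inf_tmp => _ [m /= mn <-].
by apply: le_trans (vw m); apply: ereal_inf_lbound; exists m.
Qed.

Variables (psi psi1 g : R -> R).
Hypotheses (dpsi : forall x : R, is_derive x 1 psi (psi1 x)) (cpsi1 : continuous psi1)
  (mg : @measurable_fun _ _ RR R setT g) (g2 : rint (fun x => g x ^+ 2))
  (wd : weak_derivative psi g).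

Let cpsi : continuous psi. Proof. exact: derive_continuousf dpsi. Qed.

(** A translated mollifier is a test function, and classical integration by parts gives the same
    pairing with psi. So psi1 and g have equal averages, which replaces a proof that they agree
    almost everywhere. *)
Lemma weak_derivative_eta k x : 1 <= k ->
  \int[mu]_y (psi1 y * eta k (x - y)) = \int[mu]_y (g y * eta k (x - y)).
Proof.
move=> k1; have k0 : 0 < k by rewrite (lt_le_trans ltr01).
pose phi y := eta k (x - y).
pose dphi y := flat 2 (1 - (k * (x - y)) ^+ 2) * (2 * (k * (x - y)) * k).
have D (y : R) : is_derive y 1 phi (dphi y).
  have := @derive_compf _ (eta k) (fun y => x - y) y _ _ (is_derive_eta k (x - y)) (deriveBf (derive_cstf x y) (derive_idf y)).
  by move=> /derive_eqf; apply; rewrite /dphi; ring.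
have cl : continuous (fun y => x - y).
  by apply: continuousBf; [exact: continuous_cst|exact: continuous_idf].
have cphi : continuous phi by exact: derive_continuousf D.
have cf2 : continuous (flat 2 : R -> R) by exact: derive_continuousf (is_derive_flat 2).
have ckl : continuous (fun y => k * (x - y)) by apply: continuousMf => //; exact: continuous_cst.
have cdphi : continuous dphi.
  apply: continuousMf.
    apply: continuous_compf => //; apply: continuousBf; first exact: continuous_cst.
    exact: continuousXf.
  apply: continuousMf; last exact: continuous_cst.
  by apply: continuousMf => //; exact: continuous_cst.
have far y : `|x| + 1 <= `|y| -> 1 <= k * `|x - y|.
  move=> yx; apply: le_trans k1 _; rewrite ler_peMr ?(ltW k0)//.
  have := ler_distD x 0 y; rewrite !sub0r !normrN => h1; lra.
have phi0 y : `|x| + 1 <= `|y| -> phi y = 0 by move=> /far; exact: eta_out.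
have dphi0 y : `|x| + 1 <= `|y| -> dphi y = 0.
  move=> /far h; rewrite /dphi flat_npos ?mul0r// subr_le0 -real_normK ?num_real//.
  by rewrite normrM (gtr0_norm k0) exprn_ege1.
have M0 : 0 < `|x| + 1 by rewrite ltr_wpDl.
have indM0 (h w : R -> R) : (forall y, `|x| + 1 <= `|y| -> w y = 0) ->
    forall y, ind (`|x| + 1) y * (h y * w y) = h y * w y.
  move=> hw y; rewrite indE; case: ifPn => [_|]; rewrite ?mul1r// mul0r -ltNge => /ltW yx.
  by rewrite hw// mulr0.
have tf : test_function phi.
  apply: (@elem_test_function _ _ (- (`|x| + 1)) (`|x| + 1)).
    (* The class [elem] has sums and products but no subtraction, hence the factors -1. *)
    have -> : phi = (fun y => flat 0 (1 + -1 * ((k * (x + -1 * y)) * (k * (x + -1 * y))))).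
      by apply/funext => y; rewrite /phi /eta; congr flat; ring.
    by apply: (@elem_comp _ (flat 0)); repeat (first [exact: elem_flat|exact: elem_cst
      |exact: elem_id|apply: elemD|apply: elemM]).
  by move=> y; rewrite -ler_norml -ltNge => /ltW; exact: phi0.
have := wd tf; rewrite (derive1_is_derive D) => w.
have DD (y : R) : is_derive y 1 (fun y => psi y * phi y) (psi1 y * phi y + psi y * dphi y).
  by apply: (derive_eqf (deriveMf (dpsi y) (D y))); ring.
have c1 : continuous (fun y => psi1 y * phi y) by exact: continuousMf.
have c2 : continuous (fun y => psi y * dphi y) by exact: continuousMf.
have := rintegral_ind_FTC M0 DD (continuousDf c1 c2).
have M1 : `|x| + 1 <= `| `|x| + 1 | by rewrite (gtr0_norm M0).
have M2 : `|x| + 1 <= `|- (`|x| + 1)| by rewrite normrN (gtr0_norm M0).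
rewrite (phi0 _ M1) (phi0 _ M2) !mulr0 subrr.
have i1 := rintegrable_ind (`|x| + 1) c1; have i2 := rintegrable_ind (`|x| + 1) c2.
move=> h; have : \int[mu]_y (psi1 y * phi y) + \int[mu]_y (psi y * dphi y) = 0.
  have j1 : rint (fun y => psi1 y * phi y) by apply: eq_rintegrable i1; exact: indM0.
  have j2 : rint (fun y => psi y * dphi y) by apply: eq_rintegrable i2; exact: indM0.
  rewrite -(rintegralD j1 j2) -[RHS]h; apply: eq_rintegral => y.
  by rewrite mulrDr indM0// indM0.
by rewrite w => /eqP; rewrite subr_eq0 => /eqP.
Qed.

Let K j : R := j.+1%:R.
Let K1 j : 1 <= K j. Proof. by rewrite ler1n. Qed.
Let I j := \int[mu]_t eta (K j) t.
Let I0 j : 0 < I j. Proof. exact: rintegral_eta_gt0. Qed.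

Let H j x := (I j)^-1 * \int[mu]_y (g y ^+ 2 * eta (K j) (x - y)).

Let eta_shift j x : rint (fun y => eta (K j) (x - y)) /\ \int[mu]_y eta (K j) (x - y) = I j.
Proof.
have ie := rintegrable_eta (K1 j).
by split; [exact: rintegrable_reflect ie|exact: rintegral_reflect].
Qed.

Let eta_conv j : [/\ rint (H j), \int[mu]_x H j x = \int[mu]_x g x ^+ 2,
  (forall x, rint (fun y => g y ^+ 2 * eta (K j) (x - y))) &
  (forall x, rint (fun y => g y * eta (K j) (x - y)))].
Proof.
have ie := rintegrable_eta (K1 j).
have F := rintegrable_conv g2 ie; have [h1 h2] := rfubini2 F.
have E x : \int[mu]_y (g y ^+ 2 * eta (K j) (x - y)) = \int[mu]_y (g y ^+ 2 * eta (K j) (y - x)).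
  by apply: eq_rintegral => y; rewrite -eta_opp opprB.
have meta x : @measurable_fun _ _ RR R setT (fun y => eta (K j) (x - y)).
  exact: rintegrable_measurable (eta_shift j x).1.
split.
- apply: (eq_rintegrable _ (rintegrableZ (I j)^-1 h1)) => x /=; by rewrite /H E.
- rewrite (_ : \int[mu]_x H j x = \int[mu]_x ((I j)^-1 * \int[mu]_y (g y ^+ 2 * eta (K j) (y - x)))).
    rewrite (rintegralZ _ h1) h2 (rintegral_conv g2 ie) -/(I j) mulrCA mulVf ?mulr1//.
    exact: lt0r_neq0.
  by apply: eq_rintegral => x; rewrite /H E.
- move=> x; apply: (le_rintegrable _ _ g2).
    by apply: measurable_funM => //; exact: rintegrable_measurable g2.
  move=> y; rewrite normrM ger0_norm ?sqr_ge0// ler_piMr ?sqr_ge0// ger0_norm ?eta_ge0//.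
  exact: eta_le1.
- move=> x; apply: rintegrableM_sqr => //.
  apply: (le_rintegrable _ _ (eta_shift j x).1); first exact: measurable_funX.
  move=> y; rewrite ger0_norm ?sqr_ge0// expr2 ler_piMr ?eta_ge0//; exact: eta_le1.
Qed.

Let G j x := (I j)^-1 * \int[mu]_y (psi1 y * eta (K j) (x - y)).

Let GH j x : G j x ^+ 2 <= H j x.
Proof.
have [_ _ h1 h2] := eta_conv j; have [h3 h4] := eta_shift j x.
rewrite /G /H weak_derivative_eta// -h4.
apply: (rintegral_weighted_sqr_le _ h3 (h2 x) (h1 x)); first by move=> y; exact: eta_ge0.
by rewrite h4; exact: I0.
Qed.

Let cvg_G x : (fun j => G j x) @ \oo --> psi1 x.
Proof.
apply/cvgrPdist_le => eps eps0.
have := @cpsi1 x; move/cvgrPdist_le => /(_ _ eps0) /nbhs_ballP [del /= del0 hdel].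
near=> j.
have [h3 h4] := eta_shift j x.
have i1 := rintegrable_eta_M x (K1 j) cpsi1.
have -> : psi1 x - G j x = (I j)^-1 * \int[mu]_y (psi1 x * eta (K j) (x - y) - psi1 y * eta (K j) (x - y)).
  rewrite (rintegralB (rintegrableZ (psi1 x) h3) i1) (rintegralZ _ h3) h4 /G.
  by field; exact: lt0r_neq0.
have Ij0 : 0 < (I j)^-1 by rewrite invr_gt0; exact: I0.
rewrite normrM (gtr0_norm Ij0) (ler_pdivrMl _ _ (I0 j)).
have -> : I j * eps = \int[mu]_y (eps * eta (K j) (x - y)) by rewrite (rintegralZ _ h3) h4 mulrC.
apply: (rintegral_norm_le (rintegrableB (rintegrableZ (psi1 x) h3) i1) (rintegrableZ eps h3)).
move=> y; rewrite -mulrBl normrM (ger0_norm (eta_ge0 _ _)).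
have [far|near] := leP 1 (K j * `|x - y|); first by rewrite (eta_out (K1 j) far) !mulr0.
rewrite ler_wpM2r ?eta_ge0//; apply: hdel; rewrite /ball/=.
have K0 : 0 < K j by exact: ltr0Sn.
apply: (@lt_trans _ _ (K j)^-1); first by rewrite -[ltRHS]mul1r ltr_pdivlMr// mulrC.
near: j.
have := @cvg_harmonic R; move/cvgrPdist_lt => /(_ _ del0); apply: filterS => j /=.
by rewrite sub0r normrN gtr0_norm ?invr_gt0.
Unshelve. all: by end_near. Qed.

(** The averages G j of psi1 converge to psi1, their squares are at most H j by Jensen, and every H
    j has the same integral as g^2. Fatou's lemma concludes. *)
Lemma rintegrable_classical_derivative_sqr : rint (fun x => psi1 x ^+ 2).
Proof.
have m2 : measurable_fun setT (fun x : RR => psi1 x ^+ 2).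
  by apply: continuous_rmeasurable; exact: continuousXf.
apply/integrableP; split; first exact/measurable_EFinP.
have mH j : measurable_fun setT (fun x : RR => (H j x)%:E).
  by apply/measurable_EFinP; have [h _ _ _] := eta_conv j; exact: rintegrable_measurable h.
apply: (@le_lt_trans _ _ (\int[mu]_x g x ^+ 2)%:E); last exact: ltry.
apply: (@le_trans _ _ (\int[mu]_x limn_einf (fun j => (H j x)%:E))%E).
  apply: ge0_le_integral => //.
  - exact/measurable_EFinP/measurableT_comp.
  (* The lower limit is handled as the opposite of the upper limit of the opposites. *)
  - have mN (v : RR -> \bar R) : measurable_fun setT v -> measurable_fun setT (fun x => - v x)%E.
      by move=> mv; exact: measurableT_comp.
    apply: (mN _); apply: (@measurable_fun_limn_esup _ RR R setT (fun j x => - (H j x)%:E)%E) => j.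
    exact: (mN _ (mH j)).
  - move=> x _; rewrite /= ger0_norm ?sqr_ge0//.
    have c2 : (fun j => (G j x ^+ 2)%:E) @ \oo --> (psi1 x ^+ 2)%:E.
      have c1 : (fun j => G j x ^+ 2) @ \oo --> psi1 x ^+ 2.
        by under eq_fun do rewrite expr2; rewrite expr2; apply: cvg_seqM; exact: cvg_G.
      by apply: cvg_EFin; [exact: nearW|exact: c1].
    rewrite -(cvg_limn_einf_sup c2).1; apply: le_limn_einf => j.
    by rewrite lee_fin.
apply: le_trans (fatou mu measurableT mH _) _.
  by move=> j x _; rewrite lee_fin; apply: le_trans (GH j x); exact: sqr_ge0.
rewrite (_ : (fun j => _) = fun=> (\int[mu]_x g x ^+ 2)%:E).
  by rewrite (cvg_limn_einf_sup (cvg_cst _)).1.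
by apply/funext => j; have [h e _ _] := eta_conv j; rewrite -e rintegral_EFin.
Qed.

End mollifier.

(** * Conclusion *)

Section conclusion.
Context {R : realType}.
Local Notation mu := (@lebesgue_measure R).
Local Notation rint := (rintegrable mu).
Local Notation RR := (measurableTypeR R).

(** At a point where h does not vanish, continuity keeps the power above half its value on a small
    interval, which makes the integral positive. The exponent is a general positive even number; n =
    2 gives 6. *)
Lemma rintegral_even_power_eq0 (h : R -> R) n : continuous h ->
  rint (fun x => h x ^+ n.*2.+2) -> \int[mu]_x (h x ^+ n.*2.+2) <= 0 -> forall x, h x = 0.
Proof.
move=> ch ih le0 x0; apply/eqP; apply: contraT => hx.
have ev y : 0 <= h y ^+ n.*2.+2.
  by apply: exprn_even_ge0; rewrite /= odd_double.
have p0 : 0 < h x0 ^+ n.*2.+2 by rewrite lt_neqAle ev andbT eq_sym expf_neq0.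
set m := h x0 ^+ n.*2.+2 / 2.
have m0 : 0 < m by exact: divr_gt0.
have cp := continuousXf (n := n.*2.+2) ch.
have := cp x0; move/cvgrPdist_le => /(_ _ m0) /nbhs_ballP [d /= d0 hd].
have d2 : 0 < d / 2 by exact: divr_gt0.
have [i1 e1] := rintegral_ind d2.
have i2 := rintegrable_shift (- x0) i1.
have : \int[mu]_y (m * ind (d / 2) (y + - x0)) <= \int[mu]_y (h y ^+ n.*2.+2).
  apply: (le_rintegral (rintegrableZ m i2) ih) => y; rewrite indE.
  case: ifPn => [yx|_]; last by rewrite mulr0.
  rewrite mulr1; have : `|h x0 ^+ n.*2.+2 - h y ^+ n.*2.+2| <= m.
    apply: hd; rewrite /ball/= distrC; apply: le_lt_trans yx _.
    by rewrite ltr_pdivrMr// ltr_pMr// ltr1n.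
  move=> /(le_trans (ler_norm _)); rewrite /m; move: (h x0 ^+ _) (h y ^+ _) => a b; lra.
rewrite (rintegralZ _ i2) (rintegral_shift (- x0) i1) e1 => h1.
have : 0 < m * (2 * (d / 2)) by apply: mulr_gt0 => //; exact: mulr_gt0.
by move=> /lt_le_trans /(_ h1) /lt_le_trans /(_ le0); rewrite ltxx.
Qed.

(** The derivative 4 psi^3 psi' of psi^4 is integrable, being a product of two square integrable
    functions, so psi^4 has finite variation on the line. Finally psi^2 <= 1 + psi^4. *)
Lemma sqr_bounded (psi psi1 : R -> R) : (forall x : R, is_derive x 1 psi (psi1 x)) ->
  continuous psi1 -> rint (fun x => psi1 x ^+ 2) -> rint (fun x => psi x ^+ 6) ->
  exists C, forall x, psi x ^+ 2 <= C.
Proof.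
move=> dpsi c1 iK iS; have cpsi := derive_continuousf dpsi.
pose D := \int[mu]_x (2 * (psi1 x ^+ 2 + psi x ^+ 6)).
have iD := rintegrableZ 2 (rintegrableD iK iS).
pose d x := 4 * (psi x ^+ 3 * psi1 x).
have cd : continuous d.
  apply: continuousMf; first exact: continuous_cst.
  by apply: continuousMf => //; exact: continuousXf.
have dd (x : R) : is_derive x 1 (fun x => psi x ^+ 4) (d x).
  by apply: (derive_eqf (deriveXf 4 (dpsi x))); rewrite /d /=; ring.
have var a b : a < b -> `|psi b ^+ 4 - psi a ^+ 4| <= D.
  move=> ab; rewrite -(rintegral_itv_FTC ab dd cd).
  apply: (rintegral_norm_le (rintegrable_itv _ _ cd) iD) => x.
  have le : `|d x| <= 2 * (psi1 x ^+ 2 + psi x ^+ 6).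
    rewrite /d (exprM (psi x) 3 2); have h1 := sqr_ge0 (psi x ^+ 3 - psi1 x).
    have h2 := sqr_ge0 (psi x ^+ 3 + psi1 x).
    by move: (psi x ^+ 3) (psi1 x) h1 h2 => p q h1 h2; rewrite ler_norml; apply/andP; split; lra.
  rewrite normrM -[leRHS]mul1r; apply: ler_pM => //.
  by rewrite indicE; case: (_ \in _); rewrite ?normr1 ?normr0.
exists (1 + (psi 0 ^+ 4 + D)) => x.
have h4 : psi x ^+ 4 <= psi 0 ^+ 4 + D.
  have [x0|x0|<-] := ltgtP 0 x.
  - have := var _ _ x0 => /(le_trans (ler_norm _)); lra.
  - have := var _ _ x0; rewrite distrC => /(le_trans (ler_norm _)); lra.
  - rewrite lerDl; apply: Rintegral_ge0 => y _.
    by rewrite mulr_ge0// addr_ge0 ?sqr_ge0// exprn_even_ge0.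
apply: (@le_trans _ _ (1 + psi x ^+ 4)); last by rewrite lerD2l.
rewrite (exprM _ 2 2); have := sqr_ge0 (psi x ^+ 2 - 1); have := sqr_ge0 (psi x).
by move: (psi x ^+ 2) => p; nra.
Qed.

(** In the extreme case K = (B/3) S with S > 0 the virial inequality reads c a^2 - 4 B a + c B >= 0.
    This quadratic is smallest at a = 2 B / c, with value B (c^2 - 4 B) / c < 0. *)
Lemma virial_pohozaev_le0 (c B K S : R) : 0 < c -> c ^+ 2 / 4 < B -> 0 <= K ->
  (forall a, 0 < a -> a * (K + B * S) <= c * (K + a ^+ 2 / 3 * S)) -> K <= B / 3 * S -> S <= 0.
Proof.
move=> c0 cB K0 vir poh; have B0 : 0 < B by apply: le_lt_trans cB; rewrite divr_ge0 ?sqr_ge0.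
have a0 : 0 < 2 * B / c by rewrite divr_gt0// mulr_gt0.
have := ler_wpM2l (ltW c0) (vir _ a0).
have -> : c * (2 * B / c * (K + B * S)) = 2 * B * K + 2 * B ^+ 2 * S by field; exact: lt0r_neq0.
have -> : c * (c * (K + (2 * B / c) ^+ 2 / 3 * S)) = c ^+ 2 * K + 4 / 3 * B ^+ 2 * S.
  by field; exact: lt0r_neq0.
move=> h; rewrite leNgt; apply/negP => S0.
have h2 : 2 / 3 * B ^+ 2 * S <= (c ^+ 2 - 2 * B) * K by lra.
have p0 : 0 < B ^+ 2 * S by rewrite mulr_gt0 ?exprn_gt0.
(* The upper bound on K can be inserted only when its coefficient is nonnegative; in the other case
   the sign alone contradicts S > 0. *)
have [n|/ltW p] := leP (c ^+ 2 - 2 * B) 0.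
  have : (c ^+ 2 - 2 * B) * K <= 0 by rewrite mulr_le0_ge0.
  lra.
have h3 := ler_wpM2l p poh.
have h4 : (4 * B - c ^+ 2) * (B / 3 * S) > 0.
  rewrite mulr_gt0// ?subr_gt0; first by lra.
  by rewrite mulr_gt0// divr_gt0.
lra.
Qed.

Lemma continuous_bounded_itv (h : R -> R) N : continuous h ->
  exists C, forall x, `|x| <= N -> `|h x| <= C.
Proof.
move=> ch; have [N0|N0] := leP 0 N; last first.
  by exists 0 => x /le_lt_trans /(_ N0); rewrite normr_lt0.
have ab : - N <= N by lra.
have cn : continuous (fun x => `|h x|) by move=> x; apply: cvg_norm; exact: ch.
have [c _ hc] := EVT_max ab (continuous_subspaceT cn).
by exists `|h c| => x; rewrite ler_norml => xN; apply: hc; rewrite in_itv.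
Qed.

End conclusion.

Theorem theorem7p2 (R : realType) (gamma B : R) (psi : R -> R) :
  gamma < 0 ->
  gamma ^+ 2 / 4 < B ->
  dotH1_L6 psi ->
  class_C 2 psi ->
  (forall x : R,
     - (psi^`(2))%classic x + B * `|psi x| ^+ 4 * psi x
       + gamma * psi x * absD (fun y : R => `|psi y| ^+ 2) x = 0) ->
  forall x : R, psi x = 0.
Proof.
move=> g0 gB [L6 [g gL2 wd]] [C2d C2c] eqn.
pose psi1 := (psi^`())%classic; pose psi2 := (psi^`(2))%classic.
have dpsi (x : R) : is_derive x 1 psi (psi1 x).
  by rewrite /psi1 derive1E; apply: derivableP; exact: (C2d 0%N).
have dpsi1 (x : R) : is_derive x 1 psi1 (psi2 x).
  by rewrite /psi2 derive1nS derive1E; apply: derivableP; exact: (C2d 1%N).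
have cpsi1 : continuous psi1 by exact: derive_continuousf dpsi1.
have cpsi : continuous psi by exact: derive_continuousf dpsi.
have iS : rintegrable (@lebesgue_measure R) (fun x => psi x ^+ 6).
  have h1 : (1 : R) <= 6 by rewrite ler1n.
  apply: eq_rintegrable (Lfun_integrable h1 L6) => x.
  by rewrite powR_mulrn// (exprM _ 2 3) real_normK ?num_real// -exprM.
have [mg _] : @measurable_fun _ _ (measurableTypeR R) R setT g /\ True.
  by split => //; move: gL2; rewrite inE => /andP[]; rewrite inE.
have iK := rintegrable_classical_derivative_sqr dpsi cpsi1 mg (Lfun2_integrable_sqr gL2) wd.
have [C psiC] := sqr_bounded dpsi cpsi1 iK iS.
pose f x := 2 * psi x * psi1 x.
have drho (x : R) : is_derive x 1 (fun x => psi x ^+ 2) (f x).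
  exact: (derive_eqf (deriveXf 2 (dpsi x))).
pose u := hilbert f.
have absDE x : absD (fun y : R => `|psi y| ^+ 2) x = u x.
  rewrite /absD (_ : (fun y => _) = fun y => psi y ^+ 2).
    by rewrite (derive1_is_derive drho).
  by apply/funext => y; rewrite real_normK ?num_real.
have equ x : psi2 x = B * psi x ^+ 5 + gamma * psi x * u x.
  have := eqn x; rewrite absDE (exprM _ 2 2) real_normK ?num_real// -/psi2.
  by move=> /eqP; rewrite -addrA addrC subr_eq0 => /eqP <-; ring.
(* The continuous second derivative of psi makes (psi^2)' locally Lipschitz, which is what the
   principal value of its Hilbert transform requires at every point. *)
pose f' x := 2 * (psi1 x * psi1 x + psi x * psi2 x).
have df (x : R) : is_derive x 1 f (f' x).
  have D := deriveMf (deriveMf (derive_cstf 2 x) (dpsi x)) (dpsi1 x).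
  by apply: (derive_eqf D); rewrite /f'; ring.
have cf : continuous f by exact: derive_continuousf df.
have cf' : continuous f'.
  apply: continuousMf; first exact: continuous_cst.
  by apply: continuousDf; exact: continuousMf.
have f2 : rintegrable (@lebesgue_measure R) (fun x => f x ^+ 2).
  exact: rintegrable_density_derivative_sqr dpsi dpsi1 psiC iK.
have hu (x : R) (e_ : nat -> R) : (forall n, 0 < e_ n) -> e_ @ \oo --> (0 : R) ->
    (fun n => conj_poisson (e_ n) f x) @ \oo --> pi * u x.
  move=> e0 el; have [C' hC'] := continuous_bounded_itv (`|x| + 1) cf'.
  exact: (conj_poisson_hilbert cf df f2 hC' (lexx _) e0 el).
have hb (N : R) : exists Cv : R, forall x e : R, `|x| <= N -> 0 < e ->
    `|conj_poisson e f x| <= Cv.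
  have [C' hC'] := continuous_bounded_itv (N + 1) cf'.
  by eexists => x e xN e0; exact: (conj_poisson_bound cf df f2 hC' xN e0).
have B0 : 0 < B by apply: le_lt_trans gB; rewrite divr_ge0 ?sqr_ge0.
have poh := pohozaev_inequality g0 dpsi dpsi1 C2c psiC iK iS equ hu hb.
have vir a (a0 : 0 < a) := virial_inequality g0 B0 dpsi dpsi1 C2c psiC iK iS equ hu hb a0.
apply: (@rintegral_even_power_eq0 R psi 2 cpsi iS).
apply: (virial_pohozaev_le0 (c := - gamma) _ _ _ vir poh); first by rewrite oppr_gt0.
  by rewrite sqrrN.
by apply: Rintegral_ge0 => x _; exact: sqr_ge0.
Qed.
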